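(* Let $\mathsf P$ be a fixed law of intrinsic dimension $r$ with generative leap exponent $k^\star$, let $\gamma>0$, and let $D=D(d)=O((\log d)^2)$ and $n=n(d)=O(d^{k^\star/2-\gamma})$. Consider the problem of testing $\mathbb H_1$ against $\mathbb H_0$ from $n$ samples, as defined in the context, in the regime $d\gg\max(r,k^\star)$ ($d\to\infty$ with $\mathsf P$ fixed). Then the degree-$D$ likelihood ratio satisfies $$\|\mathcal R_{\le D}\|_{L^2(\mathbb H_0)}=1+o_d(1).$$
   Context: Law and leap decomposition. Fix $r\ge1$. $\gamma_m$ denotes the standard Gaussian measure on $\mathbb R^m$. $\mathsf P$ is a probability measure on $\mathbb R^r\times\mathbb R$; $(Z,Y)\sim\mathsf P$ has $Z\sim\gamma_r$. Intrinsic dimension $r$ means: there is no proper subspace $S\subsetneq\mathbb R^r$ such that $Z_{S^\perp}$ is independent of $(Z_S,Y)$, where $Z_S$ is the orthogonal projection of $Z$ onto $S$. For a subspace $S$ (with $\emptyset$ denoting $\{0\}$) put $\bar Z_S=Z_{S^\perp}$, $\bar Y_S=(Z_S,Y)$. The normalized Hermite tensors on $\mathbb R^m$ are $\mathbf h_k(u)=\frac{(-1)^k}{\sqrt{k!}}\frac{\nabla^{\otimes k}\gamma_m(u)}{\gamma_m(u)}$, where $\gamma_m(u)$ is the Gaussian density (for $S^\perp$, identify $S^\perp$ with $\mathbb R^{\dim S^\perp}$). Define $\zeta_{k,S}=\mathbb E[\mathbf h_k(\bar Z_S)\mid\bar Y_S]\in(S^\perp)^{\otimes k}$, $\Lambda_k(S)=\mathbb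 E[\zeta_{k,S}(\bar Y_S)\otimes\zeta_{k,S}(\bar Y_S)]$, $\lambda_k^2(S)=\mathbb E\|\zeta_{k,S}(\bar Y_S)\|_F^2$, and $k(S)=\min\{k\ge1:\lambda_k^2(S)>0\}$. The span of a tensor is the column space of its unfolding along the first index into a matrix. The leap decomposition is $S_0=\emptyset$, $k_{i+1}=k(S_i)$, $S_{i+1}=S_i+\mathrm{span}[\Lambda_{k_{i+1}}(S_i)]$, until $S_L=\mathbb R^r$; the generative leap exponent is $k^\star=\max_i k_i$. Testing problem. Let $\bar S$ be a subspace of the flag $(S_i)_{i<L}$ with $k(\bar S)=k^\star$, and $r_0=\dim\bar S<r$. Let the effective label be $\bar y=(z_{\bar S},y)\in\mathbb R^{r_0+1}$, with marginal law $\mathsf P_{\bar y}$ under $\mathsf P$. View $\mathsf P$ as the joint law of $(z_{\bar S^\perp},\bar y)\in\mathbb R^{r-r_0}\times\mathbb R^{r_0+1}$. The planted directions associated with $\bar S$ are regarded as known (one conditions on them), and the effective input is $\bar x\in\mathbb R^{d-r_0}$, the component of the input orthogonal to them. For $\tilde W\in\mathbb R^{(d-r_0)\times(r-r_0)}$ with orthonormal columns, $\mathbb P_{\tilde W}$ is the law of $(\bar x,\bar y)$ with $\bar x\sim\gamma_{d-r_0}$ and conditional law $\mathbb P_{\tilde W}(\bar y\mid\bar x)=\mathsf P(\bar y\mid z_{\bar S^\perp}=\tilde W^\top\bar x)$. - $\mathbb H_1$: draw $\tilde W$ from the Haar (uniform) measure on matrices with orthonormal columns, then $n$ i.i.d.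 samples from $\mathbb P_{\tilde W}$. - $\mathbb H_0$: $n$ i.i.d. samples from $\mathbb P_0=\gamma_{d-r_0}\otimes\mathsf P_{\bar y}$. $\mathcal R=d\mathbb H_1/d\mathbb H_0$ is the likelihood ratio and $\mathcal R_{\le D}$ its orthogonal projection in $L^2(\mathbb H_0)$ onto functions that are polynomials of total degree at most $D$ in the inputs $\bar x_1,\dots,\bar x_n$ (with coefficients arbitrary functions of the labels $\bar y_1,\dots,\bar y_n$). That is, $\mathcal R_{\le D}$ is the element $f$ of this space with $\mathbb E_{\mathbb H_0}[f\,p]=\mathbb E_{\mathbb H_1}[p]$ for all $p$ in this space (this is the meaning used if $\mathcal R$ itself is not in $L^2(\mathbb H_0)$). *)

(* Defs.v *)
From HB Require Import structures.
From mathcomp Require Import all_boot all_order all_algebra.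
From mathcomp Require Import all_classical all_reals all_analysis.
From mathcomp Require Import measurable_realfun.

Set Implicit Arguments.
Unset Strict Implicit.
Unset Printing Implicit Defensive.

Import Order.TTheory GRing.Theory Num.Theory.
Import numFieldNormedType.Exports.

Local Open Scope classical_set_scope.
Local Open Scope ring_scope.

Definition matrix_display : measure_display -> measure_display.
Proof. exact. Qed.

Section measurable_matrix.
Context d (T : measurableType d) (m n : nat).

(* The sigma-algebra generated by the entries (the Borel one when T is R); it
   also serves for the spaces 'rV[R]_m that stand for R^m below. *)
Definition matrix_sigma : set (set 'M[T]_(m, n)) :=
  <<s \bigcup_(ij in [set: 'I_m * 'I_n])
        preimage_set_system setT (fun A : 'M[T]_(m, n) => A ij.1 ij.2)
          measurable >>.

Let sigma0 : matrix_sigma set0.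
Proof. exact: sigma_algebra0. Qed.

Let sigmaC A : matrix_sigma A -> matrix_sigma (~` A).
Proof. exact: sigma_algebraC. Qed.

Let sigmaU (F : _^nat) :
  (forall i, matrix_sigma (F i)) -> matrix_sigma (\bigcup_i F i).
Proof. exact: sigma_algebra_bigcup. Qed.

HB.instance Definition _ := @isMeasurable.Build (matrix_display d)
  'M[T]_(m, n) matrix_sigma sigma0 sigmaC sigmaU.

Lemma measurable_coef (i : 'I_m) (j : 'I_n) :
  measurable_fun setT (fun A : 'M[T]_(m, n) => A i j).
Proof.
move=> _ B mB; rewrite setTI; apply: sub_sigma_algebra.
by exists (i, j) => //; exists B => //; rewrite setTI.
Qed.

Lemma measurable_to_matrix d' (U : measurableType d') (f : U -> 'M[T]_(m, n)) :
  (forall i j, measurable_fun setT (fun x => f x i j)) -> measurable_fun setT f.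
Proof.
move=> mf _ A mA; have : image_set_system setT f measurable A; last by [].
move: A mA; apply: smallest_sub.
  exact/sigma_algebra_image/sigma_algebra_measurable.
move=> _ [[i j] _ [B mB <-]]; rewrite /image_set_system/= setTI setTI.
by rewrite -comp_preimage -[X in measurable X]setTI; exact: mf.
Qed.

End measurable_matrix.


Section law.
Context d d' (T : measurableType d) (T' : measurableType d') (R : realType).

Definition law (P : probability T R) (f : T -> T') (mf : measurable_fun setT f)
  : probability T' R := distribution P (mfun_Sub (mem_set mf : f \in mfun)).

End law.

Section iid.
Context d (T : measurableType d) (R : realType).

Lemma measurable_cons_pair n :
  measurable_fun setT (fun tt : T * n.-tuple T => [tuple of tt.1 :: tt.2]).
Proof. exact: measurable_cons. Qed.

(* The n-fold product P^n, as a law on n-tuples. *)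
Fixpoint iid (n : nat) (P : probability T R) : probability (n.-tuple T) R :=
  match n with
  | 0 => \d_[tuple]
  | n.+1 => law (P \x iid n P)%E (@measurable_cons_pair n)
  end.

End iid.

Section gaussian.
Context {R : realType}.

Lemma measurable_row n : measurable_fun setT (fun t : n.-tuple R => \row_i tnth t i).
Proof.
apply: measurable_to_matrix => i j.
by under eq_fun do rewrite mxE; exact: measurable_tnth.
Qed.

Definition gauss (m : nat) : probability 'rV[R]_m R :=
  law (iid m (normal_prob 0 1)) (@measurable_row m).

End gaussian.

Section kernel_fiber.
Context d d' (X : measurableType d) (Y : measurableType d') (R : realType).
Variables (k : R.-pker X ~> Y) (x : X).

(* [k x] repackaged with its structure of probability measure. *)
Definition kfiber : set Y -> \bar R := k x.

HB.instance Definition _ := Measure.on kfiber.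

Let kfiber_setT : kfiber setT = 1%E.
Proof. exact: prob_kernel. Qed.

HB.instance Definition _ := Measure_isProbability.Build _ _ _ kfiber kfiber_setT.

End kernel_fiber.

Section kernel_comap.
Context d d' d'' (Z : measurableType d'') (X : measurableType d)
  (Y : measurableType d') (R : realType).
Variables (k : R.-pker X ~> Y) (f : Z -> X).

Definition kcomap (mf : measurable_fun setT f) : Z -> {measure set Y -> \bar R} :=
  k \o f.

Hypothesis mf : measurable_fun setT f.

Let kcomap_measurable U : measurable U -> measurable_fun [set: Z] (kcomap mf ^~ U).
Proof.
move=> mU; exact: (measurableT_comp (f := fun x => k x U) (measurable_kernel k U mU) mf).
Qed.

HB.instance Definition _ :=
  isKernel.Build _ _ Z Y R (kcomap mf) kcomap_measurable.

Let kcomap_prob z : kcomap mf z setT = 1%E.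
Proof. exact: prob_kernel. Qed.

HB.instance Definition _ :=
  Kernel_isProbability.Build _ _ Z Y R (kcomap mf) kcomap_prob.

End kernel_comap.

Section kernel_iid.
Context d d' (X : measurableType d) (Y : measurableType d') (R : realType).
Variables (k : R.-pker X ~> Y).

Definition kiid (n : nat) (x : X) : {measure set (n.-tuple Y) -> \bar R} :=
  iid n (kfiber k x).

Let kiid_prob n x : kiid n x setT = 1%E.
Proof. exact: probability_setT. Qed.

Lemma measurable_kiid n U : measurable U -> measurable_fun [set: X] (kiid n ^~ U).
Proof.
elim: n U => [|n IH] U mU; first exact: measurable_cst.
pose kn := kiid n.
pose i1 := isKernel.Build _ _ X (n.-tuple Y) R kn IH.
pose k1 : R.-ker X ~> n.-tuple Y := HB.pack kn i1.
pose i2 := Kernel_isProbability.Build _ _ X (n.-tuple Y) R k1 (@kiid_prob n).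
pose k2 : R.-pker X ~> n.-tuple Y := HB.pack kn i1 i2.
have mf : measurable_fun setT (@fst X Y) by [].
pose A := (fun tt : Y * n.-tuple Y => [tuple of tt.1 :: tt.2]) @^-1` U.
have mA : measurable A.
  by rewrite -[A]setTI; exact: (@measurable_cons_pair _ Y n).
rewrite [X in measurable_fun _ X](_ : _ =
    (kproduct k (kcomap k2 mf) ^~ A)); last first.
  apply/funext => x /=; apply: eq_integral => y _.
  rewrite /kernel.intker_indic/= integral_indic//; last first.
    by rewrite -[X in measurable X]xsectionE; exact: measurable_xsection.
  by rewrite setIT xsectionE.
exact: measurable_kproduct.
Qed.

HB.instance Definition _ n :=
  isKernel.Build _ _ X (n.-tuple Y) R (kiid n) (@measurable_kiid n).

HB.instance Definition _ n :=
  Kernel_isProbability.Build _ _ X (n.-tuple Y) R (kiid n) (@kiid_prob n).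

End kernel_iid.

Section mixture.
Context d d' (X : measurableType d) (Y : measurableType d') (R : realType).
Variables (mu : probability X R) (k : R.-pker X ~> Y).
Local Open Scope ereal_scope.

Definition mixture (A : set Y) : \bar R := \int[mu]_x k x A.

Let mixture0 : mixture set0 = 0.
Proof. by apply: integral0_eq => x _; rewrite measure0. Qed.

Let mixture_ge0 A : 0 <= mixture A.
Proof. by apply: integral_ge0 => x _; exact: measure_ge0. Qed.

Let mixture_sigma_additive : semi_sigma_additive mixture.
Proof.
move=> F mF tF mUF.
rewrite [X in _ --> X](_ : _ = \sum_(n <oo) mixture (F n)); last first.
  rewrite /mixture -integral_nneseries//.
    apply: eq_integral => x _; exact: (@measure_semi_bigcup _ _ _ (k x)).
  by move=> n; exact: measurable_kernel.
by apply: is_cvg_ereal_nneg_natsum => n _; exact: mixture_ge0.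
Qed.

HB.instance Definition _ := isMeasure.Build _ _ _ mixture
  mixture0 mixture_ge0 mixture_sigma_additive.

Let mixture_setT : mixture setT = 1.
Proof.
rewrite /mixture; under eq_integral do rewrite prob_kernel.
by rewrite integral_cst// mul1e; exact: probability_setT.
Qed.

HB.instance Definition _ :=
  Measure_isProbability.Build _ _ _ mixture mixture_setT.

End mixture.

Section orthogonality.
Context {R : realType} {r : nat}.
Implicit Types S : {vspace 'rV[R]_r}.

(* Orthogonal complement for the Euclidean inner product; see memv_perpP. *)
Definition perp S : {vspace 'rV[R]_r} :=
  (\bigcap_(i < \dim S) lker (linfun (mulmxr ((vbasis S)`_i)^T)))%VS.

Lemma memv_perpP S v :
  reflect (forall u, u \in S -> v *m u^T = 0) (v \in perp S).
Proof.
apply: (iffP idP) => [vS u uS|vS]; last first.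
  rewrite memvE; apply/subv_bigcapP => i _; rewrite -memvE memv_ker lfunE/=.
  by rewrite vS// vbasis_mem// mem_nth// size_tuple.
rewrite (coord_vbasis uS) linear_sum/= mulmx_sumr big1// => i _.
rewrite linearZ/= -scalemxAr.
move: vS; rewrite memvE => /subv_bigcapP /(_ i isT).
by rewrite -memvE memv_ker lfunE/= => /eqP ->; rewrite scaler0.
Qed.

Definition orthonormal_in S m (B : 'M[R]_(m, r)) :=
  B *m B^T = 1%:M /\ forall i, row i B \in S.

Lemma dotv_gt0 (v : 'rV[R]_r) : v != 0 -> 0 < (v *m v^T) 0 0.
Proof.
move=> v0; rewrite lt_neqAle; apply/andP; split; last first.
  by rewrite mxE sumr_ge0// => j _; rewrite mxE -expr2 sqr_ge0.
apply: contra v0; rewrite eq_sym mxE psumr_eq0; last first.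
  by move=> j _; rewrite mxE -expr2 sqr_ge0.
move=> /allP h; apply/eqP/rowP => j; rewrite mxE; apply/eqP.
by have := h j (mem_index_enum _); rewrite /= mxE mulf_eq0 orbb.
Qed.

Lemma orthonormal_in_exists S m : (m <= \dim S)%N ->
  exists B : 'M[R]_(m, r), orthonormal_in S B.
Proof.
elim: m => [_|m IH mS].
  by exists 0; split=> [|[]//]; apply/matrixP => -[].
have [B [BB BS]] := IH (ltnW mS).
pose f := linfun (mulmxr B^T : 'rV[R]_r -> 'rV[R]_m).
have : (S :&: lker f)%VS != 0%VS.
  apply: contraTN mS => /eqP S0; rewrite -leqNgt -(limg_ker_dim f S) S0 dimv0 add0n.
  by rewrite (leq_trans (dimvS (subvf _)))// dimvf [X in (X <= _)%N](mul1n m).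
rewrite -vpick0; set v := vpick _ => v0.
have /memv_capP[vS] := memv_pick (S :&: lker f)%VS.
rewrite memv_ker lfunE/= -/v => /eqP vB.
pose c := (Num.sqrt ((v *m v^T) 0 0))^-1.
have cv : (c *: v) *m (c *: v)^T = (1%:M : 'M[R]_1).
  rewrite linearZ/= -scalemxAl -scalemxAr scalerA; apply/matrixP => i j.
  rewrite !ord1 mxE [RHS]mxE eqxx mulr1n -expr2 exprVn sqr_sqrtr; last exact/ltW/dotv_gt0.
  by rewrite mulVf// gt_eqF// dotv_gt0.
have cvB : (c *: v) *m B^T = 0 by rewrite -scalemxAl vB scaler0.
rewrite -[m.+1]addn1 addnC.
exists (col_mx (c *: v) B); split.
  rewrite tr_col_mx mul_col_row cv BB cvB.
  have -> : B *m (c *: v)^T = 0.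
    by rewrite -[LHS]trmxK trmx_mul trmxK cvB trmx0.
  by rewrite -scalar_mx_block.
move=> i; rewrite -(splitK i); case: (fintype.split i) => j /=.
  by rewrite (_ : row _ _ = c *: v) ?memvZ//; apply/rowP => k; rewrite [LHS]mxE col_mxEu ord1.
by rewrite (_ : row _ _ = row j B)//; apply/rowP => k; rewrite [LHS]mxE col_mxEd mxE.
Qed.

(* The rows of [orthobasis S] are a fixed orthonormal basis of S, so that
   v |-> v *m (orthobasis S)^T is the identification of S with R^(\dim S),
   precomposed with the orthogonal projection onto S. *)
Definition orthobasis S : 'M[R]_(\dim S, r) :=
  xget 0 [set B | orthonormal_in S B].

Lemma orthobasisP S : orthonormal_in S (orthobasis S).
Proof.
have [B BP] := orthonormal_in_exists (leqnn (\dim S)).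
by rewrite /orthobasis; case: xgetP => [B' _ //|/(_ B)].
Qed.

End orthogonality.

Section dim_perp.
Context {R : realType} {r : nat}.
Implicit Types S : {vspace 'rV[R]_r}.

Lemma dimv_perp S : \dim (perp S) = (r - \dim S)%N.
Proof.
have [BB BS] := orthobasisP S; set B := orthobasis S in BB BS.
have vBS a : a *m B \in S.
  by rewrite mulmx_sum_row memv_suml// => i _; rewrite memvZ.
have capS : (S :&: perp S)%VS = 0%VS.
  apply/eqP; rewrite -subv0; apply/subvP => v /memv_capP[vS /memv_perpP vP].
  apply: contraT; rewrite memv0 => /dotv_gt0.
  by rewrite vP// mxE ltxx.
have fS v : v \in S -> v *m B^T *m B = v.
  pose f := linfun (mulmxr B : 'rV[R]__ -> 'rV[R]_r).
  have f1 : (limg f <= S)%VS.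
    by apply/subvP => _ /memv_imgP[a _ ->]; rewrite lfunE/= vBS.
  have kf : lker f = 0%VS.
    apply/eqP; rewrite -subv0; apply/subvP => a; rewrite memv_ker lfunE/= => /eqP aB.
    by rewrite memv0 -[a]mulmx1 -BB mulmxA aB mul0mx.
  have : limg f == S.
    by rewrite eqEdim f1/= limg_dim_eq ?kf ?capv0// dimvf [dim _](mul1n (\dim S)).
  move=> /eqP fE vS; have : v \in limg f by rewrite fE.
  move=> /memv_imgP[a _ ->]; rewrite lfunE/=.
  by rewrite -(mulmxA a) BB mulmx1.
have addS : (S + perp S)%VS = fullv.
  apply/eqP; rewrite eqEsubv subvf/=; apply/subvP => v _.
  rewrite -[v](subrK (v *m B^T *m B)) addrC memv_add//.
  apply/memv_perpP => u /fS <-.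
  rewrite mulmxBl trmx_mul trmx_mul trmxK !mulmxA.
  by rewrite -(mulmxA (v *m B^T) B B^T) BB mulmx1 subrr.
have e : r = (\dim S + \dim (perp S))%N.
  by rewrite -(dimv_disjoint_sum capS) addS dimvf; exact/esym/mul1n.
by have := congr1 (subn^~ (\dim S)) e; rewrite /= addKn.
Qed.

End dim_perp.

Section conditional_expectation.
Context d d' (T : measurableType d) (T' : measurableType d') (R : realType).
Variables (P : probability T R) (X : T -> R) (V : T -> T').
Local Open Scope ereal_scope.

(* g is a version of E[X | V], viewed as a function of the value of V;
   [cond_exp] picks one (they agree almost surely), see cond_expP. *)
Definition is_cond_exp (g : T' -> R) :=
  [/\ measurable_fun setT g,
      P.-integrable setT (EFin \o (g \o V)) &
      forall B, measurable B ->
        \int[P]_(w in V @^-1` B) (g (V w))%:E = \int[P]_(w in V @^-1` B) (X w)%:E].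

Definition cond_exp : T' -> R := xget (cst 0%R) is_cond_exp.

Lemma cond_expP : P.-integrable setT (EFin \o X) -> measurable_fun setT V ->
  is_cond_exp cond_exp.
Proof.
move=> iX mV; rewrite /cond_exp; case: xgetP => [//|/(_ _) nex].
exfalso.
pose nu := measure_function_pushforward__canonical__charge_Charge
  (induced_charge iX) mV.
pose mu := law P mV.
have numu : nu `<< mu.
  apply/null_content_dominatesP => A mA muA0.
  have mVA : measurable (V @^-1` A).
    by rewrite -[X in measurable X]setTI; exact: (mV measurableT).
  by apply: null_set_integral => //; exact: (measurable_funTS (measurable_int _ iX)).
pose f := Radon_Nikodym nu mu.
have ffin x : f x \is a fin_num by exact: Radon_Nikodym_fin_num.
have fi : mu.-integrable setT f by exact: Radon_Nikodym_integrable.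
have mf : measurable_fun setT f by exact: measurable_int fi.
have fVi : P.-integrable setT (f \o V).
  apply/integrableP; split; first exact: measurableT_comp.
  have /integrableP[_] := fi; rewrite ge0_integral_pushforward//.
  by apply: measurableT_comp.
have fE : EFin \o (fine \o f) = f by apply/funext => x /=; rewrite fineK.
apply: (nex (fine \o f)); split.
- exact: measurableT_comp.
- by rewrite compA fE.
move=> B mB.
have mVB : measurable (V @^-1` B) by rewrite -[X in measurable X]setTI; exact: (mV measurableT).
transitivity (nu B); last by [].
rewrite (@Radon_Nikodym_integral _ _ _ nu mu)// integral_pushforward//.
  by apply: eq_integral => x _ /=; rewrite fineK.
exact: (integrableS measurableT mVB _ fVi).
Qed.

End conditional_expectation.

Section hermite.
Context {R : realType}.

(* Elements of (R^m)^(tensor k), by their coordinates. *)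
Definition tensor (k m : nat) := {ffun 'I_k -> 'I_m} -> R.

Definition tensor_mul k l m (t : tensor k m) (u : tensor l m) : tensor (k + l) m :=
  fun s => t [ffun a => s (lshift l a)] * u [ffun b => s (rshift k b)].

(* Column space of the unfolding along the first index: each s contributes the
   column indexed by the remaining entries of s (its entry s 0 is ignored). *)
Definition tensor_span k m (t : tensor k m) : {vspace 'rV[R]_m} :=
  <<[seq \row_i t [ffun a : 'I_k => if val a == 0%N then i else s a]
      | s : {ffun 'I_k -> 'I_m}]>>%VS.

Definition gauss_pdf m (u : 'rV[R]_m) : R := \prod_(i < m) normal_pdf 0 1 (u 0 i).

(* Entry (s_0, ..., s_(k-1)) of the k-th gradient of f at u. *)
Definition nabla m (f : 'rV[R]_m -> R) k (u : 'rV[R]_m) : tensor k m :=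
  fun s => foldr (fun a g => 'D_(delta_mx 0 (s a)) g) f (enum 'I_k) u.

Definition hermite m k (u : 'rV[R]_m) : tensor k m :=
  fun s => (-1) ^+ k / Num.sqrt (k`!)%:R * (nabla (@gauss_pdf m) u s / gauss_pdf u).

End hermite.

Lemma measurable_mulmx (R : realType) d' (U : measurableType d') m n p (f : U -> 'M[R]_(m, n))
    (g : U -> 'M[R]_(n, p)) : measurable_fun setT f -> measurable_fun setT g ->
  measurable_fun setT (fun x => f x *m g x).
Proof.
move=> mf mg; apply: measurable_to_matrix => i j.
under eq_fun do rewrite mxE.
by apply: measurable_sum => k; apply: measurable_funM;
  [exact: (measurableT_comp (measurable_coef _ _) mf)
  |exact: (measurableT_comp (measurable_coef _ _) mg)].
Qed.

Unset Implicit Arguments.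

Section leap.
Context {R : realType} {r : nat}.
Implicit Types (P : probability ('rV[R]_r * R)%type R) (S : {vspace 'rV[R]_r}).

(* A sample of P is a pair w = (Z, Y). *)
Definition gaussian_input P :=
  forall A, measurable A -> P (A `*` setT) = gauss r A.

(* Z_{S^perp}, in R^(dim S^perp). *)
Definition perp_input S (w : 'rV[R]_r * R) : 'rV[R]_(\dim (perp S)) :=
  w.1 *m (orthobasis (perp S))^T.

(* (Z_S, Y), in R^(dim S) x R. *)
Definition eff_label S (w : 'rV[R]_r * R) : 'rV[R]_(\dim S) * R :=
  (w.1 *m (orthobasis S)^T, w.2).

Lemma measurable_perp_input S : measurable_fun setT (perp_input S).
Proof.
by apply: measurable_mulmx; [exact: measurable_fst|exact: measurable_cst].
Qed.

Lemma measurable_eff_label S : measurable_fun setT (eff_label S).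
Proof.
apply/measurable_fun_pairP; split; last exact: measurable_snd.
by apply: measurable_mulmx; [exact: measurable_fst|exact: measurable_cst].
Qed.

Definition intrinsic_dimension P :=
  forall S, S != fullv ->
  ~ (forall A B, measurable A -> measurable B ->
       P (perp_input S @^-1` A `&` eff_label S @^-1` B) =
       (P (perp_input S @^-1` A) * P (eff_label S @^-1` B))%E).

Definition zeta P k S (y : 'rV[R]_(\dim S) * R) : tensor k (\dim (perp S)) :=
  fun s => cond_exp P (fun w => hermite (perp_input S w) s) (eff_label S) y.

Definition Lambda P k S : tensor (k + k) (\dim (perp S)) :=
  fun s => \int[P]_w
    tensor_mul (zeta P k S (eff_label S w)) (zeta P k S (eff_label S w)) s.

Definition lambda2 P k S : \bar R :=
  (\int[P]_w (\sum_s zeta P k S (eff_label S w) s ^+ 2)%:E)%E.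

(* k = k(S). *)
Definition leap_index P S (k : nat) :=
  [/\ (1 <= k)%N, (0 < lambda2 P k S)%E &
      forall j, (1 <= j < k)%N -> ~ (0 < lambda2 P j S)%E].

(* Here the span is transported from R^(dim S^perp) back to S^perp in R^r, and
   only S i for i <= L and k i for 1 <= i <= L are meaningful. *)
Definition leap_decomposition P (L : nat) (S : nat -> {vspace 'rV[R]_r})
    (k : nat -> nat) :=
  [/\ S 0%N = 0%VS,
      forall i, (i < L)%N ->
        [/\ S i != fullv, leap_index P (S i) (k i.+1) &
            S i.+1 = (S i + linfun (mulmxr (orthobasis (perp (S i))))
                              @: tensor_span (Lambda P (k i.+1) (S i)))%VS] &
      S L = fullv].

Definition leap_exponent (L : nat) (k : nat -> nat) : nat :=
  \max_(i < L) k i.+1.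

End leap.

Section testing.
Context {R : realType}.

Section planted.
Context {dY} {Y : measurableType dY} (m : nat) {q : nat} (kappa : R.-pker 'rV[R]_q ~> Y).

Lemma measurable_planted_input :
  measurable_fun setT (fun Wx : 'M[R]_(m, q) * 'rV[R]_m => Wx.2 *m Wx.1).
Proof. by apply: measurable_mulmx; [exact: measurable_snd|exact: measurable_fst]. Qed.

(* Inputs are row vectors, so W^T x is written x *m W.  [planted W] is the law of
   (x, y) with x ~ gauss m and y | x ~ kappa (x *m W). *)
Definition planted : 'M[R]_(m, q) -> {measure set ('rV[R]_m * Y) -> \bar R} :=
  mkproduct (kprobability (measurable_cst (gauss m : pprobability _ R)))
            (kcomap kappa measurable_planted_input).

HB.instance Definition _ := Kernel.on planted.

Lemma planted_setT W : planted W setT = 1%E.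
Proof.
transitivity (\int[gauss m]_(x in [set: 'rV[R]_m]) (1 : \bar R))%E.
  apply: eq_integral => x _; rewrite /kernel.intker_indic/=.
  under eq_integral do rewrite indicT/=.
  by rewrite integral_cst// mul1e; exact: prob_kernel.
by rewrite integral_cst// mul1e; exact: probability_setT.
Qed.

HB.instance Definition _ :=
  Kernel_isProbability.Build _ _ _ _ R planted planted_setT.

End planted.

(* kappa z is a regular conditional law of (Z_S, Y) given Z_{S^perp} = z. *)
Definition is_disintegration {r} (P : probability ('rV[R]_r * R)%type R)
    (S : {vspace 'rV[R]_r})
    (kappa : R.-pker 'rV[R]_(\dim (perp S)) ~> ('rV[R]_(\dim S) * R)%type) :=
  forall A B, measurable A -> measurable B ->
    P (perp_input S @^-1` A `&` eff_label S @^-1` B) =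
    (\int[gauss (\dim (perp S))]_(z in A) kappa z B)%E.

(* The uniform law on m x q matrices with orthonormal columns is the only
   probability carried by them that the orthogonal group O(m) leaves
   invariant. *)
Definition is_haar {m q} (mu : probability 'M[R]_(m, q) R) :=
  mu [set W | W^T *m W = 1%:M] = 1%E /\
  forall O : 'M[R]_m, O *m O^T = 1%:M ->
  forall A, measurable A -> mu [set W | A (O *m W)] = mu A.

Section hypotheses.
Context {r : nat} (P : probability ('rV[R]_r * R)%type R) (S : {vspace 'rV[R]_r}).
Variables (m n : nat).

Definition null_law : probability (n.-tuple ('rV[R]_m * ('rV[R]_(\dim S) * R))) R :=
  iid n (gauss m \x law P (measurable_eff_label S))%E.

(* W is drawn once, then n independent samples from [planted W]. *)
Definition planted_law
    (kappa : R.-pker 'rV[R]_(\dim (perp S)) ~> ('rV[R]_(\dim S) * R)%type)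
    (mu : probability 'M[R]_(m, \dim (perp S)) R) :
    probability (n.-tuple ('rV[R]_m * ('rV[R]_(\dim S) * R))) R :=
  mixture mu (kiid (planted m kappa) n).

End hypotheses.

Section low_degree.
Context {dY} {Y : measurableType dY} {m n : nat}.
Variables (P0 P1 : probability (n.-tuple ('rV[R]_m * Y)) R).

(* Polynomials of total degree at most D in all the entries of the n inputs,
   whose coefficients are measurable functions of the n labels. *)
Definition poly_degree_le (D : nat) (f : n.-tuple ('rV[R]_m * Y) -> R) :=
  exists c : {ffun 'I_n * 'I_m -> 'I_D.+1} -> n.-tuple Y -> R,
    (forall a, measurable_fun setT (c a)) /\
    forall s, f s =
      \sum_(a : {ffun 'I_n * 'I_m -> 'I_D.+1} | (\sum_ij a ij <= D)%N)
        c a [tuple of [seq xy.2 | xy <- s]] *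
        \prod_ij (tnth s ij.1).1 0 ij.2 ^+ a ij.

Definition low_degree_space (D : nat) : set (n.-tuple ('rV[R]_m * Y) -> R) :=
  [set f | f \in Lfun P0 2%:E /\ poly_degree_le D f].

(* The projection of dP1/dP0 onto the low-degree space, through its defining
   identity, which makes sense even if dP1/dP0 is not square-integrable. *)
Definition is_low_degree_LR (D : nat) (f : n.-tuple ('rV[R]_m * Y) -> R) :=
  low_degree_space D f /\
  forall p, low_degree_space D p ->
    (\int[P0]_s (f s * p s)%:E = \int[P1]_s (p s)%:E)%E.

End low_degree.
End testing.

(* Main.v *)
(** Everything is expanded in products of Hermite polynomials.  They are indexed
    by words (sequences of pairs sample/coordinate) rather than by multi-indices,
    because then a linear change of variables [x = u *m O^T] with [O *m O^T = 1]
    just multiplies entries of [O] letter by letter.  Under the planted law with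
    directions [W], the moment of [c(y) He_t(x)] is therefore the sum over the
    words [s] in the relevant coordinates of [W_(t_1, s_1) ... W_(t_k, s_k)]
    times [E[c(y) zeta_s(y)]], with [zeta_s = E[He_s(z) | y]], so that the
    low-degree likelihood ratio is
    [sum_(k <= D) 1/k! sum_(t, s) E_W[W_(t_1, s_1) ... W_(t_k, s_k)] zeta_s(y) He_t(x)].

    The samples being independent, the leap exponent makes [zeta_s] vanish as soon
    as some sample occurs in [s] between 1 and [kstar - 1] times; at most
    [(k n^(1/kstar) q)^k] words of length [k] survive.  Summing over [t] in the
    squared norm leaves pairs [(s, s')] through the same samples, with a weight
    [E[M_(s_1, s'_1) ... M_(s_k, s'_k)]] where [M = W^T W'] for independent Haar
    matrices [W] and [W'].  A column of [W'] seen from a unit vector has Gaussian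
    moments up to a factor [m^(-p)], hence this weight is at most
    [q^2 (2k/m)^(k/2)], and [|norm^2 - 1|] is bounded by a geometric series of
    ratio of order [D^(3/2) n^(1/kstar) d^(-1/2)]. *)

Require Import Defs.
From HB Require Import structures.
From mathcomp Require Import all_boot all_order all_algebra finmap.
From mathcomp Require Import all_classical all_reals all_analysis.
From mathcomp Require Import measurable_realfun.
From mathcomp Require Import ring lra zify.
Import Order.TTheory GRing.Theory Num.Theory.
Import numFieldNormedType.Exports.
Local Open Scope classical_set_scope.
Local Open Scope ring_scope.

Set Implicit Arguments.
Unset Strict Implicit.
Unset Printing Implicit Defensive.

(** The likelihood ratio need not be square integrable, so the argument runs by duality: [zeta_s] is
    only tested against square-integrable functions of the labels, and the explicit candidate is
    recognised by its inner products with the low-degree space. Any two functions with these inner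
    products have the same norm, so computing one norm is enough. The planted law becomes computable
    once [W] is completed to an orthogonal matrix: it is then the image of [P] and independent
    Gaussians under a rotation, whence the need for the rotation invariance of Gaussian vectors. Two
    balances make the series geometric. The bound [E[zeta_s^2] <= k!] absorbs the [1/k!] caused by
    indexing with words. Surviving concerns only the samples of a word: at most [k/kstar] distinct
    ones occur, which costs a power [n^(k/kstar)], against [m^(-k/2)] from the Haar moments. The gap
    [gamma] leaves a negative power of [d], to which a polylogarithmic [D] is negligible. The Haar
    law is known only through its support and its invariance; its moments are obtained by averaging
    over the vector it is tested on instead of over the matrix. *)

(** * Hermite polynomials in one variable and Gaussian moments *)

Section hermite_poly.
Variable R : realFieldType.
Implicit Types p : {poly R}.

(* Moments of the standard Gaussian law; [gfun p] is thus the expectation of [p],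
   see [normal_poly_Ex]. *)
Fixpoint gmom (n : nat) : R :=
  match n with
  | 0 => 1
  | n1.+1 => match n1 with 0 => 0 | n2.+1 => n2.+1%:R * gmom n2 end
  end.

Definition gfun p : R := \sum_(i < size p) p`_i * gmom i.

Lemma gfunE N p : (size p <= N)%N -> gfun p = \sum_(i < N) p`_i * gmom i.
Proof.
move=> pN; rewrite /gfun -!(big_mkord xpredT (fun i => p`_i * gmom i)).
rewrite [RHS](@big_cat_nat _ _ _ (size p))//= [X in _ + X]big_nat [X in _ + X]big1 ?addr0//.
by move=> i /andP[pi _]; rewrite nth_default// mul0r.
Qed.

Lemma gfun_is_linear : linear_for *%R gfun.
Proof.
move=> a p q; pose N := maxn (size p) (size q).
rewrite (@gfunE N (a *: p + q)); last first.
  rewrite (leq_trans (size_polyD _ _))// geq_max leq_maxr andbT.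
  by rewrite (leq_trans (size_scale_leq _ _))// leq_maxl.
rewrite (@gfunE N p) ?leq_maxl// (@gfunE N q) ?leq_maxr//.
rewrite mulr_sumr -big_split/=; apply: eq_bigr => i _.
by rewrite coefD coefZ mulrDl mulrA.
Qed.

HB.instance Definition _ := GRing.isLinear.Build R {poly R} R *%R gfun gfun_is_linear.

Lemma gfunXn n : gfun 'X^n = gmom n.
Proof.
rewrite /gfun size_polyXn big_ord_recr/= big1 ?add0r ?coefXn ?eqxx ?mul1r// => i _.
by rewrite coefXn ltn_eqF ?mul0r.
Qed.

(** Gaussian integration by parts (Stein's identity); on monomials it is the recursion that defines
    [gmom]. *)
Lemma gfunX p : gfun ('X * p) = gfun p^`().
Proof.
elim/poly_ind: p => [|p c IH]; first by rewrite mulr0 deriv0.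
have h n : gfun ('X * 'X^n) = gfun ('X^n)^`().
  rewrite -exprS gfunXn derivXn; case: n => [|n]; first by rewrite /= mulr0n linear0.
  by rewrite raddfMn/= gfunXn mulr_natl.
suff hp (q : {poly R}) : gfun ('X * q) = gfun q^`() by exact: hp.
rewrite -[q]coefK poly_def mulr_sumr !linear_sum/=; apply: eq_bigr => i _.
by rewrite -scalerAr derivZ !linearZ/= h.
Qed.

(** The probabilists' Hermite polynomials: monic, and of squared norm [n!]. *)
Fixpoint He (n : nat) : {poly R} :=
  if n is n'.+1 then 'X * He n' - (He n')^`() else 1.

Lemma derivHe n : (He n.+1)^`() = n.+1%:R *: He n.
Proof.
elim: n => [|n IH]; first by rewrite /= derivB derivM derivX derivC deriv0 mulr0 !addr0 mul1r scale1r subr0.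
have -> : He n.+2 = 'X * He n.+1 - (He n.+1)^`() by [].
rewrite derivB derivM derivX mul1r IH.
rewrite derivZ -scalerAr -addrA -scalerBr.
have -> : 'X * He n - (He n)^`() = He n.+1 by [].
by rewrite -[X in X + _]scale1r -scalerDl [in RHS]mulrSr addrC.
Qed.

Lemma hornerHeS n z : (He n.+1).[z] = z * (He n).[z] - n%:R * (He n.-1).[z].
Proof.
have -> : He n.+1 = 'X * He n - (He n)^`() by [].
rewrite hornerD hornerN hornerM hornerX; case: n => [|n].
  by rewrite derivC horner0 mul0r.
by rewrite derivHe hornerZ.
Qed.

(** Multiplication by ['X] minus derivation is adjoint to derivation for [gfun]; orthogonality
    follows by lowering both degrees together. *)
Lemma gfunHeS n p : gfun (He n.+1 * p) = gfun (He n * p^`()).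
Proof.
have -> : He n.+1 = 'X * He n - (He n)^`() by [].
rewrite mulrBl linearB/= -mulrA gfunX derivM linearD/=.
by rewrite addrAC subrr add0r.
Qed.

Lemma gfunHeSl a b : gfun (He a.+1 * He b) = b%:R * gfun (He a * He b.-1).
Proof.
rewrite gfunHeS; case: b => [|b]; first by rewrite derivC mulr0 linear0 mul0r.
by rewrite derivHe -scalerAr linearZ.
Qed.

Lemma gfunHe a b : gfun (He a * He b) = if a == b then a`!%:R else 0.
Proof.
elim: a b => [|a IH] [|b].
- by rewrite mulr1; exact: (gfunXn 0%N).
- by rewrite mulrC gfunHeSl mul0r.
- by rewrite gfunHeSl mul0r.
by rewrite gfunHeSl IH eqSS; case: eqP => [->|_]; rewrite ?mulr0// factS natrM.
Qed.

Lemma size_He n : size (He n) = n.+1 /\ He n \is monic.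
Proof.
elim: n => [|n [sn mn]]; first by rewrite size_poly1 monic1.
have s1 : size ('X * He n) = n.+2 by rewrite mulrC size_mulX ?sn// monic_neq0.
have s2 : (size (- (He n)^`())%R < size ('X * He n)%R)%N.
  rewrite s1 size_polyN (leq_trans (lt_size_deriv _)) ?monic_neq0//.
  by rewrite sn.
rewrite /= size_polyDl// s1; split => //.
by rewrite monicE lead_coefDl// -monicE mulrC monicMr// ?monicX.
Qed.

Lemma He_span N p : (size p <= N)%N -> exists c : nat -> R, p = \sum_(j < N) c j *: He j.
Proof.
elim: N p => [|N IH] p.
  by rewrite leqn0 size_poly_eq0 => /eqP ->; exists (fun=> 0); rewrite big_ord0.
move=> pN; have [|c cE] := IH (p - p`_N *: He N).
  apply/leq_sizeP => j; rewrite leq_eqVlt => /predU1P[<-|Nj].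
    rewrite coefB coefZ; have [sN /monicP] := size_He N.
    by rewrite /lead_coef sN/= => ->; rewrite mulr1 subrr.
  rewrite coefB coefZ nth_default ?(leq_trans pN)// [X in _ * X]nth_default ?mulr0 ?subr0//.
  by rewrite (size_He N).1.
exists (fun j => if (j == N)%N then p`_N else c j); rewrite big_ord_recr/= eqxx.
rewrite -[LHS](subrK (p`_N *: He N)) cE; congr (_ + _); apply: eq_bigr => i _.
by rewrite ltn_eqF.
Qed.

Lemma He_expand N p : (size p <= N)%N ->
  p = \sum_(j < N) (gfun (p * He j) / j`!%:R) *: He j.
Proof.
move=> /He_span[c cE]; rewrite [LHS]cE; apply: eq_bigr => j _; congr (_ *: _).
have -> : gfun (p * He j) = c j * j`!%:R.
  rewrite {1}cE mulr_suml linear_sum/= (bigD1 j)//= big1 ?addr0 => [|i ij].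
    by rewrite -scalerAl linearZ/= gfunHe eqxx.
  by rewrite -scalerAl linearZ/= gfunHe (negbTE (_ : i != j :> nat)) ?mulr0.
by rewrite mulfK// pnatr_eq0 -lt0n fact_gt0.
Qed.

Lemma gfun_He_eq0 j p : (size p <= j)%N -> gfun (p * He j) = 0.
Proof.
move=> /He_span[c ->]; rewrite mulr_suml linear_sum/= big1// => i _.
by rewrite -scalerAl linearZ/= gfunHe ltn_eqF ?mulr0.
Qed.

Lemma gmom_ge0 n : 0 <= gmom n.
Proof.
have : 0 <= gmom n /\ 0 <= gmom n.+1.
  by elim: n => [|n [h0 h1]] //=; split => //; rewrite mulr_ge0.
by case.
Qed.

(** A crude bound on the double factorial [(2p-1)!!]; it is the origin of the factor [2k] in the
    bounds on Haar moments. *)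
Lemma gmom_le (p : nat) : gmom (p.*2) <= (p.*2)%:R ^+ p.
Proof.
elim: p => [|p IH] //.
rewrite doubleS [leLHS]/= -/(gmom _) exprS ler_pM//; last 2 first.
- by rewrite ler_nat.
- apply: le_trans IH _; apply: lerXn2r; rewrite ?nnegrE// ler_nat.
  by rewrite (leq_trans (leqnSn _))// leqnSn.
- exact: gmom_ge0.
Qed.

End hermite_poly.

(** * Hermite polynomials indexed by words *)

Section words.
Variable R : realFieldType.

Section defs.
Variable I : finType.
Implicit Types (s t : seq I) (F : seq I -> R).

Fixpoint words (k : nat) : seq (seq I) :=
  if k is k'.+1 then [seq i :: w | i <- enum I, w <- words k'] else [:: [::]].

Lemma big_words0 F : \sum_(w <- words 0) F w = F [::].
Proof. by rewrite big_seq1. Qed.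

Lemma big_wordsS k F :
  \sum_(w <- words k.+1) F w = \sum_i \sum_(w <- words k) F (i :: w).
Proof. by rewrite big_allpairs_dep/= big_enum. Qed.

Lemma size_words k w : w \in words k -> size w = k.
Proof.
elim: k w => [|k IH] w /=; first by rewrite inE => /eqP ->.
by move=> /allpairsP[[i w'] [_ /IH wk ->]] /=; rewrite wk.
Qed.

Lemma words_uniq k : uniq (words k).
Proof.
elim: k => [|k IH] //=; apply: allpairs_uniq => //; first exact: enum_uniq.
by move=> [i w] [j v] _ _ [-> ->].
Qed.

(* [contract i s F] sums [F (s minus one occurrence of i)] over the occurrences
   of [i] in [s]. *)
Fixpoint contract (i : I) s F : R :=
  if s is j :: s' then (if i == j then F s' else 0) + contract i s' (fun t => F (j :: t))
  else 0.

Lemma contract_ext i s F F' : F =1 F' -> contract i s F = contract i s F'.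
Proof.
elim: s F F' => [|j s IH] F F' FF' //=; rewrite FF'; congr (_ + _).
by apply: IH => t; rewrite FF'.
Qed.

Lemma contractD i s F F' : contract i s (fun t => F t + F' t) = contract i s F + contract i s F'.
Proof.
elim: s F F' => [|j s IH] F F' /=; first by rewrite addr0.
by rewrite IH; case: eqP => _; ring.
Qed.

Lemma contractZ i s a F : contract i s (fun t => a * F t) = a * contract i s F.
Proof.
elim: s F => [|j s IH] F /=; first by rewrite mulr0.
by rewrite IH; case: eqP => _; ring.
Qed.

Lemma contract_sum (X : Type) (r : seq X) i s (F : X -> seq I -> R) :
  contract i s (fun t => \sum_(x <- r) F x t) = \sum_(x <- r) contract i s (F x).
Proof.
elim: r => [|x r IH].
  rewrite big_nil; elim: s => [|j s IHs] //=.
  rewrite big_nil if_same add0r -[RHS]IHs; apply: contract_ext => t; by rewrite !big_nil.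
rewrite big_cons -IH -contractD; apply: contract_ext => t; by rewrite big_cons.
Qed.

Definition perm_inv F := forall s t, perm_eq s t -> F s = F t.

Lemma contractE i s F : perm_inv F -> contract i s F = (count_mem i s)%:R * F (rem i s).
Proof.
elim: s F => [|j s IH] F Fi /=; first by rewrite mul0r.
rewrite IH; last by move=> u v uv; apply: Fi; rewrite perm_cons.
rewrite [j == i]eq_sym; have [->|ij] := eqVneq i j; last by rewrite !add0r.
rewrite add1n -[in RHS]natr1 mulrDl mul1r addrC; congr (_ + _).
have [js|] := boolP (j \in s); last by move/count_memPn => ->; rewrite !mul0r.
by congr (_ * _); apply: Fi; rewrite perm_sym perm_to_rem.
Qed.

Lemma sum_count s : \sum_i (count_mem i s)%:R = (size s)%:R :> R.
Proof.
rewrite -natr_sum; congr (_%:R); elim: s => [|j s IH] /=; first by rewrite big1.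
rewrite big_split/= IH (bigD1 j)//= eqxx big1 ?addn0// => i.
by rewrite eq_sym => /negbTE ->.
Qed.

Definition HI (c : I -> nat) (x : I -> R) : R := \prod_i (He R (c i)).[x i].

Lemma HI_D1 i c x : HI c x = (He R (c i)).[x i] * \prod_(j | j != i) (He R (c j)).[x j].
Proof. by rewrite /HI (bigD1 i). Qed.

Definition HW s (x : I -> R) : R := HI (fun i => count_mem i s) x.

Lemma HW_perm x : perm_inv (HW ^~ x).
Proof.
move=> s t st; apply: eq_bigr => i _.
by rewrite (permP st).
Qed.

Lemma HW_nil x : HW [::] x = 1.
Proof. by rewrite /HW /HI big1// => i _; rewrite hornerC. Qed.

(** The three-term recursion in the variable [x i]: its factor [n] is the number of occurrences of
    [i], each of which is one term of the contraction. *)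
Lemma HW_cons i s x : HW (i :: s) x = x i * HW s x - contract i s (HW ^~ x).
Proof.
rewrite contractE; last exact: HW_perm.
rewrite /HW !(HI_D1 i)/= eqxx add1n.
have hj j : j != i -> (i == j) = false by rewrite eq_sym => /negbTE.
under eq_bigr => j ji do rewrite hj// add0n.
rewrite hornerHeS.
have [si|/count_memPn ->] := boolP (i \in s); last by rewrite !mul0r !subr0 mulrA.
under [X in _ - _ * (_ * X)]eq_bigr => j ji do rewrite count_rem si /= hj// subn0.
by rewrite count_rem si /= eqxx subn1; ring.
Qed.

(** The inner product of [HW s] and [HW t] for independent standard Gaussian coordinates; it
    vanishes unless the words are permutations of each other. *)
Definition he_gram (s t : seq I) : R :=
  \prod_i gfun (He R (count_mem i s) * He R (count_mem i t)).

Lemma he_gram_D1 i s t : he_gram s t = gfun (He R (count_mem i s) * He R (count_mem i t)) *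
  \prod_(j | j != i) gfun (He R (count_mem j s) * He R (count_mem j t)).
Proof. by rewrite /he_gram (bigD1 i). Qed.

Lemma he_gram_perm s : perm_inv (he_gram s).
Proof. by move=> t t' tt'; apply: eq_bigr => i _; rewrite (permP tt'). Qed.

Lemma he_gram_cons i s t : he_gram (i :: s) t = contract i t (he_gram s).
Proof.
rewrite contractE; last exact: he_gram_perm.
rewrite !(he_gram_D1 i)/= eqxx add1n gfunHeSl -mulrA; congr (_ * _).
have hj j : j != i -> (i == j) = false by rewrite eq_sym => /negbTE.
have [ti|ti] := boolP (i \in t); last first.
  rewrite rem_id//; congr (_ * _); last by apply: eq_bigr => j ji; rewrite hj.
  by move/count_memPn : ti => ->.
rewrite count_rem ti /= eqxx subn1; congr (_ * _); apply: eq_bigr => j ji.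
by rewrite count_rem ti /= !hj// subn0.
Qed.

(** If [t] has the multi-index [b], its [k!/b!] rearrangements each weigh [b!], and all other words
    weigh 0. *)
Lemma sum_he_gram k t F : size t = k -> perm_inv F ->
  \sum_(s <- words k) he_gram s t * F s = k`!%:R * F t.
Proof.
elim: k t F => [|k IH] t F.
  move=> /size0nil -> _; rewrite big_words0 fact0 mul1r /he_gram big1 ?mul1r// => i _.
  by rewrite gfunHe.
move=> tk Fi; rewrite big_wordsS.
transitivity (\sum_i (count_mem i t)%:R * (k`!%:R * F t)).
  apply: eq_bigr => i _.
  under eq_bigr do rewrite he_gram_cons (contractE _ _ (@he_gram_perm _)).
  under eq_bigr do rewrite -mulrA.
  rewrite -mulr_sumr.
  have [ti|/count_memPn ->] := boolP (i \in t); last by rewrite !mul0r.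
  rewrite IH; last 2 first.
  - by rewrite size_rem// tk.
  - by move=> u v uv; apply: Fi; rewrite perm_cons.
  by congr (_ * (_ * _)); apply: Fi; rewrite perm_sym perm_to_rem.
by rewrite -mulr_suml sum_count tk factS natrM mulrA.
Qed.

End defs.

Section wordprod.
Variables (I J : finType) (O : I -> J -> R).

(* The value 1 on words of different lengths is never used. *)
Fixpoint WP (t : seq I) (s : seq J) : R :=
  match t, s with
  | i :: t', j :: s' => O i j * WP t' s'
  | _, _ => 1
  end.

(** Contraction pairs letters through the identity matrix, which a change of variables with
    orthonormal rows preserves: contracting before or after it is the same. *)
Lemma WP_contract i t (F : seq J -> R) :
  (forall i i', \sum_j O i j * O i' j = (i == i')%:R) ->
  \sum_j O i j * (\sum_(s <- words J (size t)) WP t s * contract j s F) =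
  contract i t (fun t' => \sum_(s <- words J (size t')) WP t' s * F s).
Proof.
move=> OO; elim: t F => [|a t IH] F.
  by rewrite big1//= => j _; rewrite big_words0/= mulr0 mulr0.
rewrite /=.
have -> : (if i == a then \sum_(s <- words J (size t)) WP t s * F s else 0) =
    \sum_j O i j * O a j * (\sum_(s <- words J (size t)) WP t s * F s).
  by rewrite -mulr_suml OO; case: eqP => _; rewrite ?mul1r ?mul0r.
have -> : contract i t (fun t' => \sum_(s <- words J (size (a :: t'))) WP (a :: t') s * F s) =
    \sum_b O a b * (\sum_j O i j * (\sum_(s <- words J (size t)) WP t s * contract j s (fun s' => F (b :: s')))).
  under [RHS]eq_bigr do rewrite IH -contractZ.
  rewrite -contract_sum; apply: contract_ext => t'; rewrite big_wordsS; apply: eq_bigr => b _.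
  by rewrite mulr_sumr; apply: eq_bigr => s _; rewrite /= mulrA.
transitivity (\sum_j (O i j * O a j * (\sum_(s <- words J (size t)) WP t s * F s)
   + \sum_b O a b * (O i j * (\sum_(s <- words J (size t)) WP t s * contract j s (fun s' => F (b :: s')))))); last first.
  rewrite big_split/=; congr (_ + _); rewrite exchange_big/=; apply: eq_bigr => b _.
  by rewrite mulr_sumr.
apply: eq_bigr => j _; rewrite big_wordsS.
transitivity (O i j * \sum_b (\sum_(w <- words J (size t))
   ((if j == b then O a b * (WP t w * F w) else 0) + O a b * (WP t w * contract j w (fun s' => F (b :: s')))))).
  congr (_ * _); apply: eq_bigr => b _; apply: eq_bigr => w _ /=.
  by case: eqP => _; ring.
under eq_bigr do rewrite big_split/= -[X in _ + X]mulr_sumr.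
rewrite big_split/= mulrDr; congr (_ + _).
  rewrite (bigD1 j)//= eqxx [X in _ + X]big1 ?addr0 => [|b bj]; last first.
    by rewrite big1// => w _; rewrite eq_sym (negbTE bj).
  by rewrite -mulr_sumr mulrA.
by rewrite mulr_sumr; apply: eq_bigr => b _; rewrite mulrCA.
Qed.

(** Hermite tensors are equivariant under rotations. In the recursion [HW_cons] the linear term
    transforms letter by letter, and [WP_contract] takes care of the correction. *)
Lemma HW_rotate (t : seq I) (x : I -> R) (u : J -> R) :
  (forall i i', \sum_j O i j * O i' j = (i == i')%:R) ->
  (forall i, x i = \sum_j O i j * u j) ->
  HW t x = \sum_(s <- words J (size t)) WP t s * HW s u.
Proof.
move=> OO xu; have [k] := ubnP (size t); elim: k t => // k IH [|i t] tk.
  by rewrite big_words0/= !HW_nil mulr1.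
rewrite HW_cons IH// xu.
(* The induction is on a bound for the length: a contraction evaluates its function only at strictly
   shorter words. *)
rewrite (_ : contract i t _ = contract i t (fun t' => \sum_(s <- words J (size t')) WP t' s * HW s u)); last first.
  have : (size t < k)%N by [].
  move=> tk'.
  have h (F F' : seq I -> R) (s : seq I) : (forall s', (size s' < size s)%N -> F s' = F' s') -> contract i s F = contract i s F'.
    elim: s F F' => [|j s IHs] F F' FF' //=; rewrite FF'//; congr (_ + _).
    by apply: IHs => s' ss'; rewrite FF'.
  by apply: h => s' st; apply: IH; apply: ltn_trans st tk'.
rewrite -WP_contract// big_wordsS mulr_suml -sumrB; apply: eq_bigr => j _.
rewrite -mulrA mulr_sumr -mulrBr -sumrB mulr_sumr; apply: eq_bigr => s _ /=.
by rewrite HW_cons; ring.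
Qed.

End wordprod.

(** [WP A] is the tensor power of the matrix [A], so this is multiplicativity of tensor powers. *)
Lemma WP_comp (I J J' : finType) (A : I -> J -> R) (B : I -> J' -> R) (M : J -> J' -> R) k s s' :
  (forall j j', \sum_i A i j * B i j' = M j j') -> size s = k -> size s' = k ->
  \sum_(t <- words I k) WP A t s * WP B t s' = WP M s s'.
Proof.
move=> ABM; elim: k s s' => [|k IH] [|j s] [|j' s'] //.
  by move=> _ _; rewrite big_words0/= mulr1.
move=> [sk] [s'k]; rewrite big_wordsS/= -(IH s s')// -ABM mulr_suml.
by apply: eq_bigr => i _; rewrite mulr_sumr; apply: eq_bigr => t _; ring.
Qed.

Lemma big_words_emb (J J' : finType) (emb : J' -> J) (F : seq J -> R) k :
  injective emb ->
  (forall s, size s = k -> (exists2 j, j \in s & j \notin codom emb) -> F s = 0) ->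
  \sum_(s <- words J k) F s = \sum_(s <- words J' k) F (map emb s).
Proof.
move=> ei; elim: k F => [|k IH] F F0; first by rewrite !big_words0.
rewrite !big_wordsS.
transitivity (\sum_(j in codom emb) \sum_(w <- words J k) F (j :: w)).
  rewrite [RHS]big_mkcond/=; apply: eq_bigr => j _.
  case: ifPn => // je; rewrite big_seq big1// => w /size_words wk.
  by apply: F0; rewrite /= ?wk//; exists j; rewrite // mem_head.
rewrite -big_uniq/=; last by rewrite map_inj_uniq ?enum_uniq.
rewrite big_image/=; apply: eq_bigr => j _; apply: IH => s sk [i si ie].
by apply: F0; rewrite /= ?sk//; exists i; rewrite // inE si orbT.
Qed.

End words.

(** * From words to multi-indices and monomials *)

Section multi_index.
Variables (R : realFieldType) (I : finType).

Definition canon_word (b : I -> nat) : seq I := flatten [seq nseq (b i) i | i <- enum I].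

Lemma count_canon_word b i : count_mem i (canon_word b) = b i.
Proof.
rewrite /canon_word count_flatten -map_comp sumnE big_map big_enum/= (bigD1 i)//= count_nseq /= eqxx mul1n.
by rewrite big1 ?addn0// => j ji; rewrite /= count_nseq /= (negbTE ji).
Qed.

Lemma size_canon_word b : size (canon_word b) = (\sum_i b i)%N.
Proof.
rewrite /canon_word size_flatten /shape -map_comp sumnE big_map big_enum/=.
by apply: eq_bigr => i _; rewrite size_nseq.
Qed.

Lemma HW_canon_word b (x : I -> R) : HW (canon_word b) x = HI b x.
Proof. by apply: eq_bigr => i _; rewrite count_canon_word. Qed.

Lemma he_gram_count (s t : seq I) : he_gram R s t =
  if [forall i, count_mem i s == count_mem i t] then \prod_i (count_mem i t)`!%:R else 0.
Proof.
rewrite /he_gram; case: ifPn => [/forallP h|/forallPn[i ne]].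
  by apply: eq_bigr => i _; rewrite gfunHe (h i) (eqP (h i)).
by rewrite (bigD1 i)//= gfunHe (negbTE ne) mul0r.
Qed.

Section bounded.
Variable D : nat.
Implicit Types a b : {ffun I -> 'I_D.+1}.

Definition mult b : I -> nat := fun i => b i.

Lemma prod_gfunHe b b' : \prod_i gfun (He R (b i) * He R (b' i)) =
  if b == b' then \prod_i (b i)`!%:R else 0.
Proof.
have [->|] := eqVneq b b'; first by apply: eq_bigr => i _; rewrite gfunHe eqxx.
move=> /eqP bb'; have [i ne] : exists i, b i != b' i.
  by apply/existsP; apply: contraT; rewrite negb_exists => /forallP h; case: bb';
    apply/ffunP => i; apply/eqP; have := h i; rewrite negbK.
by rewrite (bigD1 i)//= gfunHe (negbTE (_ : b i != b' i :> nat))// mul0r.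
Qed.

(** A multi-index [b] of weight [k] is spelled by [k!/b!] words, so its weight [1/b!] becomes [1/k!]
    on each of them. *)
Lemma sum_index (F : seq I -> R) : perm_inv F ->
  \sum_(b : {ffun I -> 'I_D.+1} | (\sum_i b i <= D)%N)
     (\prod_i (b i)`!%:R)^-1 * F (canon_word (mult b)) =
  \sum_(k < D.+1) (k`!%:R)^-1 * \sum_(t <- words I k) F t.
Proof.
move=> Fi.
have f0 (k : nat) : k`!%:R != 0 :> R by rewrite pnatr_eq0 -lt0n fact_gt0.
transitivity (\sum_(b : {ffun I -> 'I_D.+1} | (\sum_i b i <= D)%N)
    \sum_(k < D.+1 | k == (\sum_i b i)%N :> nat) (k`!%:R)^-1 *
    \sum_(t <- words I k) (if [forall i, count_mem i t == b i] then F t else 0)).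
  apply: eq_bigr => b bD.
  have bD' : ((\sum_i b i)%N < D.+1)%N by [].
  rewrite (big_pred1 (Ordinal bD')) => [|k /=]; last by rewrite -val_eqE.
  (* Multiplying and dividing by [k!] lets [sum_he_gram] spread the value at the canonical word over
     all its rearrangements. *)
  rewrite /= -[F (canon_word (mult b))](mulKf (f0 (\sum_i b i)%N)) -sum_he_gram//; last exact: size_canon_word.
  rewrite mulrCA mulr_sumr; congr (_ * _); apply: eq_bigr => t _.
  rewrite he_gram_count; under eq_forallb do rewrite count_canon_word.
  case: ifP => _; last by rewrite mul0r mulr0.
  have -> : \prod_i (count_mem i (canon_word (mult b)))`!%:R = \prod_i (b i)`!%:R :> R.
    by apply: eq_bigr => i _; rewrite count_canon_word.
  by rewrite mulKf//; apply/prodf_neq0 => i _.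
rewrite (exchange_big_dep xpredT)//=; apply: eq_bigr => k _.
rewrite -mulr_sumr; congr (_ * _); rewrite exchange_big/= big_seq [RHS]big_seq.
apply: eq_bigr => t /size_words tk.
have ck i : (count_mem i t < D.+1)%N.
  by rewrite (leq_ltn_trans (count_size _ _))// tk.
pose bt : {ffun I -> 'I_D.+1} := [ffun i => Ordinal (ck i)].
have btE i : bt i = count_mem i t :> nat by rewrite ffunE.
have sbt : (\sum_i bt i)%N = k.
  apply/eqP; rewrite -(eqr_nat R) natr_sum -tk -(sum_count R t).
  by apply/eqP/eq_bigr => i _; rewrite btE.
rewrite (bigD1 bt)/=; last by rewrite sbt -ltnS ltn_ord eqxx.
rewrite (_ : [forall _, _] = true); last by apply/forallP => i; rewrite btE.
rewrite big1 ?addr0// => b /andP[_ bbt]; case: ifP => // /forallP h.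
by case/negP: bbt; apply/eqP/ffunP => i; apply/val_inj; rewrite /= btE (eqP (h i)).
Qed.

Lemma prod_expand (p : I -> {poly R}) (x : I -> R) :
  (forall i, (size (p i) <= D.+1)%N) ->
  \prod_i (p i).[x i] = \sum_(a : {ffun I -> 'I_D.+1}) (\prod_i (p i)`_(a i)) * \prod_i x i ^+ a i.
Proof.
move=> pD; under eq_bigr do rewrite (horner_coef_wide _ (pD _)).
rewrite bigA_distr_bigA/=; apply: eq_bigr => a _; by rewrite big_split.
Qed.

Lemma HI_expand b (x : I -> R) : (\sum_i b i <= D)%N ->
  HI (mult b) x = \sum_(a : {ffun I -> 'I_D.+1} | (\sum_i a i <= D)%N)
     (\prod_i (He R (b i))`_(a i)) * \prod_i x i ^+ a i.
Proof.
move=> bD; rewrite /HI prod_expand => [|i]; last by rewrite (size_He R _).1 ltn_ord.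
rewrite [RHS]big_mkcond/=; apply: eq_bigr => a _; case: ifPn => // aD.
have [i bai] : exists i, (b i < a i)%N.
  apply/existsP; apply: contraT; rewrite negb_exists => /forallP h.
  case/negP: aD; apply: leq_trans bD; apply: leq_sum => i _.
  by rewrite leqNgt.
rewrite (bigD1 i)//= nth_default ?mul0r//.
by rewrite (size_He R _).1.
Qed.

(** The expansion stays within total degree [D]: a multi-index of larger weight exceeds [a] at some
    coordinate, where the Hermite coefficient of the monomial is 0 by orthogonality. *)
Lemma monom_expand a (x : I -> R) : (\sum_i a i <= D)%N ->
  \prod_i x i ^+ a i = \sum_(b : {ffun I -> 'I_D.+1} | (\sum_i b i <= D)%N)
     (\prod_i (b i)`!%:R)^-1 * (\prod_i gfun ('X^(a i) * He R (b i))) * HI (mult b) x.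
Proof.
move=> aD.
transitivity (\prod_i \sum_(j < D.+1) (gfun ('X^(a i) * He R j) / j`!%:R) * (He R j).[x i]).
  apply: eq_bigr => i _; rewrite -[LHS]hornerXn [in LHS](@He_expand R D.+1 'X^(a i)).
    by rewrite horner_sum; apply: eq_bigr => j _; rewrite hornerZ.
  by rewrite size_polyXn ltn_ord.
rewrite bigA_distr_bigA/= [RHS]big_mkcond/=; apply: eq_bigr => b _; case: ifPn => bD.
  by rewrite !big_split/= prodfV [X in X * _ = _]mulrC.
have [i abi] : exists i, (a i < b i)%N.
  apply/existsP; apply: contraT; rewrite negb_exists => /forallP h.
  case/negP: bD; apply: leq_trans aD; apply: leq_sum => i _.
  by rewrite leqNgt.
by rewrite (bigD1 i)//= gfun_He_eq0 ?size_polyXn// !mul0r.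
Qed.

End bounded.
End multi_index.

(** * Counting the surviving words *)

Section counting.

Definition good_word (T : finType) (kap : nat) (w : seq T) :=
  [forall i, (count_mem i w == 0%N) || (kap <= count_mem i w)%N].

Lemma sum_countN (T : finType) (s : seq T) : (\sum_i count_mem i s)%N = size s.
Proof. by apply/eqP; rewrite -(eqr_nat rat) natr_sum sum_count. Qed.

(* A good word has at most k/kap distinct letters: it is read off a choice of k/kap
   letters and of one of these for each position. *)
Lemma count_good_word (T : finType) (kap k : nat) : (0 < kap)%N ->
  (count (good_word kap) (words T k) <= #|T| ^ (k %/ kap) * (k %/ kap) ^ k)%N.
Proof.
move=> kap0; case: k => [|k].
  by rewrite div0n expn0 mul1n expn0 (leq_trans (count_size _ _)).
set J := (k.+1 %/ kap)%N.
pose g (up : {ffun 'I_J -> T} * {ffun 'I_k.+1 -> 'I_J}) : seq T :=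
  [seq up.1 (up.2 a) | a <- enum 'I_k.+1].
pose S := [seq g up | up <- enum {: {ffun 'I_J -> T} * {ffun 'I_k.+1 -> 'I_J}}].
have -> : (#|T| ^ J * J ^ k.+1)%N = size S.
  by rewrite size_map -cardE card_prod !card_ffun !card_ord.
rewrite -size_filter; apply: uniq_leq_size; first by rewrite filter_uniq// words_uniq.
move=> w; rewrite mem_filter => /andP[/forallP gw /size_words wk].
case: w wk gw => [//|x0 w'] wk; set w := x0 :: w' in wk * => gw.
pose e := undup w.
have eJ : (size e <= J)%N.
  rewrite /J leq_divRL//.
  have ce : #|e| = size e := card_uniqP (undup_uniq w).
  rewrite -wk -(sum_countN w) -ce -sum_nat_const big_mkcond/=.
  apply: leq_sum => i _; case: ifP => //; rewrite mem_undup => iw.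
  by have /orP[/eqP/count_memPn|//] := gw i; rewrite iw.
have e0 : (0 < J)%N.
  by apply: leq_trans eJ; rewrite -has_predT; apply/hasP; exists x0; rewrite // mem_undup mem_head.
have ix a : (index (nth x0 w a) e < J)%N \/ (size w <= a)%N.
  have [wa|aw] := leqP (size w) a; [by right|left].
  by apply: leq_trans eJ; rewrite index_mem mem_undup mem_nth.
(* When [e] is shorter than [J] the table [u] is padded with [x0]. No position of [w] points to the
   padding, and the default [Ordinal e0] below is never reached. *)
pose u : {ffun 'I_J -> T} := [ffun j : 'I_J => nth x0 e j].
pose p : {ffun 'I_k.+1 -> 'I_J} := [ffun a : 'I_k.+1 => insubd (Ordinal e0) (index (nth x0 w a) e)].
apply/mapP; exists (u, p); first by rewrite mem_enum.
apply: (@eq_from_nth _ x0); first by rewrite size_map size_enum_ord.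
move=> a aw; have ak : (a < k.+1)%N by rewrite -wk.
rewrite (nth_map (Ordinal ak)) ?size_enum_ord//= !ffunE nth_enum_ord//.
rewrite val_insubd; have [->|] := ix a; last by rewrite leqNgt aw.
by rewrite nth_index// mem_undup mem_nth.
Qed.

Variable R : realFieldType.

Lemma big_words_zip (A B : finType) k (F : seq (A * B) -> R) :
  \sum_(s <- words _ k) F s = \sum_(w <- words A k) \sum_(v <- words B k) F (zip w v).
Proof.
elim: k F => [|k IH] F; first by rewrite !big_words0.
rewrite !big_wordsS/=.
transitivity (\sum_a \sum_b \sum_(s <- words (A * B)%type k) F ((a, b) :: s)).
  by rewrite pair_bigA; apply: eq_bigr => -[a b].
apply: eq_bigr => a _.
transitivity (\sum_b \sum_(w <- words A k) \sum_(v <- words B k) F (zip (a :: w) (b :: v))).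
  by apply: eq_bigr => b _; rewrite IH.
rewrite exchange_big/=; apply: eq_bigr => w _; by rewrite big_wordsS.
Qed.

Lemma size_wordsE (A : finType) k : size (words A k) = (#|A| ^ k)%N.
Proof. by elim: k => [|k IH] //; rewrite /= size_allpairs IH expnS cardE. Qed.

(** A pair consists of one good sample word and two free coordinate words. The latter give [q^(2k)];
    the former number at most [n^(k/kap) k^k], where [rho] plays the part of [n^(1/kap)]. *)
Lemma sum_good_pairs (n q kap k : nat) (rho : R) : (0 < kap)%N -> (0 < k)%N ->
  1 <= rho -> n%:R <= rho ^+ kap ->
  \sum_(s <- words ('I_n * 'I_q)%type k) \sum_(s' <- words ('I_n * 'I_q)%type k)
    ((good_word kap (map fst s) && (map fst s == map fst s'))%:R : R) <=
  (k%:R * rho * q%:R ^+ 2) ^+ k.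
Proof.
move=> kap0 k0 rho1 nrho.
have fz w v : w \in words 'I_n k -> v \in words 'I_q k -> map fst (zip w v) = w.
  by move=> /size_words wk /size_words vk; rewrite -/(unzip1 _) unzip1_zip// wk vk.
rewrite big_words_zip big_seq.
rewrite (eq_bigr (fun w => ((good_word kap w)%:R * (q ^ k * q ^ k)%:R))); last first.
  move=> w wW; rewrite big_seq.
  rewrite (eq_bigr (fun v => ((good_word kap w)%:R * (q ^ k)%:R))); last first.
    move=> v vW; rewrite fz// big_words_zip (bigD1_seq w) ?words_uniq//=.
    rewrite [X in _ + X]big1_seq ?addr0; last first.
      move=> w' /andP[ww' w'W]; rewrite big1_seq// => v' /andP[_ v'W].
      by rewrite fz// eq_sym (negbTE ww') andbF.
    rewrite big_seq (eq_bigr (fun=> (good_word kap w)%:R)); last first.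
      by move=> v' v'W; rewrite fz// eqxx andbT.
    by rewrite -big_seq big_const_seq count_predT size_wordsE card_ord iter_addr_0 mulr_natr.
  by rewrite -big_seq big_const_seq count_predT size_wordsE card_ord iter_addr_0 -[LHS]mulr_natr natrM mulrA.
rewrite -big_seq -mulr_suml -natr_sum.
have -> : (\sum_(w <- words 'I_n k) good_word kap w)%N = count (good_word kap) (words 'I_n k).
  by rewrite -sum1_count [RHS]big_mkcond; apply: eq_bigr => w _; case: good_word.
rewrite !exprMn natrM natrX.
rewrite ler_wpM2r ?mulr_ge0 ?exprn_ge0//.
apply: (@le_trans _ _ (#|'I_n| ^ (k %/ kap) * (k %/ kap) ^ k)%:R).
  rewrite ler_nat; exact: count_good_word.
rewrite natrM mulrC ler_pM//.
  by rewrite natrX lerXn2r ?nnegrE// ler_nat leq_div.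
rewrite card_ord natrX (le_trans (lerXn2r _ _ _ nrho)) ?nnegrE// ?exprn_ge0 ?(le_trans ler01)//.
by rewrite -exprM ler_weXn2l// mulnC leq_trunc_div.
Qed.

Lemma WP_block_le (n q k : nat) (M : 'I_q -> 'I_q -> R) (X : R) s s' :
  (forall b b', `|M b b'| <= X) -> size s = k -> size s' = k ->
  `|WP (fun ib jb : 'I_n * 'I_q => (ib.1 == jb.1)%:R * M ib.2 jb.2) s s'| <=
  (map fst s == map fst s')%:R * X ^+ k.
Proof.
move=> MX; elim: k s s' => [|k IH] [|[i b] s] [|[j b'] s'] //.
  by move=> _ _; rewrite /= normr1 mul1r.
move=> [sk] [s'k] /=; rewrite eqseq_cons /= !normrM.
have [_|_] := eqVneq i j; last by rewrite normr0 !mul0r.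
rewrite normr1 mul1r /= exprS mulrCA ler_pM//; first exact: IH.
Qed.

End counting.

(** * Image measures and expectations *)

Section measurable_proj.
Context d d1 d2 (T : measurableType d) (T1 : measurableType d1) (T2 : measurableType d2).
Variable f : T -> T1 * T2.
Hypothesis mf : measurable_fun setT f.

Lemma measurable_fst_comp : measurable_fun setT (fun x => (f x).1).
Proof. exact: measurableT_comp measurable_fst mf. Qed.

Lemma measurable_snd_comp : measurable_fun setT (fun x => (f x).2).
Proof. exact: measurableT_comp measurable_snd mf. Qed.

End measurable_proj.

Section pushes.
Context d d' (T : measurableType d) (T' : measurableType d') (R : realType).
Variables (B : probability T R) (A : probability T' R).
Local Open Scope ereal_scope.

(** Image measure as a relation rather than a construction, since the target is usually a law built
    in another way: a product, an n-fold power, a fibre of a kernel. *)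
Definition pushes (psi : T -> T') :=
  measurable_fun setT psi /\ forall U, measurable U -> A U = B (psi @^-1` U).

Variable psi : T -> T'.
Hypothesis BA : pushes psi.

Lemma pushes_ge0_integral (F : T' -> \bar R) : measurable_fun setT F ->
  (forall x, 0 <= F x) -> \int[A]_x F x = \int[B]_x F (psi x).
Proof.
move: BA => [mpsi BAE] mF F0.
rewrite -[RHS](@ge0_integral_pushforward _ _ _ _ _ _ mpsi B setT F)//.
by apply: eq_measure_integral => U mU _; exact: BAE.
Qed.

Lemma pushes_integral (F : T' -> \bar R) : measurable_fun setT F ->
  \int[A]_x F x = \int[B]_x F (psi x).
Proof.
move=> mF; rewrite integralE [RHS]integralE.
have mp : measurable_fun setT F^\+ by exact: measurable_funepos.
have mn : measurable_fun setT F^\- by exact: measurable_funeneg.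
rewrite (pushes_ge0_integral mp)// (pushes_ge0_integral mn)//. by rewrite !unlock.
Qed.

Lemma pushes_integrable (F : T' -> \bar R) : measurable_fun setT F ->
  A.-integrable setT F <-> B.-integrable setT (F \o psi).
Proof.
move=> mF; split => /integrableP[_ iF]; apply/integrableP; split => //.
- by apply: measurableT_comp => //; exact: BA.1.
- by rewrite pushes_ge0_integral// in iF; exact: measurableT_comp.
- by rewrite pushes_ge0_integral//; exact: measurableT_comp.
Qed.

End pushes.

Section pushes_op.
Variable R : realType.
Local Open Scope ereal_scope.

Lemma pushes_law d d' (T : measurableType d) (T' : measurableType d')
    (P : probability T R) (f : T -> T') (mf : measurable_fun setT f) :
  pushes P (law P mf) f.
Proof. by []. Qed.

Lemma pushes_comp d1 d2 d3 (T1 : measurableType d1) (T2 : measurableType d2)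
    (T3 : measurableType d3) (P1 : probability T1 R) (P2 : probability T2 R)
    (P3 : probability T3 R) f g :
  pushes P1 P2 f -> pushes P2 P3 g -> pushes P1 P3 (g \o f).
Proof.
move=> [mf Pf] [mg Pg]; split; first exact: measurableT_comp.
move=> U mU; rewrite Pg// Pf// -[X in measurable X]setTI.
exact: mg.
Qed.

Lemma pushes_of_integral d d' (T : measurableType d) (T' : measurableType d')
    (B : probability T R) (A : probability T' R) (psi : T -> T') :
  measurable_fun setT psi ->
  (forall F : T' -> \bar R, measurable_fun setT F -> (forall x, 0 <= F x) ->
    \int[A]_x F x = \int[B]_x F (psi x)) ->
  pushes B A psi.
Proof.
move=> mpsi h; split => // U mU.
have := h (EFin \o \1_U); rewrite /= integral_indic// setIT => -> //; last first.
  by apply/measurable_EFinP.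
have mU' : measurable (psi @^-1` U) by rewrite -[X in measurable X]setTI; exact: mpsi.
by rewrite -[X in B X]setIT -integral_indic.
Qed.

Lemma pushes_prod d1 d2 d3 d4 (T1 : measurableType d1) (T2 : measurableType d2)
    (T3 : measurableType d3) (T4 : measurableType d4)
    (P1 : probability T1 R) (P2 : probability T2 R)
    (P3 : probability T3 R) (P4 : probability T4 R) f g :
  pushes P1 P3 f -> pushes P2 P4 g ->
  pushes (P1 \x P2) (P3 \x P4) (fun t => (f t.1, g t.2)).
Proof.
move=> Pf Pg.
have mfg : measurable_fun setT (fun t : T1 * T2 => (f t.1, g t.2)).
  apply: measurable_fun_pair.
    exact: measurableT_comp Pf.1 _.
  exact: measurableT_comp Pg.1 _.
apply: pushes_of_integral => // F mF F0.
rewrite fubini_tonelli1// fubini_tonelli1//=; last exact: measurableT_comp mF mfg.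
rewrite (pushes_ge0_integral Pf)//.
- apply: eq_integral => x _; rewrite /fubini_F/= (pushes_ge0_integral Pg)//.
  exact: measurableT_comp mF _.
- exact: measurable_fun_fubini_tonelli_F.
- by move=> x; apply: integral_ge0.
Qed.

Lemma pushes_id d (T : measurableType d) (P : probability T R) : pushes P P id.
Proof. by split => //; exact: measurable_id. Qed.

Lemma pushes_iid_cons d (T : measurableType d) (P : probability T R) n :
  pushes (P \x iid n P) (iid n.+1 P) (fun tt => [tuple of tt.1 :: tt.2]).
Proof. exact: pushes_law. Qed.

Lemma iid_ge0_integralS d (T : measurableType d) (P : probability T R) n
    (F : n.+1.-tuple T -> \bar R) :
  measurable_fun setT F -> (forall x, 0 <= F x) ->
  \int[iid n.+1 P]_w F w = \int[P]_a \int[iid n P]_w F [tuple of a :: w].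
Proof.
move=> mF F0; rewrite (pushes_ge0_integral (pushes_iid_cons P n))// fubini_tonelli1//.
by apply: measurableT_comp => //; exact: (pushes_iid_cons P n).1.
Qed.

Lemma iid_ge0_integral0 d (T : measurableType d) (P : probability T R)
    (F : 0.-tuple T -> \bar R) :
  measurable_fun setT F -> \int[iid 0 P]_w F w = F [tuple].
Proof. by move=> mF; rewrite integral_dirac// diracE mem_setT mul1e. Qed.

Lemma measurable_map_tuple d d' (T : measurableType d) (T' : measurableType d') n
    (f : T -> T') : measurable_fun setT f ->
  measurable_fun setT (fun w : n.-tuple T => [tuple of map f w]).
Proof.
move=> mf; apply/measurable_fun_tnthP => i.
rewrite (_ : _ \o _ = f \o (@tnth _ _ ^~ i)); last first.
  by apply/funext => w /=; rewrite tnth_map.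
exact: measurableT_comp (measurable_tnth _).
Qed.

Lemma pushes_iid d d' (T : measurableType d) (T' : measurableType d')
    (B : probability T R) (A : probability T' R) psi n :
  pushes B A psi -> pushes (iid n B) (iid n A) (fun w => [tuple of map psi w]).
Proof.
move=> BA; have mm k := @measurable_map_tuple _ _ T T' k psi BA.1.
elim: n => [|n IH]; apply: pushes_of_integral (mm _) _ => F mF F0.
  rewrite [LHS]iid_ge0_integral0// [RHS]iid_ge0_integral0.
    by congr F; exact/val_inj.
  exact: measurableT_comp mF (mm _).
rewrite iid_ge0_integralS// iid_ge0_integralS//; last exact: measurableT_comp mF (mm _).
rewrite (pushes_ge0_integral BA).
- apply: eq_integral => a _; rewrite (pushes_ge0_integral IH)//.
    by apply: eq_integral => w _; congr F; exact/val_inj.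
  apply: (measurableT_comp mF).
  by apply: measurable_cons => //; exact: measurable_cst.
- apply: (@measurable_fun_fubini_tonelli_F _ _ _ _ _ (iid n A)
    (fun aw => F [tuple of aw.1 :: aw.2])) => //.
  exact: measurableT_comp mF (pushes_iid_cons A n).1.
- by move=> a; exact: integral_ge0.
Qed.

Definition ziptuple (T T' : Type) n (w : n.-tuple T * n.-tuple T') : n.-tuple (T * T') :=
  [tuple (tnth w.1 i, tnth w.2 i) | i < n].

Lemma measurable_ziptuple d d' (T : measurableType d) (T' : measurableType d') n :
  measurable_fun setT (@ziptuple T T' n).
Proof.
apply/measurable_fun_tnthP => i.
rewrite (_ : _ \o _ = fun w : n.-tuple T * n.-tuple T' => (tnth w.1 i, tnth w.2 i)).
  apply: measurable_fun_pair.
    exact: measurableT_comp (measurable_tnth i) measurable_fst.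
  exact: measurableT_comp (measurable_tnth i) measurable_snd.
by apply/funext => w /=; rewrite tnth_mktuple.
Qed.

Lemma ziptuple_cons (T T' : Type) n (a : T) (b : T') (w : n.-tuple T) (w' : n.-tuple T') :
  ziptuple ([tuple of a :: w], [tuple of b :: w']) = [tuple of (a, b) :: ziptuple (w, w')].
Proof.
apply: eq_from_tnth => i; rewrite tnth_mktuple /=.
case: (unliftP ord0 i) => [j ->|->]; last by rewrite !tnth0.
by rewrite !tnthS tnth_mktuple.
Qed.

(** This regrouping separates all the inputs from all the labels, so that Fubini can be applied to
    the two groups. *)
Lemma pushes_zip d d' (T : measurableType d) (T' : measurableType d')
    (A : probability T R) (B : probability T' R) n :
  pushes (iid n A \x iid n B) (iid n (A \x B)) (@ziptuple T T' n).
Proof.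
have mz := @measurable_ziptuple _ _ T T'.
elim: n => [|n IH]; apply: pushes_of_integral (mz _) _ => F mF F0.
  have mFz := measurableT_comp mF (mz 0%N).
  rewrite iid_ge0_integral0// fubini_tonelli1//.
  rewrite [RHS]iid_ge0_integral0; last first.
    by apply: measurable_fun_fubini_tonelli_F.
  rewrite /fubini_F [RHS]iid_ge0_integral0.
    by congr F; exact/esym/tuple0.
  exact: measurableT_comp mFz _.
have mFz := measurableT_comp mF (mz n.+1).
have mFc : measurable_fun setT (fun aw : (T * T') * n.-tuple (T * T') => F [tuple of aw.1 :: aw.2]).
  exact: measurableT_comp mF (pushes_iid_cons (A \x B) n).1.
have mG0 : measurable_fun setT
    (fun a : T * T' => \int[iid n (A \x B)]_w F [tuple of a :: w]).
  have := measurable_fun_fubini_tonelli_F (m2 := iid n (A \x B)%E) _ mFc.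
  by apply => x; exact: F0.
rewrite iid_ge0_integralS// fubini_tonelli1//; last first.
  by move=> x; apply: integral_ge0 => w _; exact: F0.
rewrite fubini_tonelli1//.
rewrite iid_ge0_integralS/=; [|
  by apply: measurable_fun_fubini_tonelli_F|
  by move=> a; exact: integral_ge0].
apply: eq_integral => a _; rewrite /fubini_F/=.
transitivity (\int[iid n A]_w \int[B]_b \int[iid n B]_w'
    F [tuple of (a, b) :: ziptuple (w, w')]); last first.
  apply: eq_integral => w _; rewrite iid_ge0_integralS//.
    by apply: eq_integral => b _; apply: eq_integral => w' _; rewrite ziptuple_cons.
  by apply: (measurableT_comp mF); exact: measurableT_comp (mz n.+1) _.
have mG : measurable_fun setT (fun x : n.-tuple T * (T' * n.-tuple T') =>
    F [tuple of (a, x.2.1) :: ziptuple (x.1, x.2.2)]).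
  apply: (measurableT_comp mF); apply: measurable_cons.
    apply: measurable_fun_pair; first exact: measurable_cst.
    exact: measurable_fst_comp.
  apply: (measurableT_comp (mz n)); apply: measurable_fun_pair.
    exact: measurable_fst.
  exact: measurable_snd_comp.
pose G := fun x : (n.-tuple T * T') * (n.-tuple T') =>
  F [tuple of (a, x.1.2) :: ziptuple (x.1.1, x.2)].
have mG' : measurable_fun setT (fun wb => \int[iid n B]_w' G (wb, w')).
  have := measurable_fun_fubini_tonelli_F (m2 := iid n B) G.
  apply; last by move=> x; exact: F0.
  apply: (@measurableT_comp _ _ _ _ _ _ _ _
    (fun x : (n.-tuple T * T') * (n.-tuple T') => (x.1.1, (x.1.2, x.2))) mG).
  apply: measurable_fun_pair; first exact: measurable_fst_comp.
  apply: measurable_fun_pair; last exact: measurable_snd.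
  exact: measurable_snd_comp.
(* The only exchange: the integrals come in the order [a, w, b, w'] on one side and [a, b, w, w'] on
   the other. *)
have -> := fubini_tonelli (m1 := iid n A) (m2 := B) _ mG'; last first.
  by move=> wb; apply: integral_ge0 => w' _; exact: F0.
apply: eq_integral => b _.
have mH : measurable_fun setT (fun w : n.-tuple (T * T') => F [tuple of (a, b) :: w]).
  by apply: (measurableT_comp mF); apply: measurable_cons => //; exact: measurable_cst.
rewrite (pushes_ge0_integral IH)// fubini_tonelli1//.
  exact: measurableT_comp mH (mz n).
Qed.

End pushes_op.

Section expectation.
Context d (T : measurableType d) (R : realType).
Implicit Types (P : probability T R) (f g : T -> R).

Definition intg P f := P.-integrable setT (EFin \o f).
Definition Ex P f : R := \int[P]_x f x.
Definition sqi P f := measurable_fun setT f /\ intg P (fun x => f x ^+ 2).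

Lemma intg_meas P f : intg P f -> measurable_fun setT f.
Proof. by move=> /measurable_int/measurable_EFinP. Qed.

Lemma ExE P f : intg P f -> (\int[P]_x (f x)%:E = (Ex P f)%:E)%E.
Proof. by move=> h; rewrite /Ex /Rintegral fineK//; exact: integrable_fin_num. Qed.

Lemma eq_Ex P f g : f =1 g -> Ex P f = Ex P g.
Proof. by move=> fg; apply: eq_Rintegral => x _; exact: fg. Qed.

Lemma eq_intg P f g : f =1 g -> intg P f -> intg P g.
Proof. by move=> /funext ->. Qed.

Lemma eq_sqi P f g : f =1 g -> sqi P f -> sqi P g.
Proof. by move=> /funext ->. Qed.

Lemma intgD P f g : intg P f -> intg P g -> intg P (fun x => f x + g x).
Proof. by move=> hf hg; exact: (integrableD measurableT hf hg). Qed.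

Lemma intgZ P a f : intg P f -> intg P (fun x => a * f x).
Proof. by move=> hf; exact: (integrableZl measurableT a hf). Qed.

Lemma intgN P f : intg P f -> intg P (fun x => - f x).
Proof. by move=> /(intgZ (-1)); apply: eq_intg => x; rewrite mulN1r. Qed.

Lemma intgB P f g : intg P f -> intg P g -> intg P (fun x => f x - g x).
Proof. by move=> hf hg; apply: intgD => //; exact: intgN. Qed.

Lemma intg_cst P c : intg P (cst c).
Proof. exact: finite_measure_integrable_cst. Qed.

Lemma intg_sum (I : Type) (r : seq I) (p : pred I) P (F : I -> T -> R) :
  (forall i, p i -> intg P (F i)) -> intg P (fun x => \sum_(i <- r | p i) F i x).
Proof.
elim: r => [|i r IH] h.
  by apply: (eq_intg _ (intg_cst P 0)) => x; rewrite big_nil.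
have := IH h; have [pi|pi] := boolP (p i) => h'.
  by apply: (eq_intg _ (intgD (h i pi) h')) => x; rewrite big_cons pi.
by apply: (eq_intg _ h') => x; rewrite big_cons (negbTE pi).
Qed.

Lemma ExD P f g : intg P f -> intg P g -> Ex P (fun x => f x + g x) = Ex P f + Ex P g.
Proof. exact: RintegralD. Qed.

Lemma ExB P f g : intg P f -> intg P g -> Ex P (fun x => f x - g x) = Ex P f - Ex P g.
Proof. exact: RintegralB. Qed.

Lemma ExZ P a f : intg P f -> Ex P (fun x => a * f x) = a * Ex P f.
Proof. exact: RintegralZl. Qed.

Lemma Ex_cst P c : Ex P (fun=> c) = c.
Proof.
have p1 : P setT = 1%E := probability_setT P.
by rewrite /Ex Rintegral_cst// [X in fine X]p1 mulr1.
Qed.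

Lemma Ex_sum (I : Type) (r : seq I) (p : pred I) P (F : I -> T -> R) :
  (forall i, p i -> intg P (F i)) ->
  Ex P (fun x => \sum_(i <- r | p i) F i x) = \sum_(i <- r | p i) Ex P (F i).
Proof.
elim: r => [|i r IH] h.
  rewrite big_nil -[RHS](Ex_cst P); apply: eq_Ex => x; by rewrite big_nil.
rewrite big_cons -IH//; case: ifPn => pi.
  rewrite -ExD//; [|exact: h|exact: intg_sum].
  by apply: eq_Ex => x; rewrite big_cons pi.
by apply: eq_Ex => x; rewrite big_cons (negbTE pi).
Qed.

Lemma Ex_ge0 P f : (forall x, 0 <= f x) -> 0 <= Ex P f.
Proof. by move=> f0; apply: Rintegral_ge0. Qed.

Lemma Ex_le P f g : intg P f -> intg P g -> (forall x, f x <= g x) -> Ex P f <= Ex P g.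
Proof. by move=> hf hg fg; apply: le_Rintegral. Qed.

Lemma intg_le P f g : measurable_fun setT f -> intg P g ->
  (forall x, `|f x| <= g x) -> intg P f.
Proof.
move=> mf hg fg; apply: (le_integrable measurableT _ _ hg); first exact/measurable_EFinP.
by move=> x _; rewrite /= lee_fin (le_trans (fg x))// ler_norm.
Qed.

Lemma intg_norm P f : intg P f -> intg P (fun x => `|f x|).
Proof. by move=> hf; exact: (integrable_norm hf). Qed.

Lemma Ex_norm_le P f g : intg P f -> intg P g -> (forall x, `|f x| <= g x) ->
  `|Ex P f| <= Ex P g.
Proof.
move=> hf hg fg; apply: le_trans (le_normr_Rintegral measurableT hf) _.
by apply: Ex_le => //; exact: intg_norm.
Qed.

Lemma mul_le_sqr (a b : R) : `|a * b| <= 2^-1 * (a ^+ 2 + b ^+ 2).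
Proof.
rewrite normrM -[a ^+ 2]real_normK ?num_real// -[b ^+ 2]real_normK ?num_real//.
by have := sqr_ge0 (`|a| - `|b|); rewrite sqrrB; lra.
Qed.

Lemma intgM P f g : sqi P f -> sqi P g -> intg P (fun x => f x * g x).
Proof.
move=> [mf f2] [mg g2].
apply: (@intg_le _ _ (fun x => 2^-1 * (f x ^+ 2 + g x ^+ 2))).
- exact: measurable_funM.
- by apply: intgZ; exact: intgD.
- by move=> x; exact: mul_le_sqr.
Qed.

(** The arithmetic-geometric form of Cauchy-Schwarz; it costs nothing when both second moments obey
    the same bound. *)
Lemma ExM_le P f g : sqi P f -> sqi P g ->
  `|Ex P (fun x => f x * g x)| <= 2^-1 * (Ex P (fun x => f x ^+ 2) + Ex P (fun x => g x ^+ 2)).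
Proof.
move=> hf hg; rewrite -ExD; [|exact: hf.2|exact: hg.2].
rewrite -ExZ; last by apply: intgD; [exact: hf.2|exact: hg.2].
apply: Ex_norm_le; first exact: intgM.
- by apply: intgZ; apply: intgD; [exact: hf.2|exact: hg.2].
- by move=> x; exact: mul_le_sqr.
Qed.

Lemma sqi_cst P c : sqi P (cst c).
Proof. by split; [exact: measurable_cst|exact: (intg_cst P (c ^+ 2))]. Qed.

Lemma sqi_intg P f : sqi P f -> intg P f.
Proof.
by move=> hf; apply: (eq_intg _ (intgM hf (sqi_cst P 1))) => x; rewrite mulr1.
Qed.

Lemma sqi_le P f g : measurable_fun setT f -> sqi P g ->
  (forall x, `|f x| <= `|g x|) -> sqi P f.
Proof.
move=> mf [mg g2] fg; split => //; apply: (intg_le _ g2); first exact: measurable_funX.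
move=> x; rewrite normrX -[leRHS]real_normK ?num_real//.
by rewrite lerXn2r ?nnegrE.
Qed.

Lemma sqiD P f g : sqi P f -> sqi P g -> sqi P (fun x => f x + g x).
Proof.
move=> [mf f2] [mg g2]; split; first exact: measurable_funD.
apply: (@intg_le _ _ (fun x => 2 * (f x ^+ 2 + g x ^+ 2))).
- by apply: measurable_funX; exact: measurable_funD.
- by apply: intgZ; exact: intgD.
- move=> x; rewrite ger0_norm ?sqr_ge0//.
  by have := sqr_ge0 (f x - g x); rewrite sqrrB sqrrD; lra.
Qed.

Lemma sqiZ P a f : sqi P f -> sqi P (fun x => a * f x).
Proof.
move=> [mf f2]; split; first exact: measurable_funM.
by apply: (eq_intg _ (intgZ (a ^+ 2) f2)) => x; rewrite exprMn.
Qed.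

Lemma sqi_sum (I : Type) (r : seq I) (p : pred I) P (F : I -> T -> R) :
  (forall i, p i -> sqi P (F i)) -> sqi P (fun x => \sum_(i <- r | p i) F i x).
Proof.
elim: r => [|i r IH] h.
  by apply: (eq_sqi _ (sqi_cst P 0)) => x; rewrite big_nil.
have := IH h; have [pi|pi] := boolP (p i) => h'.
  by apply: (eq_sqi _ (sqiD (h i pi) h')) => x; rewrite big_cons pi.
by apply: (eq_sqi _ h') => x; rewrite big_cons (negbTE pi).
Qed.

Lemma intg_ge0P P f : measurable_fun setT f -> (forall x, 0 <= f x) ->
  (\int[P]_x (f x)%:E < +oo)%E -> intg P f.
Proof.
move=> mf f0 h; apply/integrableP; split; first exact/measurable_EFinP.
by under eq_integral do rewrite /= ger0_norm//.
Qed.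

End expectation.

Section expectation_pushes.
Context d d' (T : measurableType d) (T' : measurableType d') (R : realType).
Variables (B : probability T R) (A : probability T' R) (psi : T -> T').
Hypothesis BA : pushes B A psi.

Lemma pushes_intg f : measurable_fun setT f -> intg A f <-> intg B (f \o psi).
Proof.
move=> mf; apply: (pushes_integrable BA (F := EFin \o f)).
exact/measurable_EFinP.
Qed.

Lemma pushes_Ex f : measurable_fun setT f -> Ex A f = Ex B (f \o psi).
Proof.
move=> mf; rewrite /Ex /Rintegral (pushes_integral BA)//; exact/measurable_EFinP.
Qed.

Lemma pushes_sqi f : measurable_fun setT f -> sqi A f <-> sqi B (f \o psi).
Proof.
move=> mf; split=> -[_ h]; split => //.
- by apply: measurableT_comp => //; exact: BA.1.
- by have /pushes_intg[+ _] := measurable_funX 2 mf; exact.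
- by have /pushes_intg[_ +] := measurable_funX 2 mf; exact.
Qed.

End expectation_pushes.

Section expectation_prod.
Context d d' (T : measurableType d) (T' : measurableType d') (R : realType).
Variables (P : probability T R) (Q : probability T' R).

Lemma intg_prod f g : intg P f -> intg Q g -> intg (P \x Q)%E (fun w => f w.1 * g w.2).
Proof.
move=> hf hg; have mf := intg_meas hf; have mg := intg_meas hg.
apply/integrable12ltyP.
  apply/measurable_EFinP; apply: measurable_funM.
    exact: measurableT_comp mf measurable_fst.
  exact: measurableT_comp mg measurable_snd.
rewrite [X in (X < _)%E](_ : _ = (\int[P]_x (`|f x|%:E * \int[Q]_y (`|g y|%:E)))%E); last first.
  apply: eq_integral => x _; rewrite -ge0_integralZl//.
    by apply: eq_integral => y _; rewrite /= normrM.
  by apply/measurable_EFinP; exact: measurableT_comp mg.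
rewrite (ExE (intg_norm hg)).
under eq_integral do rewrite -EFinM mulrC.
by rewrite (ExE (intgZ _ (intg_norm hf))) ltry.
Qed.

Lemma Ex_prod f g : intg P f -> intg Q g ->
  Ex (P \x Q)%E (fun w => f w.1 * g w.2) = Ex P f * Ex Q g.
Proof.
move=> hf hg; rewrite /Ex {1}/Rintegral -integral12_prod_meas1; last exact: intg_prod.
rewrite -/(Ex Q g) mulrC -ExZ//; congr fine.
apply: eq_integral => x _; rewrite /fubini_F/=.
by rewrite (ExE (intgZ _ hg)) ExZ// mulrC.
Qed.

Lemma sqi_prod f g : sqi P f -> sqi Q g -> sqi (P \x Q)%E (fun w => f w.1 * g w.2).
Proof.
move=> hf hg; split.
  apply: measurable_funM.
    exact: measurableT_comp hf.1 measurable_fst.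
  exact: measurableT_comp hg.1 measurable_snd.
by apply: (eq_intg _ (intg_prod hf.2 hg.2)) => x; rewrite exprMn.
Qed.

(** The vanishing is asked only of integrable sections, because Fubini makes almost every section
    integrable but not all of them. *)
Lemma Ex_prod_eq0l (F : T * T' -> R) : intg (P \x Q)%E F ->
  (forall x, intg Q (fun y => F (x, y)) -> Ex Q (fun y => F (x, y)) = 0) ->
  Ex (P \x Q)%E F = 0.
Proof.
move=> iF h; rewrite /Ex /Rintegral -integral12_prod_meas1// (ae_eq_integral (cst 0%E))//.
- by rewrite integral_cst// mul0e.
- exact: measurable_fubini_F iF.
- have := ae_integrable1 iF; apply: filterS => x hx _ /=.
  by rewrite /fubini_F (ExE hx) h.
Qed.

Lemma Ex_prod_eq0r (F : T * T' -> R) : intg (P \x Q)%E F ->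
  (forall y, intg P (fun x => F (x, y)) -> Ex P (fun x => F (x, y)) = 0) ->
  Ex (P \x Q)%E F = 0.
Proof.
move=> iF h; rewrite /Ex /Rintegral -integral21_prod_meas1// (ae_eq_integral (cst 0%E))//.
- by rewrite integral_cst// mul0e.
- exact: measurable_fubini_G iF.
- have := ae_integrable2 iF; apply: filterS => x hx _ /=.
  by rewrite /fubini_G (ExE hx) h.
Qed.

End expectation_prod.

Section expectation_iid.
Context d (T : measurableType d) (R : realType) (P : probability T R).

Lemma iid_prod n (f : 'I_n -> T -> R) : (forall i, intg P (f i)) ->
  intg (iid n P) (fun w => \prod_i f i (tnth w i)) /\
  Ex (iid n P) (fun w => \prod_i f i (tnth w i)) = \prod_i Ex P (f i).
Proof.
elim: n f => [|n IH] f hf.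
  rewrite big_ord0; split.
    by apply: (eq_intg _ (intg_cst _ 1)) => w; rewrite big_ord0.
  by rewrite -[RHS](Ex_cst (iid 0 P)); apply: eq_Ex => w; rewrite big_ord0.
have [h1 h2] := IH (fun i => f (lift ord0 i)) (fun i => hf _).
have mF : measurable_fun setT (fun w : n.+1.-tuple T => \prod_i f i (tnth w i)).
  apply: measurable_prod => i _.
  exact: measurableT_comp (intg_meas (hf i)) (measurable_tnth i).
have E : (fun w : n.+1.-tuple T => \prod_i f i (tnth w i)) \o
    (fun tt : T * n.-tuple T => [tuple of tt.1 :: tt.2]) =1
    (fun w => f ord0 w.1 * \prod_i f (lift ord0 i) (tnth w.2 i)).
  move=> w /=; rewrite big_ord_recl tnth0; congr (_ * _).
  by apply: eq_bigr => i _; rewrite tnthS.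
split.
  apply/(pushes_intg (pushes_iid_cons P n) mF); apply: (eq_intg (fun w => esym (E w))).
  exact: (intg_prod (hf ord0) h1).
rewrite (pushes_Ex (pushes_iid_cons P n) mF) (eq_Ex _ E) (Ex_prod (hf ord0) h1) h2.
by rewrite big_ord_recl.
Qed.

(* Isolates sample i0: given all the others, its factor integrates to 0 against
   any function of its label. *)
Lemma iid_Ex_eq0 d' (Y : measurableType d') (y : T -> Y) n (h : 'I_n -> T -> R) (i0 : 'I_n) :
  (forall i, measurable_fun setT (h i)) -> measurable_fun setT y ->
  (forall phi : Y -> R, measurable_fun setT phi -> intg P (fun w => h i0 w * phi (y w)) ->
     Ex P (fun w => h i0 w * phi (y w)) = 0) ->
  forall c : n.-tuple Y -> R, measurable_fun setT c ->
  intg (iid n P) (fun w => c [tuple of map y w] * \prod_i h i (tnth w i)) ->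
  Ex (iid n P) (fun w => c [tuple of map y w] * \prod_i h i (tnth w i)) = 0.
Proof.
elim: n h i0 => [|n IH] h i0 mh my h0 c mc; first by case: i0 h0.
set F := (fun w => _).
have mF : measurable_fun setT F.
  apply: measurable_funM.
    exact: measurableT_comp mc (@measurable_map_tuple _ _ _ _ n.+1 _ my).
  by apply: measurable_prod => i _; exact: measurableT_comp (mh i) (measurable_tnth i).
move=> /(pushes_intg (pushes_iid_cons P n) mF) iF.
rewrite (pushes_Ex (pushes_iid_cons P n) mF).
have E (a : T) (w : n.-tuple T) : F [tuple of a :: w] = h ord0 a * (c [tuple of y a :: [tuple of map y w]] *
    \prod_i h (lift ord0 i) (tnth w i)).
  rewrite /F big_ord_recl tnth0 mulrCA; congr (_ * (_ * _)).
    by congr c; exact/val_inj.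
  by apply: eq_bigr => i _; rewrite tnthS.
have mc1 (ys : n.-tuple Y) : measurable_fun setT (fun b => c [tuple of b :: ys]).
  by apply: (measurableT_comp mc); apply: measurable_cons => //; exact: measurable_cst.
have mc2 (b : Y) : measurable_fun setT (fun ys : n.-tuple Y => c [tuple of b :: ys]).
  by apply: (measurableT_comp mc); apply: measurable_cons => //; exact: measurable_cst.
case: (unliftP ord0 i0) => [j|] i0E; last first.
  apply: (Ex_prod_eq0r iF) => w /= iw.
  pose k := \prod_i h (lift ord0 i) (tnth w i).
  have E' a : F [tuple of a :: w] = k * (h i0 a * c [tuple of y a :: [tuple of map y w]]).
    by rewrite E i0E /k; ring.
  (* Integrability of the remaining factor is recovered by dividing by the constant [k], hence the
     separate case. *)
  have [k0|k0] := eqVneq k 0.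
    by rewrite -[RHS](Ex_cst P); apply: eq_Ex => a; rewrite E' k0 mul0r.
  have iw' : intg P (fun a => h i0 a * c [tuple of y a :: [tuple of map y w]]).
    by apply: (eq_intg _ (intgZ k^-1 iw)) => a; rewrite E' mulKf.
  by rewrite (eq_Ex _ E') ExZ// (h0 (fun b => c [tuple of b :: [tuple of map y w]]))// mulr0.
apply: (Ex_prod_eq0l iF) => a /= ia.
have [k0|k0] := eqVneq (h ord0 a) 0.
  by rewrite -[RHS](Ex_cst (iid n P)); apply: eq_Ex => w; rewrite E k0 mul0r.
have ia' : intg (iid n P) (fun w => c [tuple of y a :: [tuple of map y w]] *
    \prod_i h (lift ord0 i) (tnth w i)).
  by apply: (eq_intg _ (intgZ (h ord0 a)^-1 ia)) => w; rewrite E mulKf.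
rewrite (eq_Ex _ (E a)) ExZ//.
rewrite (IH (fun i => h (lift ord0 i)) j _ my _ (fun ys => c [tuple of y a :: ys]))//.
  by rewrite mulr0.
by rewrite -i0E.
Qed.

End expectation_iid.

(** * Conditional expectation and square integrability *)

Section cond_exp_square.
Context d d' (T : measurableType d) (T' : measurableType d') (R : realType).
Variables (P : probability T R) (V : T -> T').
Hypothesis mV : measurable_fun setT V.
Import HBNNSimple.

Let measurable_preV (B : set T') : measurable B -> measurable (V @^-1` B).
Proof. by move=> mB; rewrite -[X in measurable X]setTI; exact: mV. Qed.

Section orthogonal.
Variable X : T -> R.
Hypothesis iX : intg P X.
Hypothesis X0 : forall B, measurable B -> (\int[P]_(w in V @^-1` B) (X w)%:E = 0)%E.

Let Ex_indic (B : set T') : measurable B ->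
  intg P (fun w => \1_B (V w) * X w) /\ Ex P (fun w => \1_B (V w) * X w) = 0.
Proof.
move=> mB; have mX := intg_meas iX.
have mI : measurable_fun setT (fun w => \1_B (V w) : R).
  by apply: measurableT_comp mV; exact: measurable_indic.
split.
  apply: (intg_le _ (intg_norm iX)); first exact: measurable_funM.
  by move=> w; rewrite normrM indicE; case: (_ \in _); rewrite ?normr1 ?mul1r// normr0 mul0r.
have := X0 mB; rewrite integral_mkcond /Ex /Rintegral => h; rewrite -[RHS]/(fine 0%E) -h.
congr fine; apply: eq_integral => w _; rewrite /patch indicE.
have -> : (w \in V @^-1` B) = (V w \in B) by apply/idP/idP; rewrite !inE.
by case: (_ \in _); rewrite ?mul1r// mul0r.
Qed.

Let Ex_nnsfun (g : {nnsfun T' >-> R}) : Ex P (fun w => X w * g (V w)) = 0.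
Proof.
pose s : seq R := finmap.enum_fset (fset_set (g @` setT)).
have E w : X w * g (V w) = \sum_(i < size s) s`_i * (\1_(g @^-1` [set s`_i]) (V w) * X w).
  rewrite [g (V w)](fimfunEord g) -/s mulrC mulr_suml.
  by apply: eq_bigr => i _; rewrite mulrA.
rewrite (eq_Ex _ E) Ex_sum => [|i _].
  by rewrite big1// => i _; rewrite ExZ ?(Ex_indic _).2 ?mulr0//; exact: (Ex_indic _).1.
by apply: intgZ; exact: (Ex_indic _).1.
Qed.

Let Ex_ge0_fun (phi : T' -> R) : measurable_fun setT phi -> (forall y, 0 <= phi y) ->
  intg P (fun w => X w * phi (V w)) -> Ex P (fun w => X w * phi (V w)) = 0.
Proof.
move=> mphi phi0 iXphi.
have mphiE : measurable_fun setT (EFin \o phi) by exact/measurable_EFinP.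
pose g := nnsfun_approx measurableT mphiE.
have gphi y : (fun n => g n y) @ \oo --> phi y.
  have h := @cvg_nnsfun_approx _ _ _ _ measurableT _ mphiE (fun x _ => phi0 x) y I.
  by move/fine_cvg : h.
have gle n y : g n y <= phi y.
  rewrite -(cvg_lim _ (gphi y))//; apply: nondecreasing_cvgn_le.
    by move=> a b ab; exact/lefP/nd_nnsfun_approx.
  by apply/cvg_ex; exists (phi y); exact: gphi.
have mX := intg_meas iX.
have mXg n : measurable_fun setT (fun w => X w * g n (V w)).
  by apply: measurable_funM => //; apply: measurableT_comp mV.
have [] := @dominated_convergence _ _ _ P setT measurableT
  (fun n w => (X w * g n (V w))%:E) (fun w => (X w * phi (V w))%:E)
  (fun w => `|(X w * phi (V w))%:E|%E).
- by move=> n; exact/measurable_EFinP.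
- exact: measurable_int iXphi.
- apply: aeW => w _; apply: cvg_EFin.
    by near=> n.
  by apply: cvgM; [exact: cvg_cst|exact: gphi].
- exact: (integrable_abse iXphi).
- apply: aeW => w n _; rewrite lee_fin !normrM ler_wpM2l//.
  by rewrite !ger0_norm.
move=> _ _ h; rewrite /Ex /Rintegral -(cvg_lim _ h)//.
rewrite (_ : (fun n => _) = cst 0%E) ?lim_cst//.
apply/funext => n.
rewrite (ExE (f := fun w => X w * g n (V w))) ?Ex_nnsfun//.
apply: (intg_le (mXg n) (intg_norm iXphi)) => w.
by rewrite !normrM ler_wpM2l// !ger0_norm.
Unshelve. all: by end_near. Qed.

(** From indicators to simple functions, to nonnegative functions, then by positive and negative
    parts. The limit is dominated by the product [X phi] itself, so [phi] may be unbounded as long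
    as that product is integrable. *)
Lemma Ex_orthogonal (phi : T' -> R) : measurable_fun setT phi ->
  intg P (fun w => X w * phi (V w)) -> Ex P (fun w => X w * phi (V w)) = 0.
Proof.
move=> mphi iXphi; have mX := intg_meas iX.
have mp : measurable_fun setT (fun y => Num.max (phi y) 0) by exact: measurable_maxr.
have mn : measurable_fun setT (fun y => Num.max (- phi y) 0).
  by apply: measurable_maxr => //; exact: measurableT_comp.
have h (psi : T' -> R) : measurable_fun setT psi -> (forall y, 0 <= psi y <= `|phi y|) ->
    intg P (fun w => X w * psi (V w)) /\ Ex P (fun w => X w * psi (V w)) = 0.
  move=> mpsi hpsi.
  have i : intg P (fun w => X w * psi (V w)).
    apply: (intg_le _ (intg_norm iXphi)).
      by apply: measurable_funM => //; exact: measurableT_comp mV.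
    by move=> w; have /andP[p0 p1] := hpsi (V w); rewrite !normrM ler_wpM2l// ger0_norm.
  by split => //; apply: Ex_ge0_fun => // y; have /andP[] := hpsi y.
have [ip Ep] := h _ mp (fun y => ltac:(by rewrite le_max lexx orbT/= ge_max ler_norm normr_ge0)).
have [in' En] := h _ mn (fun y => ltac:(by rewrite le_max lexx orbT/= ge_max normr_ge0 andbT -normrN ler_norm)).
transitivity (Ex P (fun w => X w * Num.max (phi (V w)) 0 - X w * Num.max (- phi (V w)) 0)).
  apply: eq_Ex => w; rewrite -mulrBr; congr (_ * _).
  have [p0|p0] := leP 0 (phi (V w)).
    by rewrite max_r ?subr0// oppr_le0.
  by rewrite max_l ?oppr_ge0 ?ltW// sub0r opprK.
by rewrite ExB// Ep En subr0.
Qed.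

End orthogonal.

(** The form in which the vanishing of [lambda2] is exploited: the conditional expectation is 0
    almost surely, so [X] is orthogonal to every function of [V]. *)
Lemma cond_exp_sqr0 (X : T -> R) : intg P X ->
  (\int[P]_w (cond_exp P X V (V w) ^+ 2)%:E = 0)%E ->
  forall phi : T' -> R, measurable_fun setT phi ->
  intg P (fun w => X w * phi (V w)) -> Ex P (fun w => X w * phi (V w)) = 0.
Proof.
move=> iX z0; have [mz iz hz] := cond_expP iX mV.
have mzV : measurable_fun setT (fun w => cond_exp P X V (V w)) by exact: measurableT_comp mz mV.
apply: Ex_orthogonal => // B mB; rewrite -hz//.
have : ae_eq P setT (fun w => (cond_exp P X V (V w) ^+ 2)%:E) (cst 0%E).
  apply/ae_eq_integral_abs => //; first by apply/measurable_EFinP; exact: measurable_funX.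
  by under eq_integral do rewrite /= ger0_norm ?sqr_ge0//.
move=> ae0; rewrite (ae_eq_integral (cst 0%E)).
- by rewrite integral_cst ?mul0e//; exact: measurable_preV.
- exact: measurable_preV.
- by apply: measurable_funTS; exact/measurable_EFinP.
- exact: measurable_cst.
- apply: filterS ae0 => w h _; have := h Logic.I => /= -[] /eqP.
  by rewrite sqrf_eq0 => /eqP ->.
Qed.

Lemma sqi_cond_exp (X : T -> R) : sqi P X -> exists z : T' -> R,
  [/\ measurable_fun setT z, sqi P (z \o V),
      Ex P (fun w => z (V w) ^+ 2) <= Ex P (fun w => X w ^+ 2) &
      forall c : T' -> R, measurable_fun setT c -> sqi P (c \o V) ->
        Ex P (fun w => X w * c (V w)) = Ex P (fun w => z (V w) * c (V w))].
Proof.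
move=> sX; have iX := sqi_intg sX; have [mz iz hz] := cond_expP iX mV.
set z := cond_exp P X V in mz iz hz; exists z.
have mzV : measurable_fun setT (fun w => z (V w)) by exact: measurableT_comp mz mV.
have iXz : intg P (fun w => X w - z (V w)) by exact: intgB.
have Xz0 B : measurable B -> (\int[P]_(w in V @^-1` B) (X w - z (V w))%:E = 0)%E.
  move=> mB; have mVB := measurable_preV mB.
  rewrite (_ : (\int[P]_(w in _) _ = \int[P]_(w in V @^-1` B) ((X w)%:E - (z (V w))%:E))%E)//.
  rewrite integralB//; [|exact: (integrableS measurableT mVB _ iX)|exact: (integrableS measurableT mVB _ iz)].
  rewrite hz// subee//; apply: integrable_fin_num => //.
  exact: (integrableS measurableT mVB _ iX).
have orth := Ex_orthogonal iXz Xz0.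
(* Square integrability of [z] is what has to be shown, so [X] is tested against truncations:
   [E[zN^2] = E[X zN]] is at most half of [E[X^2] + E[zN^2]], hence [E[zN^2] <= E[X^2]], and [N]
   tends to infinity by monotone convergence. *)
pose zN (N : nat) y := if `|z y| <= N%:R then z y else 0.
have mzN N : measurable_fun setT (zN N).
  apply: measurable_fun_ifT => //; apply: measurable_fun_ler => //.
  exact: measurableT_comp.
have mzNV N : measurable_fun setT (fun w => zN N (V w)) by exact: measurableT_comp (mzN N) mV.
have zNle N y : `|zN N y| <= N%:R.
  by rewrite /zN; case: ifP => //; rewrite normr0.
have szN N : sqi P (fun w => zN N (V w)).
  apply: (sqi_le _ (sqi_cst P N%:R)) => // w.
  by rewrite /= (le_trans (zNle N _))// ger0_norm.
have zzN N y : z y * zN N y = zN N y ^+ 2 by rewrite /zN; case: ifP; rewrite ?expr0n ?mulr0.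
have EzN N : Ex P (fun w => zN N (V w) ^+ 2) <= Ex P (fun w => X w ^+ 2).
  have i1 := intgM sX (szN N).
  have i2 : intg P (fun w => z (V w) * zN N (V w)).
    by apply: (eq_intg _ (szN N).2) => w; rewrite zzN.
  have E : Ex P (fun w => X w * zN N (V w)) = Ex P (fun w => zN N (V w) ^+ 2).
    rewrite -(eq_Ex _ (fun w => zzN N (V w))); apply/eqP; rewrite -subr_eq0 -ExB//; apply/eqP.
    rewrite -[RHS](orth (zN N))//; first by apply: eq_Ex => w; rewrite mulrBl.
    by apply: (eq_intg _ (intgB i1 i2)) => w; rewrite mulrBl.
  have := ExM_le sX (szN N); rewrite E => /(le_trans (ler_norm _)); lra.
have iE2 : (\int[P]_w (z (V w) ^+ 2)%:E <= (Ex P (fun w => X w ^+ 2))%:E)%E.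
  have := @cvg_monotone_convergence _ _ _ P setT measurableT
    (fun N w => (zN N (V w) ^+ 2)%:E).
  move=> /(_ (fun N => ltac:(by apply/measurable_EFinP; exact: measurable_funX))).
  move=> /(_ (fun N w _ => ltac:(by rewrite lee_fin sqr_ge0))).
  have nd w : setT w -> {homo (fun N => (zN N (V w) ^+ 2)%:E) : n m / (n <= m)%N >-> (n <= m)%E}.
    move=> _ n m nm; rewrite lee_fin /zN; case: ifPn => h1.
      by rewrite (le_trans h1) ?ler_nat.
    by rewrite expr0n/= sqr_ge0.
  move=> /(_ nd) h.
  rewrite (_ : (\int[P]_w _)%E = (\int[P]_w limn (fun N => (zN N (V w) ^+ 2)%:E))%E); last first.
    apply: eq_integral => w _; apply/esym/cvg_lim => //.
    apply: cvg_near_cst; near=> N; rewrite /zN ifT//.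
    near: N; exact: nbhs_infty_ger.
  rewrite -(cvg_lim _ h)//; apply: lime_le.
    by apply/cvg_ex; eexists; exact: h.
  by apply: nearW => N; rewrite (ExE (szN N).2) lee_fin.
have i2 : intg P (fun w => z (V w) ^+ 2).
  apply: intg_ge0P => //; first exact: measurable_funX.
    by move=> w; rewrite sqr_ge0.
  by rewrite (le_lt_trans iE2)// ltry.
have sz : sqi P (z \o V) by [].
split => //; first by rewrite -lee_fin -(ExE i2).
move=> c mc sc; apply/eqP; rewrite -subr_eq0 -ExB; [|exact: intgM|exact: intgM].
apply/eqP; rewrite -[RHS](orth c)//; first by apply: eq_Ex => w; rewrite mulrBl.
apply: (eq_intg _ (intgB (intgM sX sc) (intgM sz sc))) => w.
by rewrite mulrBl.
Unshelve. all: by end_near. Qed.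

End cond_exp_square.

(** * Integration against a mixture *)

Section mixture_integral.
Context d d' (X : measurableType d) (Y : measurableType d') (R : realType).
Variables (mu : probability X R) (k : R.-pker X ~> Y).

Lemma ge0_integral_mixture (F : Y -> \bar R) : measurable_fun setT F ->
  (forall y, (0 <= F y)%E) ->
  (\int[mixture mu k]_y F y = \int[mu]_x \int[k x]_y F y)%E.
Proof.
move=> mF F0.
(* A mixture is a composition of kernels that starts from the one-point space. *)
pose l := kprobability (measurable_cst (mu : pprobability _ R) : measurable_fun [set: unit] _).
pose k' := kcomap k (measurable_snd : measurable_fun [set: unit * X] _).
have := @integral_kcomp _ _ _ _ _ _ R l k' tt F F0 mF.
by move=> <-; apply: eq_measure_integral.
Qed.

Let measurable_integral (g : Y -> \bar R) : measurable_fun setT g ->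
  (forall y, 0 <= g y)%E -> measurable_fun setT (fun x => \int[k x]_y g y)%E.
Proof.
move=> mg g0.
exact: (@measurable_fun_integral_kernel _ _ _ _ _ k (measurable_kernel k) g g0 mg).
Qed.

Variable M : R.
Hypothesis M0 : 0 <= M.

Let mixture_ge0_Ex (g : Y -> R) : measurable_fun setT g -> (forall y, 0 <= g y) ->
  {ae mu, forall x, intg (kfiber k x) g /\ Ex (kfiber k x) g <= M} ->
  [/\ intg (mixture mu k) g, intg mu (fun x => Ex (kfiber k x) g) &
      Ex (mixture mu k) g = Ex mu (fun x => Ex (kfiber k x) g)].
Proof.
move=> mg g0 hM; have mgE : measurable_fun setT (EFin \o g) by exact/measurable_EFinP.
have mI := measurable_integral mgE (fun y => g0 y : (0 <= (g y)%:E)%E).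
have Ip x : (0 <= \int[k x]_y (g y)%:E)%E by apply: integral_ge0 => y _; rewrite lee_fin.
have aeE : {ae mu, forall x, setT x -> (\int[k x]_y (g y)%:E)%E = (Ex (kfiber k x) g)%:E}.
  by apply: filterS hM => x [ix _] _; rewrite -(ExE ix).
have mE : measurable_fun setT (fun x => Ex (kfiber k x) g).
  by apply: measurableT_comp mI.
have IE : (\int[mixture mu k]_y (g y)%:E = \int[mu]_x (Ex (kfiber k x) g)%:E)%E.
  rewrite ge0_integral_mixture//; apply: ae_eq_integral => //.
  exact/measurable_EFinP.
have iE : intg mu (fun x => Ex (kfiber k x) g).
  apply: intg_ge0P => //; first by move=> x; exact: Ex_ge0.
  apply: (@le_lt_trans _ _ (\int[mu]_x M%:E)%E); last first.
    by rewrite integral_cst// [X in (_ * X)%E]probability_setT mule1 ltry.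
  apply: ae_ge0_le_integral => //.
  - by move=> x _; rewrite lee_fin; exact: Ex_ge0.
  - exact/measurable_EFinP.
  - by apply: filterS hM => x [_ xM] _; rewrite lee_fin.
have im : intg (mixture mu k) g.
  by apply: intg_ge0P => //; rewrite IE (ExE iE) ltry.
by split=> //; rewrite /Ex /Rintegral IE.
Qed.

(** Integrability under the mixture needs a bound on [E|f|] uniform in the fibre. Everything is
    asked for almost every [x], since Haar matrices are orthonormal only almost surely. *)
Lemma mixture_Ex (f : Y -> R) (F : X -> R) : measurable_fun setT f -> measurable_fun setT F ->
  {ae mu, forall x, [/\ intg (kfiber k x) f, Ex (kfiber k x) (fun y => `|f y|) <= M &
    Ex (kfiber k x) f = F x]} ->
  intg (mixture mu k) f /\ Ex (mixture mu k) f = Ex mu F.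
Proof.
move=> mf mF hM.
pose fp y := Num.max (f y) 0; pose fn y := Num.max (- f y) 0.
have mp : measurable_fun setT fp by exact: measurable_maxr.
have mn : measurable_fun setT fn by apply: measurable_maxr => //; exact: measurableT_comp.
have h (g : Y -> R) : measurable_fun setT g -> (forall y, 0 <= g y <= `|f y|) ->
    {ae mu, forall x, intg (kfiber k x) g /\ Ex (kfiber k x) g <= M}.
  move=> mg gf; apply: filterS hM => x [ix ixM _].
  have ig : intg (kfiber k x) g.
    apply: (intg_le mg (intg_norm ix)) => y; have /andP[g0 g1] := gf y.
    by rewrite ger0_norm.
  split => //; apply: le_trans ixM; apply: Ex_le => //; first exact: intg_norm.
  by move=> y; have /andP[] := gf y.
have hp := h _ mp (fun y => ltac:(by rewrite /fp le_max lexx orbT/= ge_max ler_norm normr_ge0)).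
have hn := h _ mn (fun y => ltac:(by rewrite /fn le_max lexx orbT/= ge_max normr_ge0 andbT -normrN ler_norm)).
have [ip jp Ep] := mixture_ge0_Ex mp (fun y => ltac:(by rewrite /fp le_max lexx orbT)) hp.
have [iN jN EN] := mixture_ge0_Ex mn (fun y => ltac:(by rewrite /fn le_max lexx orbT)) hn.
have fE y : fp y - fn y = f y.
  rewrite /fp /fn; have [p0|p0] := leP 0 (f y).
    by rewrite max_r ?subr0// oppr_le0.
  by rewrite max_l ?oppr_ge0 ?ltW// sub0r opprK.
split; first exact: (eq_intg fE (intgB ip iN)).
rewrite -(eq_Ex _ fE) ExB// Ep EN -ExB// /Ex /Rintegral; congr fine.
have mpn : measurable_fun setT (fun x => (Ex (kfiber k x) fp - Ex (kfiber k x) fn)%:E).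
  exact: measurable_int (intgB jp jN).
apply: ae_eq_integral => //; first exact/measurable_EFinP.
apply: filterS3 hM hp hn => x [_ _ <-] [ixp _] [ixn _] _.
by rewrite -ExB//; congr EFin; exact: eq_Ex.
Qed.

End mixture_integral.

(** * Gaussian laws *)

Section density.
Context d (T : measurableType d) (R : realType).
Variables (mu nu : {measure set T -> \bar R}) (g : T -> R).
Hypotheses (mg : measurable_fun setT g) (g0 : forall x, 0 <= g x).
Hypothesis nuE : forall A, measurable A -> nu A = (\int[mu]_(x in A) (g x)%:E)%E.
Import HBNNSimple.
Local Open Scope ereal_scope.

Let integral_density_nnsfun (h : {nnsfun T >-> R}) :
  \int[nu]_x (h x)%:E = \int[mu]_x (h x * g x)%:E.
Proof.
pose s : seq R := finmap.enum_fset (fset_set (h @` setT)).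
have s0 i : (i < size s)%N -> (0 <= s`_i)%R.
  move=> si; have : s`_i \in fset_set (h @` setT) by exact: mem_nth.
  by rewrite in_fset_set// inE => -[x _ <-].
have hE x : h x = (\sum_(i < size s) s`_i * \1_(h @^-1` [set s`_i]) x)%R := fimfunEord h x.
transitivity (\sum_(i < size s) \int[nu]_x (s`_i * \1_(h @^-1` [set s`_i]) x)%:E).
  rewrite -ge0_integral_sum//.
  - by apply: eq_integral => x _; rewrite hE -sumEFin.
  - by move=> i; apply/measurable_EFinP; apply: measurable_funM => //; exact: measurable_indic.
  - by move=> i x _; rewrite lee_fin mulr_ge0// s0.
transitivity (\sum_(i < size s) \int[mu]_x (s`_i * (\1_(h @^-1` [set s`_i]) x * g x))%:E); last first.
  rewrite -ge0_integral_sum//.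
  - by apply: eq_integral => x _; rewrite hE mulr_suml -sumEFin; apply: eq_bigr => i _; rewrite mulrA.
  - move=> i; apply/measurable_EFinP; apply: measurable_funM => //.
    by apply: measurable_funM => //; exact: measurable_indic.
  - by move=> i x _; rewrite lee_fin !mulr_ge0// s0.
apply: eq_bigr => i _.
have mh : measurable (h @^-1` [set s`_i]) by [].
under eq_integral do rewrite EFinM.
under [RHS]eq_integral do rewrite EFinM.
have mI : measurable_fun setT (fun x => (\1_(h @^-1` [set s`_i]) x)%:E : \bar R).
  by apply/measurable_EFinP; exact: measurable_indic.
have mIg : measurable_fun setT (fun x => (\1_(h @^-1` [set s`_i]) x * g x)%:E : \bar R).
  by apply/measurable_EFinP; apply: measurable_funM => //; exact: measurable_indic.
have si : 0 <= (s`_i)%:E by rewrite lee_fin s0.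
have I0 x : 0 <= (\1_(h @^-1` [set s`_i]) x * g x)%:E by rewrite lee_fin mulr_ge0.
have I1 x : 0 <= (\1_(h @^-1` [set s`_i]) x)%:E :> \bar R by rewrite lee_fin.
rewrite ge0_integralZl// ge0_integralZl//.
rewrite integral_indic// setIT nuE//; congr (_ * _); rewrite integral_mkcond.
apply: eq_integral => x _; rewrite /patch indicE; case: ifP => _; first by rewrite mul1r.
by rewrite mul0r.
Qed.

Lemma ge0_integral_density (F : T -> \bar R) : measurable_fun setT F ->
  (forall x, 0 <= F x) -> \int[nu]_x F x = \int[mu]_x (F x * (g x)%:E).
Proof.
move=> mF F0; pose h := nnsfun_approx measurableT mF.
have hF x : EFin \o h ^~ x @ \oo --> F x.
  by apply: (@cvg_nnsfun_approx _ _ _ _ measurableT _ mF).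
have nd x : {homo (fun n => (h n x)%:E) : n m / (n <= m)%N >-> n <= m}.
  by move=> a b ab; rewrite lee_fin; exact/lefP/nd_nnsfun_approx.
rewrite [LHS](_ : _ = \int[nu]_x limn (fun n => (h n x)%:E)); last first.
  by apply: eq_integral => x _; apply/esym/cvg_lim => //; exact: hF.
rewrite monotone_convergence//; last 2 first.
- by move=> n; exact/measurable_EFinP.
- by move=> n x _; rewrite lee_fin.
rewrite [RHS](_ : _ = \int[mu]_x limn (fun n => (h n x * g x)%:E)); last first.
  apply: eq_integral => x _; apply/esym/cvg_lim => //.
  by under eq_fun do rewrite EFinM; apply: cvgeZr => //; exact: hF.
rewrite monotone_convergence//; last 3 first.
- by move=> n; apply/measurable_EFinP; exact: measurable_funM.
- by move=> n x _; rewrite lee_fin mulr_ge0.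
- by move=> x _ a b ab; rewrite lee_fin ler_wpM2r// -lee_fin nd.
by congr (limn _); apply/funext => n; exact: integral_density_nnsfun.
Qed.

End density.

Section normal_line.
Variable R : realType.
Local Notation lam := (@lebesgue_measure R).
Local Notation phi := (normal_pdf (0 : R) 1).
Local Notation N01 := (normal_prob (0 : R) 1).

Lemma normal_pdf01E x : phi x = normal_peak 1 * expR (- (x ^+ 2 / 2)).
Proof.
rewrite normal_pdfE ?oner_eq0// /normal_fun; congr (_ * expR _).
by rewrite subr0 expr1n mulNr.
Qed.

Lemma ge0_integral_normal (F : R -> \bar R) : measurable_fun setT F ->
  (forall x, (0 <= F x)%E) -> (\int[N01]_x F x = \int[lam]_x (F x * (phi x)%:E))%E.
Proof.
move=> mF F0; apply: (ge0_integral_density (mu := lam) (nu := N01)) => //.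
- exact: measurable_normal_pdf.
- by move=> x; exact: normal_pdf_ge0.
Qed.

(** Rodrigues' formula: it supplies an antiderivative of [He (n+1)] times the Gaussian density,
    leaving only boundary terms in its integral. *)
Lemma is_derive_He_phi n (x : R) :
  is_derive x (1 : R) (fun t => (He R n).[t] * phi t) (- ((He R n.+1).[x] * phi x)).
Proof.
have hphi : is_derive x (1 : R) phi (- x * phi x).
  have -> : phi = (fun t => normal_peak 1 * expR (- (t ^+ 2 / 2))).
    by apply/funext => t; exact: normal_pdf01E.
  apply: is_derive_eq.
  rewrite /GRing.scale/= !mulr0 add0r !mulr1; by field.
have h := is_deriveM (is_derive_poly (He R n) x) hphi.
apply: (is_derive_eq h).
rewrite [He R n.+1]/= hornerD hornerN hornerM hornerX /GRing.scale/=; ring.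
Qed.

(** With [u = a x^2], the exponential dominates [u^n/n!], which controls [x^(2n)]; and [|x|^n] is at
    most [1 + x^(2n)]. *)
Lemma poly_expR_bound (p : {poly R}) (a : R) : 0 < a ->
  exists C, forall x, `|p.[x] * expR (- (a * x ^+ 2))| <= C.
Proof.
move=> a0; have ax x : 0 <= a * x ^+ 2 by rewrite mulr_ge0 ?sqr_ge0// ltW.
have hm n : exists C, forall x : R, `|x ^+ n * expR (- (a * x ^+ 2))| <= C.
  exists (1 + n`!%:R / a ^+ n) => x.
  have e0 := expR_gt0 (a * x ^+ 2).
  have e1 : 1 <= expR (a * x ^+ 2) by rewrite -[leLHS]expR0 ler_expR.
  rewrite expRN normrM normfV (@ger0_norm _ (expR _)) ?expR_ge0//.
  rewrite ler_pdivrMr// normrX.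
  have h1 : `|x| ^+ n <= 1 + `|x| ^+ n ^+ 2.
    by have := sqr_ge0 (`|x| ^+ n - 2^-1); rewrite sqrrB; lra.
  apply: le_trans h1 _; rewrite mulrDl mul1r lerD//.
  have := @expR_ge1Dxn R (a * x ^+ 2) n.-1 (ax x).
  case: n => [|n] h; first by rewrite !expr0 expr1n divr1 fact0 mul1r.
  rewrite -exprM mulnC exprM real_normK ?num_real//.
  have {}h : (a * x ^+ 2) ^+ n.+1 / n.+1`!%:R <= expR (a * x ^+ 2).
    by apply: le_trans h; rewrite lerDr.
  move: h; rewrite ler_pdivrMr ?ltr0n ?fact_gt0// exprMn => h.
  by rewrite mulrAC ler_pdivlMr ?exprn_gt0// mulrC (le_trans h)// mulrC.
have hs (I : Type) (r : seq I) (F : I -> R -> R) : (forall i, exists C, forall x, `|F i x| <= C) ->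
    exists C, forall x, `|\sum_(i <- r) F i x| <= C.
  move=> hF; elim: r => [|i r [C hC]].
    by exists 0 => x; rewrite big_nil normr0.
  have [C' hC'] := hF i; exists (C' + C) => x; rewrite big_cons.
  by rewrite (le_trans (ler_normD _ _))// lerD.
have hF (i : 'I_(size p)) : exists C, forall x, `|p`_i * (x ^+ i * expR (- (a * x ^+ 2)))| <= C.
  by have [C hC] := hm i; exists (`|p`_i| * C) => x; rewrite normrM ler_wpM2l.
have [C hC] := hs _ (index_enum 'I_(size p)) _ hF.
exists C => x; apply: le_trans (hC x); rewrite horner_coef mulr_suml.
by under eq_bigr do rewrite -mulrA.
Qed.

Lemma lebesgue_shift_integral (F : R -> \bar R) (t : R) : measurable_fun setT F ->
  (forall x, (0 <= F x)%E) -> (\int[lam]_x F (x + t)%R = \int[lam]_x F x)%E.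
Proof.
move=> mF F0.
have mt : measurable_fun setT ((fun x => x + t) : measurableTypeR R -> measurableTypeR R).
  exact: measurable_funD.
rewrite -(@ge0_integral_pushforward _ _ _ _ _ _ mt lam setT F)//.
apply: eq_measure_integral => A mA _; apply/esym.
apply: (@lebesgue_measure_unique R
  (measure_function_pushforward__canonical__measure_function_Measure lam mt)) => // X [[a b] _ <-].
have E : (fun x : R => x + t) @^-1` [set` `]a, b]] = [set` `]a - t, b - t]].
  by apply/seteqP; split => x /=; rewrite !in_itv/= ltrBlDr lerBrDr.
rewrite [RHS](_ : _ = lam [set` `]a - t, b - t]]); last by rewrite -E.
rewrite !lebesgue_measure_itv/= !lte_fin ltrD2r; case: ifP => // _.
by rewrite -!EFinD; congr EFin; ring.
Qed.

Lemma lebesgue_opp_integral (F : R -> \bar R) : measurable_fun setT F ->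
  (forall x, (0 <= F x)%E) -> (\int[lam]_x F (- x)%R = \int[lam]_x F x)%E.
Proof.
move=> mF F0.
have mt : measurable_fun setT ((fun x => - x) : measurableTypeR R -> measurableTypeR R).
  exact: measurableT_comp.
rewrite -(@ge0_integral_pushforward _ _ _ _ _ _ mt lam setT F)//.
apply: eq_measure_integral => A mA _; apply/esym.
apply: (@lebesgue_measure_unique R
  (measure_function_pushforward__canonical__measure_function_Measure lam mt)) => // X [[a b] _ <-].
have E : (fun x : R => - x) @^-1` [set` `]a, b]] = [set` `[- b, - a[].
  by apply/seteqP; split => x /=; rewrite !in_itv/= lerNl ltrNr andbC.
rewrite [RHS](_ : _ = lam [set` `[- b, - a[]); last by rewrite -E.
rewrite !lebesgue_measure_itv/= !lte_fin ltrN2; case: ifP => // _.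
by rewrite -!EFinD; congr EFin; ring.
Qed.

Lemma normal_poly_intg (p : {poly R}) : intg N01 (fun x => p.[x]).
Proof.
have mp : measurable_fun setT (fun x : R => p.[x]) by exact: measurable_poly.
apply/integrableP; split; first exact/measurable_EFinP.
rewrite ge0_integral_normal//; last by apply/measurable_EFinP; exact: measurableT_comp.
have a0 : 0 < 4^-1 :> R by rewrite invr_gt0.
have [C hC] := poly_expR_bound p a0.
have C0 : 0 <= C by apply: le_trans (hC 0).
(* The factor [exp(-x^2/2)] is split into two copies of [exp(-x^2/4)]: one bounds the polynomial,
   the other is up to a constant the integrable normal density of variance 2. *)
pose s2 : R := Num.sqrt 2.
have s20 : s2 != 0 by rewrite gt_eqF// sqrtr_gt0.
have phi2 x : normal_pdf 0 s2 x = normal_peak s2 * expR (- (4^-1 * x ^+ 2)).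
  rewrite normal_pdfE// /normal_fun subr0 /s2 sqr_sqrtr// mulNr; congr (_ * expR (- _)).
  by field.
have k20 := normal_peak_gt0 s20.
pose K : R := normal_peak 1 * C / normal_peak s2.
have : (\int[lam]_x (K * normal_pdf 0 s2 x)%:E < +oo)%E.
  under eq_integral do rewrite EFinM.
  rewrite integralZl//; last exact: integrable_normal_pdf.
  by rewrite integral_normal_pdf mule1 ltry.
apply: le_lt_trans; apply: ge0_le_integral => //.
- by move=> x _; rewrite mule_ge0// lee_fin normal_pdf_ge0.
- apply: emeasurable_funM; last by apply/measurable_EFinP; exact: measurable_normal_pdf.
  by apply/measurable_EFinP; exact: measurableT_comp.
- by apply/measurable_EFinP; apply: measurable_funM => //; exact: measurable_normal_pdf.
- move=> x _; rewrite /= -EFinM lee_fin phi2 normal_pdf01E /K.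
  have -> : normal_peak 1 * C / normal_peak s2 * (normal_peak s2 * expR (- (4^-1 * x ^+ 2))) =
     normal_peak 1 * (C * expR (- (4^-1 * x ^+ 2))) by field; exact: lt0r_neq0.
  rewrite mulrCA ler_wpM2l ?normal_peak_ge0//.
  have -> : - (x ^+ 2 / 2) = - (4^-1 * x ^+ 2) + - (4^-1 * x ^+ 2) by field.
  rewrite expRD mulrA ler_wpM2r ?expR_ge0//.
  by apply: le_trans (hC x); rewrite normrM (@ger0_norm _ (expR _)) ?expR_ge0.
Qed.

Lemma He_phi_integral k n : (\int[lam]_(x in [set` `[(- k%:R)%R, k%:R]]) ((He R n.+1).[x] * phi x)%:E =
  (- ((He R n).[k%:R] * phi k%:R - (He R n).[- k%:R] * phi (- k%:R)))%:E)%E.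
Proof.
have [->|k0] := eqVneq k 0%N.
  by rewrite oppr0 set_itv1 subrr oppr0 integral_set1.
have kk : - k%:R < k%:R :> R by rewrite (lt_trans (_ : _ < 0))// ?oppr_lt0 ltr0n lt0n.
pose F x := - ((He R n).[x] * phi x).
have dF x : is_derive x (1 : R) F ((He R n.+1).[x] * phi x).
  by have := is_deriveN (is_derive_He_phi n x); rewrite opprK.
have cF x : {for x, continuous F}.
  by apply: differentiable_continuous; apply/derivable1_diffP; exact: ex_derive.
rewrite (continuous_FTC2 (F := F))//.
- by rewrite -EFinB /F opprK opprB addrC.
- apply: continuous_subspaceT => x; apply: cvgM.
    exact: (@continuous_horner R (He R n.+1)).
  by apply: continuous_normal_pdf; rewrite oner_eq0.
- split.
  + by move=> x _; exact: ex_derive.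
  + by apply: cvg_at_right_filter; exact: cF.
  + by apply: cvg_at_left_filter; exact: cF.
- by move=> x _; rewrite derive1E derive_val.
Qed.

Lemma intg_normal (f : R -> R) : intg N01 f ->
  lam.-integrable setT (fun x => (f x * phi x)%:E) /\
  (\int[N01]_x (f x)%:E = \int[lam]_x (f x * phi x)%:E)%E.
Proof.
move=> fi; have mf := intg_meas fi; have mphi := measurable_normal_pdf (0 : R) 1.
have h (g : R -> R) : measurable_fun setT g -> (forall x, 0 <= g x <= `|f x|) ->
   [/\ intg N01 g, lam.-integrable setT (fun x => (g x * phi x)%:E) &
     (\int[N01]_x (g x)%:E = \int[lam]_x (g x * phi x)%:E)%E].
  move=> mg gf.
  have gi : intg N01 g.
    apply: (@intg_le _ _ R N01 g (fun x => `|f x|)) => //; first exact: intg_norm.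
    move=> x; have /andP[g0 g1] := gf x.
    by rewrite ger0_norm.
  have E : (\int[N01]_x (g x)%:E = \int[lam]_x (g x * phi x)%:E)%E.
    rewrite ge0_integral_normal//; first exact/measurable_EFinP.
    by move=> x; have /andP[] := gf x; rewrite lee_fin.
  split=> //; apply/integrableP; split.
    by apply/measurable_EFinP; exact: measurable_funM.
  have -> : (\int[lam]_x `|(g x * phi x)%:E| = \int[lam]_x (g x * phi x)%:E)%E.
    apply: eq_integral => x _; have /andP[g0 _] := gf x.
    by rewrite /= ger0_norm// mulr_ge0// normal_pdf_ge0.
  by rewrite -E (ExE gi) ltry.
have mp : measurable_fun setT (fun x => Num.max (f x) 0) by exact: measurable_maxr.
have mn : measurable_fun setT (fun x => Num.max (- f x) 0).
  by apply: measurable_maxr => //; exact: measurableT_comp.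
have [ip jp Ep] := h _ mp (fun y => ltac:(by rewrite le_max lexx orbT/= ge_max ler_norm normr_ge0)).
have [iN jN EN] := h _ mn (fun y => ltac:(by rewrite le_max lexx orbT/= ge_max normr_ge0 andbT -normrN ler_norm)).
have fE x : f x = Num.max (f x) 0 - Num.max (- f x) 0.
  have [p0|p0] := leP 0 (f x); first by rewrite max_r ?subr0// oppr_le0.
  by rewrite max_l ?oppr_ge0 ?ltW// sub0r opprK.
have E1 x : (f x * phi x)%:E = ((Num.max (f x) 0 * phi x)%:E - (Num.max (- f x) 0 * phi x)%:E)%E.
  by rewrite {1}fE mulrBl EFinB.
split; first by under eq_fun do rewrite E1; exact: integrableB.
under [RHS]eq_integral do rewrite E1.
rewrite [RHS]integralB// -Ep -EN -integralB//.
by apply: eq_integral => x _; rewrite {1}fE.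
Qed.

Lemma normal_He_Ex n : Ex N01 (fun x => (He R n.+1).[x]) = 0.
Proof.
have [i E] := intg_normal (normal_poly_intg (He R n.+1)).
pose f x := (He R n.+1).[x] * phi x.
rewrite -/f in i E.
have mf : measurable_fun setT f by apply/measurable_EFinP; exact: measurable_int i.
(* The radius is [k+1] because the boundary terms are bounded by a constant over [|x|], which
   requires nonzero endpoints. *)
pose B (k : nat) : set R := [set` `[(- k.+1%:R)%R, k.+1%:R]].
have mB k : measurable (B k) by exact: measurable_itv.
pose r (k : nat) : R := - ((He R n).[k.+1%:R] * phi k.+1%:R - (He R n).[- k.+1%:R] * phi (- k.+1%:R)).
have rE k : (\int[lam]_(x in B k) (f x)%:E = (r k)%:E)%E by exact: He_phi_integral.
have a0 : 0 < 2^-1 :> R by rewrite invr_gt0.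
(* Bounding ['X * He n] instead of [He n] gains the factor [1/|x|] that makes the boundary terms
   vanish. *)
have [C hC] := poly_expR_bound ('X * He R n) a0.
have C0 : 0 <= C by apply: le_trans (hC 0).
have k10 := normal_peak_ge0 (1 : R).
have hb (x : R) : x != 0 -> `|(He R n).[x] * phi x| <= normal_peak 1 * C / `|x|.
  move=> x0; rewrite ler_pdivlMr ?normr_gt0// -normrM.
  have := hC x; rewrite hornerM hornerX => h.
  have -> : (He R n).[x] * phi x * x = normal_peak 1 * (x * (He R n).[x] * expR (- (2^-1 * x ^+ 2))).
    by rewrite normal_pdf01E [2^-1 * _]mulrC; ring.
  by rewrite normrM ger0_norm// ler_wpM2l.
have r0 : r @ \oo --> (0 : R).
  apply/cvgrPdist_le => e e0.
  have [N _ hN] := near_infty_natSinv_lt (PosNum (divr_gt0 e0 (ltr_pwDr ltr01 (mulr_ge0 (ler0n R 2) (mulr_ge0 k10 C0))))).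
  near=> k; rewrite sub0r normrN /r normrN.
  have h1 := hb k.+1%:R ltac:(by rewrite pnatr_eq0).
  have h2 := hb (- k.+1%:R) ltac:(by rewrite oppr_eq0 pnatr_eq0).
  rewrite normrN (@ger0_norm _ k.+1%:R) ?ler0n// in h1 h2.
  apply: le_trans (ler_normB _ _) _.
  apply: le_trans (lerD h1 h2) _.
  have Nk : (N <= k)%N by near: k; exists N.
  have := hN k Nk.
  rewrite /= ltr_pdivlMr; last by rewrite ltr_pwDr// !mulr_ge0// ?ler0n.
  move=> h3; apply: le_trans (ltW h3).
  have -> : normal_peak 1 * C / k.+1%:R + normal_peak 1 * C / k.+1%:R =
    k.+1%:R^-1 * (2%:R * (normal_peak 1 * C)) by ring.
  by rewrite ler_wpM2l ?invr_ge0 ?ler0n// ?lerDl ?lerDr ?ler01.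
have [] := @dominated_convergence _ _ _ lam setT measurableT
  (fun k x => (f x * \1_(B k) x)%:E) (fun x => (f x)%:E) (fun x => `|(f x)%:E|%E).
- move=> k; apply/measurable_EFinP; apply: measurable_funM => //.
  by apply: measurable_indic; exact: mB.
- exact: measurable_int i.
- apply: aeW => x _; apply: cvg_near_cst; near=> k.
  rewrite indicE mem_set ?mulr1// /B /= in_itv/=.
  have : `|x| <= k%:R by near: k; exact: nbhs_infty_ger.
  rewrite ler_norml => /andP[h1 h2].
  have : k%:R <= k.+1%:R :> R by rewrite ler_nat.
  by move=> h3; rewrite (le_trans h2 h3) (le_trans _ h1)// lerN2.
- exact: (integrable_abse i).
- apply: aeW => x k _; rewrite lee_fin normrM indicE.
  by case: (_ \in _); rewrite ?normr1 ?mulr1// normr0 mulr0.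
move=> _ _ h.
have h' : (r k)%:E @[k --> \oo] --> (\int[lam]_x (f x)%:E)%E.
  rewrite (_ : (fun k => (r k)%:E) = (fun k => \int[lam]_x (f x * \1_(B k) x)%:E)%E)//.
  apply/funext => k; rewrite -rE integral_mkcond; apply: eq_integral => x _.
  by rewrite /patch indicE; case: ifP => _; rewrite ?mulr1// mulr0.
have h0 : (r k)%:E @[k --> \oo] --> (0 : R)%:E by apply: cvg_EFin => //; exact: nearW.
by rewrite /Ex /Rintegral E (cvg_unique _ h' h0).
Unshelve. all: by end_near. Qed.

(** In the Hermite expansion only [He 0] has a nonzero mean, and its coefficient is [gfun p]. *)
Lemma normal_poly_Ex (p : {poly R}) : Ex N01 (fun x => p.[x]) = gfun p.
Proof.
pose c j := gfun (p * He R j) / j`!%:R.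
have E x : p.[x] = \sum_(j < (size p).+1) c j * (He R j).[x].
  rewrite [in LHS](He_expand (leqnSn (size p))) horner_sum.
  by apply: eq_bigr => j _; rewrite hornerZ.
rewrite [LHS](eq_Ex N01 E) Ex_sum => [|j _]; last by apply: intgZ; exact: normal_poly_intg.
rewrite big_ord_recl big1 ?addr0 => [|j _].
  rewrite ExZ; last exact: normal_poly_intg.
  rewrite (eq_Ex (g := fun=> 1) N01 (fun x : R => hornerC 1 x)) Ex_cst mulr1 /c /= mulr1 fact0.
  by rewrite invr1 mulr1.
by rewrite ExZ ?normal_He_Ex ?mulr0//; exact: normal_poly_intg.
Qed.

End normal_line.

(** * Rotation invariance of the Gaussian law *)

Section plane.
Variable R : realType.
Local Notation lam := (@lebesgue_measure R).
Local Notation phi := (normal_pdf (0 : R) 1).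
Local Notation N01 := (normal_prob (0 : R) 1).
Local Open Scope ereal_scope.

Definition plane_inv (psi : R * R -> R * R) :=
  measurable_fun setT psi /\
  forall H : R * R -> \bar R, measurable_fun setT H -> (forall x, 0 <= H x) ->
    \int[lam \x lam]_z H (psi z) = \int[lam \x lam]_z H z.

Lemma plane_inv_comp f g : plane_inv f -> plane_inv g -> plane_inv (f \o g).
Proof.
move=> [mf If] [mg Ig]; split; first exact: measurableT_comp.
move=> H mH H0; rewrite -(If H)//.
have mHf : measurable_fun setT (H \o f) by exact: measurableT_comp.
by apply: (Ig (H \o f) mHf) => z; exact: H0.
Qed.

Lemma plane_inv_shear1 (a : R) : plane_inv (fun z => (z.1 + a * z.2, z.2)%R).
Proof.
have mf : measurable_fun setT (fun z : R * R => (z.1 + a * z.2, z.2)%R).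
  apply: measurable_fun_pair => //; apply: measurable_funD => //.
  exact: measurable_funM.
split => // H mH H0; rewrite fubini_tonelli2//; last exact: measurableT_comp.
rewrite fubini_tonelli2//; apply: eq_integral => y _; rewrite /fubini_G/=.
rewrite (lebesgue_shift_integral (F := fun x => H (x, y)))//.
exact: measurableT_comp.
Qed.

Lemma plane_inv_shear2 (a : R) : plane_inv (fun z => (z.1, z.2 + a * z.1)%R).
Proof.
have mf : measurable_fun setT (fun z : R * R => (z.1, z.2 + a * z.1)%R).
  apply: measurable_fun_pair => //; apply: measurable_funD => //.
  exact: measurable_funM.
split => // H mH H0; rewrite fubini_tonelli1//; last exact: measurableT_comp.
rewrite fubini_tonelli1//; apply: eq_integral => x _; rewrite /fubini_F/=.
rewrite (lebesgue_shift_integral (F := fun y => H (x, y)))//.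
exact: measurableT_comp.
Qed.

Lemma plane_inv_flip2 : plane_inv (fun z => (z.1, - z.2)%R).
Proof.
have mf : measurable_fun setT (fun z : R * R => (z.1, - z.2)%R).
  apply: measurable_fun_pair => //; exact: measurableT_comp.
split => // H mH H0; rewrite fubini_tonelli1//; last exact: measurableT_comp.
rewrite fubini_tonelli1//; apply: eq_integral => x _; rewrite /fubini_F/=.
rewrite (lebesgue_opp_integral (F := fun y => H (x, y)))//.
exact: measurableT_comp.
Qed.

Lemma plane_inv_flip1 : plane_inv (fun z => (- z.1, z.2)%R).
Proof.
have mf : measurable_fun setT (fun z : R * R => (- z.1, z.2)%R).
  apply: measurable_fun_pair => //; exact: measurableT_comp.
split => // H mH H0; rewrite fubini_tonelli2//; last exact: measurableT_comp.
rewrite fubini_tonelli2//; apply: eq_integral => x _; rewrite /fubini_G/=.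
rewrite (lebesgue_opp_integral (F := fun y => H (y, x)))//.
exact: measurableT_comp.
Qed.

(** When [c^2 + s^2 = 1], the reflection that sends the unit vector [(c, s)] to the first basis
    vector; its matrix is symmetric, hence its own inverse. *)
Definition plane_refl (c s : R) (z : R * R) : R * R :=
  (c * z.1 + s * z.2, s * z.1 - c * z.2)%R.

(* For s <> 0 the rotation by (c, s) is a product of three shears. *)
Lemma plane_inv_refl c s : (c ^+ 2 + s ^+ 2 = 1)%R -> plane_inv (plane_refl c s).
Proof.
move=> cs; have [s0|s0] := eqVneq s 0%R.
  have : ((c - 1) * (c + 1) = 0)%R by move: cs; rewrite s0; lra.
  move=> /eqP; rewrite mulf_eq0 subr_eq0 addr_eq0 => /orP[] /eqP ->.
    rewrite (_ : plane_refl _ _ = fun z => (z.1, - z.2)%R); first exact: plane_inv_flip2.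
    by apply/funext => z; rewrite /plane_refl s0; congr pair; ring.
  rewrite (_ : plane_refl _ _ = fun z => (- z.1, z.2)%R); first exact: plane_inv_flip1.
  by apply/funext => z; rewrite /plane_refl s0; congr pair; ring.
pose a := ((c - 1) / s)%R.
rewrite (_ : plane_refl c s = (fun z => (z.1 + a * z.2, z.2)%R) \o
   ((fun z => (z.1, z.2 + s * z.1)%R) \o ((fun z => (z.1 + a * z.2, z.2)%R) \o
   (fun z => (z.1, - z.2)%R)))); last first.
  have as1 : (a * s = c - 1)%R by rewrite /a divfK.
  have a1 : (a * (c + 1) = - s)%R.
    by apply: (mulfI s0); rewrite mulrA [(s * a)%R]mulrC as1; move: cs; lra.
  apply/funext => z; rewrite /plane_refl/=; congr pair.
    have -> : (z.1 + a * - z.2 + a * (- z.2 + s * (z.1 + a * - z.2)) =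
      (1 + a * s) * z.1 - (a * (2%:R + a * s)) * z.2)%R by ring.
    by rewrite as1 (_ : (2%:R + (c - 1) = c + 1)%R) ?a1; ring.
  have -> : (- z.2 + s * (z.1 + a * - z.2) = s * z.1 - (1 + a * s) * z.2)%R by ring.
  by rewrite as1; ring.
apply: plane_inv_comp; first exact: plane_inv_shear1.
apply: plane_inv_comp; first exact: plane_inv_shear2.
by apply: plane_inv_comp; [exact: plane_inv_shear1|exact: plane_inv_flip2].
Qed.

Lemma ge0_integral_normal2 (F : R * R -> \bar R) : measurable_fun setT F ->
  (forall z, 0 <= F z) ->
  \int[N01 \x N01]_z F z = \int[lam \x lam]_z (F z * (phi z.1 * phi z.2)%:E).
Proof.
move=> mF F0; have mphi := measurable_normal_pdf (0 : R) 1.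
have p0 x : (0 <= phi x)%R by exact: normal_pdf_ge0.
have mFp : measurable_fun setT (fun z => F z * (phi z.1 * phi z.2)%:E).
  apply: emeasurable_funM => //; apply/measurable_EFinP; apply: measurable_funM.
    exact: measurableT_comp mphi measurable_fst.
  exact: measurableT_comp mphi measurable_snd.
rewrite fubini_tonelli1// fubini_tonelli1//; last first.
  by move=> z; rewrite mule_ge0// lee_fin mulr_ge0.
rewrite ge0_integral_normal; last 2 first.
- by apply: measurable_fun_fubini_tonelli_F.
- by move=> x; apply: integral_ge0.
apply: eq_integral => x _; rewrite /fubini_F/=.
have mFx : measurable_fun setT (fun y => F (x, y)) by exact: measurableT_comp.
rewrite ge0_integral_normal// muleC -ge0_integralZl ?lee_fin//.
- by apply: eq_integral => y _; rewrite muleCA -EFinM.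
- apply: emeasurable_funM => //; exact/measurable_EFinP.
- by move=> y _; rewrite mule_ge0// lee_fin.
Qed.

Lemma pushes_refl c s : (c ^+ 2 + s ^+ 2 = 1)%R ->
  pushes (N01 \x N01) (N01 \x N01) (plane_refl c s).
Proof.
move=> cs; have [mf If] := plane_inv_refl cs; have mphi := measurable_normal_pdf (0 : R) 1.
have p0 x : (0 <= phi x)%R by exact: normal_pdf_ge0.
apply: pushes_of_integral => // F mF F0.
rewrite ge0_integral_normal2// ge0_integral_normal2//; last exact: measurableT_comp.
rewrite -If; last 2 first.
- apply: emeasurable_funM => //; apply/measurable_EFinP; apply: measurable_funM.
    exact: measurableT_comp mphi measurable_fst.
  exact: measurableT_comp mphi measurable_snd.
- by move=> z; rewrite mule_ge0// lee_fin mulr_ge0.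
apply: eq_integral => z _; congr (_ * _%:E).
rewrite !normal_pdf01E.
have h (u v : R) : (normal_peak 1 * expR (- (u ^+ 2 / 2)) * (normal_peak 1 * expR (- (v ^+ 2 / 2))) =
   normal_peak 1 ^+ 2 * expR (- ((u ^+ 2 + v ^+ 2) / 2)))%R.
  by rewrite mulrACA -expr2 -expRD; congr (_ * expR _)%R; ring.
rewrite !h; congr (_ * expR (- (_ / 2)))%R; rewrite /plane_refl/=.
have -> : ((c * z.1 + s * z.2) ^+ 2 + (s * z.1 - c * z.2) ^+ 2 = (c ^+ 2 + s ^+ 2) * (z.1 ^+ 2 + z.2 ^+ 2))%R.
  by ring.
by rewrite cs mul1r.
Qed.

Lemma pushes_normal_opp : pushes N01 N01 (fun x => (- x)%R).
Proof.
have p0 x : (0 <= phi x)%R by exact: normal_pdf_ge0.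
have mt : measurable_fun setT (fun x : R => (- x)%R) by exact: measurableT_comp.
apply: pushes_of_integral => // F mF F0.
rewrite ge0_integral_normal// ge0_integral_normal//; last exact: measurableT_comp.
rewrite -(lebesgue_opp_integral (F := fun x => F x * (phi x)%:E)).
- by apply: eq_integral => x _; rewrite !normal_pdf01E sqrrN.
- apply: emeasurable_funM => //; apply/measurable_EFinP; exact: measurable_normal_pdf.
- by move=> x; rewrite mule_ge0// lee_fin.
Qed.

End plane.

Section gauss_rotation.
Variable R : realType.
Local Notation N01 := (normal_prob (0 : R) 1).

(** Invariance under [g] is checked upstairs, in coordinates [f] where the law is a product. *)
Lemma pushes_factor d1 d2 d3 (T1 : measurableType d1) (T2 : measurableType d2)
    (T3 : measurableType d3) (A : probability T1 R) (B : probability T2 R)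
    (C : probability T3 R) f g :
  pushes A B f -> measurable_fun setT g -> pushes A C (g \o f) -> pushes B C g.
Proof.
move=> [mf Bf] mg [_ Cf]; split => // U mU; rewrite Cf// Bf//.
by rewrite -[X in measurable X]setTI; exact: mg.
Qed.

Lemma pushes_assoc d1 d2 d3 (T1 : measurableType d1) (T2 : measurableType d2)
    (T3 : measurableType d3) (A : probability T1 R) (B : probability T2 R)
    (C : probability T3 R) :
  pushes (A \x (B \x C))%E ((A \x B) \x C)%E (fun z => ((z.1, z.2.1), z.2.2)).
Proof.
have mf : measurable_fun setT (fun z : T1 * (T2 * T3) => ((z.1, z.2.1), z.2.2)).
  apply: measurable_fun_pair; last exact: measurable_snd_comp.
  by apply: measurable_fun_pair; [exact: measurable_fst|exact: measurable_fst_comp].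
apply: pushes_of_integral => // F mF F0.
rewrite fubini_tonelli1// fubini_tonelli1//; last 2 first.
- exact: measurable_fun_fubini_tonelli_F.
- by move=> x; apply: integral_ge0.
rewrite [RHS]fubini_tonelli1//; last exact: measurableT_comp mF mf.
apply: eq_integral => x _; rewrite /fubini_F/= fubini_tonelli1//.
exact: (measurable_fun_pair2 x (measurableT_comp mF mf)).
Qed.

Lemma pushes_eqf d1 d2 (T1 : measurableType d1) (T2 : measurableType d2)
    (A : probability T1 R) (B : probability T2 R) f g :
  f =1 g -> pushes A B f -> pushes A B g.
Proof. by move=> /funext ->. Qed.

Lemma measurable_row_mx d (T : measurableType d) a b (f : T -> 'rV[R]_a) (g : T -> 'rV[R]_b) :
  measurable_fun setT f -> measurable_fun setT g ->
  measurable_fun setT (fun x => row_mx (f x) (g x)).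
Proof.
move=> mf mg; apply: measurable_to_matrix => i j.
rewrite -(splitK j); case: (fintype.split j) => k /=.
  under eq_fun do rewrite row_mxEl.
  exact: measurableT_comp (measurable_coef i k) mf.
under eq_fun do rewrite row_mxEr.
exact: measurableT_comp (measurable_coef i k) mg.
Qed.

Lemma measurable_scalar1 d (T : measurableType d) (f : T -> R) :
  measurable_fun setT f -> measurable_fun setT (fun x => (f x)%:M : 'rV[R]_1).
Proof.
move=> mf; apply: measurable_to_matrix => i j; rewrite !ord1.
by under eq_fun do rewrite mxE eqxx mulr1n.
Qed.

Definition rowcons m (z : R * 'rV[R]_m) : 'rV[R]_(1 + m) := row_mx z.1%:M z.2.

Lemma measurable_rowcons m : measurable_fun setT (@rowcons m).
Proof.
by apply: measurable_row_mx; [exact: measurable_scalar1|exact: measurable_snd].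
Qed.

Lemma pushes_gaussS m : pushes (N01 \x gauss m)%E (gauss m.+1) (@rowcons m).
Proof.
have h : pushes (iid m N01) (gauss m) (fun t => \row_i tnth t i) := pushes_law _ _.
have hS : pushes (iid m.+1 N01) (gauss m.+1) (fun t => \row_i tnth t i) := pushes_law _ _.
apply: (pushes_factor (pushes_prod (pushes_id N01) h) (@measurable_rowcons m)).
have := pushes_comp (pushes_iid_cons N01 m) hS.
apply: pushes_eqf => -[a w]; apply/rowP => i; rewrite [LHS]mxE /rowcons/=.
case: (unliftP ord0 i) => [j ->|->].
  rewrite tnthS; have -> : lift ord0 j = rshift 1 j by exact/val_inj.
  by transitivity ((\row_i tnth w i) 0 j); [rewrite mxE|exact/esym/row_mxEr].
rewrite tnth0; have -> : ord0 = lshift m (ord0 : 'I_1) by exact/val_inj.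
transitivity ((a%:M : 'rV_1) 0 0); last exact/esym/row_mxEl.
by rewrite mxE eqxx mulr1n.
Qed.

Lemma row_mx_vall a b (A : 'rV[R]_a) (B : 'rV[R]_b) (i : 'I_(a + b)) (j : 'I_a) :
  val i = val j -> row_mx A B 0 i = A 0 j.
Proof. by move=> ij; rewrite (_ : i = lshift b j) ?row_mxEl//; exact/val_inj. Qed.

Lemma row_mx_valr a b (A : 'rV[R]_a) (B : 'rV[R]_b) (i : 'I_(a + b)) (j : 'I_b) :
  val i = (a + val j)%N -> row_mx A B 0 i = B 0 j.
Proof. by move=> ij; rewrite (_ : i = rshift a j) ?row_mxEr//; exact/val_inj. Qed.

Lemma pushes_gauss_add l q : pushes (gauss l \x gauss q)%E (gauss (l + q))
  (fun z : 'rV[R]_l * 'rV[R]_q => row_mx z.1 z.2).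
Proof.
have mrow l' : measurable_fun setT (fun z : 'rV[R]_l' * 'rV[R]_q => row_mx z.1 z.2).
  by apply: measurable_row_mx; [exact: measurable_fst|exact: measurable_snd].
elim: l => [|l IH].
  apply: (@pushes_eqf _ _ _ _ _ _ snd).
    by move=> [x y] /=; rewrite [RHS]row_thin_mx.
  split; first exact: measurable_snd.
  move=> U mU; rewrite (_ : snd @^-1` U = setT `*` U); last first.
    by apply/seteqP; split => -[x y] //= [].
  by rewrite [RHS]product_measure1E// [X in (X * _)%E]probability_setT mul1e.
have pA := pushes_comp (pushes_assoc N01 (gauss l) (gauss q))
  (pushes_prod (pushes_gaussS l) (pushes_id (gauss q))).
apply: (pushes_factor pA (mrow l.+1)).
have := pushes_comp (pushes_prod (pushes_id N01) IH) (pushes_gaussS (l + q)).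
apply: pushes_eqf => -[a [x y]] /=; rewrite /rowcons/=.
apply/rowP => i; have := @splitK 1 (l + q) i; case: (@fintype.split 1 (l + q) i) => j /= <-.
  transitivity ((a%:M : 'rV_1) 0 j); first exact: row_mx_vall.
  apply/esym; transitivity ((row_mx a%:M x : 'rV_(1 + l)) 0 (lshift l j)).
    exact: row_mx_vall.
  exact: row_mxEl.
transitivity ((row_mx x y : 'rV_(l + q)) 0 j); first exact: row_mx_valr.
have := splitK j; case: (fintype.split j) => k /= <-.
  rewrite row_mxEl; apply/esym; transitivity ((row_mx a%:M x : 'rV_(1 + l)) 0 (rshift 1 k)).
    exact: row_mx_vall.
  exact: row_mxEr.
by rewrite row_mxEr; apply/esym; apply: row_mx_valr.
Qed.

Definition rotinv m (O : 'M[R]_m) := pushes (gauss m) (gauss m) (fun x => x *m O).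

Lemma measurable_mulmxr d (T : measurableType d) a b (f : T -> 'rV[R]_a) (O : 'M[R]_(a, b)) :
  measurable_fun setT f -> measurable_fun setT (fun x => f x *m O).
Proof. by move=> mf; apply: measurable_mulmx => //; exact: measurable_cst. Qed.

Lemma rotM m (A B : 'M[R]_m) : rotinv A -> rotinv B -> rotinv (A *m B).
Proof.
move=> rA rB; have := pushes_comp rA rB; apply: pushes_eqf => x /=.
by rewrite mulmxA.
Qed.

Lemma rotV m (A B : 'M[R]_m) : A *m B = 1%:M -> rotinv A -> rotinv B.
Proof.
move=> AB rA; apply: (pushes_factor rA).
  by apply: measurable_mulmxr; exact: measurable_id.
by apply: pushes_eqf (pushes_id _) => x /=; rewrite -mulmxA AB mulmx1.
Qed.

Lemma rot_block m (A : 'M[R]_m) : rotinv A -> rotinv (block_mx 1%:M 0 0 A : 'M[R]_(1 + m)).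
Proof.
move=> rA; apply: (pushes_factor (pushes_gaussS m)).
  by apply: measurable_mulmxr; exact: measurable_id.
have := pushes_comp (pushes_prod (pushes_id N01) rA) (pushes_gaussS m).
apply: pushes_eqf => -[a x] /=; rewrite /rowcons/= mul_row_block.
by rewrite mulmx1 !mulmx0 add0r addr0.
Qed.

Lemma rot_sign m : rotinv (block_mx (- 1%:M) 0 0 1%:M : 'M[R]_(1 + m)).
Proof.
apply: (pushes_factor (pushes_gaussS m)).
  by apply: measurable_mulmxr; exact: measurable_id.
have := pushes_comp (pushes_prod (pushes_normal_opp R) (pushes_id (gauss m))) (pushes_gaussS m).
apply: pushes_eqf => -[a x] /=; rewrite /rowcons/= mul_row_block.
by rewrite !mulmx1 !mulmx0 add0r addr0 mulmxN mulmx1 raddfN.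
Qed.

Definition reflmx m (c s : R) : 'M[R]_(1 + (1 + m)) :=
  block_mx c%:M (row_mx s%:M 0) (col_mx s%:M 0) (block_mx (- c)%:M 0 0 1%:M).

Lemma mul_reflmx m (a b c s : R) (x : 'rV[R]_m) :
  row_mx a%:M (row_mx b%:M x) *m reflmx m c s =
  row_mx (c * a + s * b)%:M (row_mx (s * a - c * b)%:M x).
Proof.
rewrite /reflmx mul_row_block.
rewrite mul_mx_row mul_row_col mul_row_block !mulmx0 addr0 add0r addr0 mulmx1.
rewrite -!scalar_mxM add_row_mx add0r -!raddfD/=.
by congr (row_mx _%:M (row_mx _%:M _)); ring.
Qed.

Lemma rot_refl m c s : c ^+ 2 + s ^+ 2 = 1 -> rotinv (reflmx m c s).
Proof.
move=> cs.
have p2 : pushes (N01 \x (N01 \x gauss m))%E (gauss m.+2) (fun z => rowcons (z.1, rowcons z.2)).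
  exact: (pushes_comp (pushes_prod (pushes_id _) (pushes_gaussS m)) (pushes_gaussS m.+1)).
have p2' : pushes ((N01 \x N01) \x gauss m)%E (gauss m.+2)
    (fun z => rowcons (z.1.1, rowcons (z.1.2, z.2))).
  apply: (pushes_factor (pushes_assoc _ _ _)).
    apply: measurableT_comp (@measurable_rowcons _) _.
    apply: measurable_fun_pair; first by apply: measurable_fst_comp; exact: measurable_fst.
    apply: measurableT_comp (@measurable_rowcons _) _.
    apply: measurable_fun_pair; last exact: measurable_snd.
    by apply: measurable_snd_comp; exact: measurable_fst.
  by apply: pushes_eqf p2 => -[a [b x]].
apply: (pushes_factor p2').
  by apply: measurable_mulmxr; exact: measurable_id.
have := pushes_comp (pushes_prod (pushes_refl cs) (pushes_id (gauss m))) p2'.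
by apply: pushes_eqf => -[[a b] x] /=; rewrite /rowcons/= mul_reflmx.
Qed.

(** The reflection along [w = u - v]; equality of the norms gives that the inner product of [u] and
    [w] is half of [|w|^2], so that [u] is sent to [u - w = v]. *)
Lemma householder m (u v : 'rV[R]_m) : u *m u^T = v *m v^T ->
  exists2 H : 'M[R]_m, H *m H^T = 1%:M & u *m H = v.
Proof.
move=> uv; have [->|neq] := eqVneq u v.
  by exists 1%:M; rewrite ?mulmx1// trmx1 mulmx1.
have [w wE] : {w | w = u - v} by exists (u - v).
have w0 : w != 0 by rewrite wE subr_eq0.
have := dotv_gt0 w0; set n := (w *m w^T) 0 0 => n0.
have nE : w *m w^T = n%:M by rewrite [LHS]mx11_scalar.
have uwE : u *m w^T = (n / 2)%:M.
  have vuT : v *m u^T = u *m v^T by rewrite -[LHS]trmxK trmx_mul trmxK [RHS]mx11_scalar [in LHS](mx11_scalar (u *m v^T)) tr_scalar_mx.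
  have h : w *m w^T = 2 *: (u *m w^T).
    by rewrite wE linearB/= mulmxBl !mulmxBr -uv vuT opprB scaler_nat mulr2n.
  by rewrite -[LHS](scalerK (_ : 2 != 0 :> R)) ?pnatr_eq0// -h nE scale_scalar_mx mulrC.
pose H : 'M[R]_m := 1%:M - (2 / n) *: (w^T *m w).
have HT : H^T = H by rewrite /H linearB/= linearZ/= trmx_mul trmxK trmx1.
exists H.
  rewrite HT /H mulmxBl mul1mx mulmxBr mulmx1 -scalemxAl -scalemxAr.
  rewrite mulmxA -(mulmxA w^T w w^T) nE -[w^T *m n%:M]mulmx1 -[n%:M]scalemx1 -!scalemxAr !mulmx1 -scalemxAl.
  rewrite !scalerA -addrA -opprD -scalerBl.
  rewrite -scalerDl (_ : 2 / n + (2 / n - 2 / n * (2 / n * n)) = 0); last by field; exact: lt0r_neq0.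
  by rewrite scale0r subr0.
rewrite /H mulmxBr mulmx1 -scalemxAr mulmxA uwE mul_scalar_mx scalerA.
rewrite (_ : 2 / n * (n / 2) = 1); last by field; exact: lt0r_neq0.
by rewrite scale1r wE opprB addrCA subrr addr0.
Qed.

Lemma gauss_rot m (O : 'M[R]_m) : O *m O^T = 1%:M -> rotinv O.
Proof.
elim: m O => [|m IH] O.
  by move=> _; apply: pushes_eqf (pushes_id _) => x; apply/rowP; case.
move: O; change (forall O : 'M[R]_(1 + m), O *m O^T = 1%:M -> rotinv O) => O OO.
(* it suffices to rotate the first row of O onto the first basis vector *)
have first_row (A : 'M[R]_(1 + m)) : A *m A^T = 1%:M -> usubmx A = row_mx 1%:M 0 -> rotinv A.
  move=> AA uA; have AE : A = block_mx 1%:M 0 (dlsubmx A) (drsubmx A).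
    by rewrite -[LHS]submxK /ulsubmx /ursubmx uA row_mxKl row_mxKr.
  move: AA; rewrite AE tr_block_mx mulmx_block trmx1 !trmx0 !mulmx1 !mulmx0 !mul0mx !addr0 !mul1mx.
  rewrite (_ : (1%:M : 'M[R]_(1 + m)) = block_mx 1%:M 0 0 1%:M); last exact: scalar_mx_block.
  move=> /eq_block_mx[_ _ dl0 dd].
  have {}dl0 : dlsubmx A = 0 by [].
  move: dd; rewrite dl0 mul0mx add0r => dd.
  exact/rot_block/IH.
have uE (A B : 'M[R]_(1 + m)) : usubmx (A *m B) = usubmx A *m B.
  by rewrite -{1}[A]vsubmxK mul_col_mx col_mxKu.
have normr (A : 'M[R]_(1 + m)) a b : A *m A^T = 1%:M -> usubmx A = row_mx a%:M b ->
    a ^+ 2 + (b *m b^T) 0 0 = 1.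
  move=> AA uA; have : usubmx A *m (usubmx A)^T = 1%:M.
    have := congr1 (@ulsubmx _ 1 m 1 m) AA.
    rewrite -{1 2}[A]vsubmxK tr_col_mx mul_col_row block_mxKul => ->.
    by rewrite (@scalar_mx_block _ 1 m) block_mxKul.
  rewrite uA tr_row_mx mul_row_col tr_scalar_mx -scalar_mxM expr2.
  by move=> /matrixP /(_ 0 0); rewrite !mxE eqxx !mulr1n.
have cancel_rot (A B B' : 'M[R]_(1 + m)) : B *m B' = 1%:M -> rotinv B -> rotinv (A *m B) -> rotinv A.
  move=> BB rB rAB; rewrite -[A]mulmx1 -BB mulmxA; apply: rotM => //.
  exact: rotV BB rB.
have orthM (A B : 'M[R]_(1 + m)) : A *m A^T = 1%:M -> B *m B^T = 1%:M ->
    A *m B *m (A *m B)^T = 1%:M.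
  by move=> AA BB; rewrite trmx_mul mulmxA -(mulmxA A) BB mulmx1.
pose a := usubmx O 0 0; pose b : 'rV[R]_m := rsubmx (usubmx O).
have uO : usubmx O = row_mx a%:M b.
  rewrite -[LHS]hsubmxK; congr row_mx; rewrite [LHS]mx11_scalar; congr (_%:M).
  by rewrite mxE; congr (usubmx O _ _); exact/val_inj.
have ab := normr _ _ _ OO uO.
(* In dimension one an orthogonal matrix is a sign; in higher dimension two coordinates are
   available for a plane reflection. *)
case: m => [|m] in O OO IH first_row uE normr cancel_rot orthM a b uO ab *.
  have b0 : b = 0 by apply/rowP; case.
  move: ab; rewrite b0 mul0mx mxE addr0 => /eqP; rewrite sqrf_eq1 => /orP[]/eqP a1.
    by apply: first_row => //; rewrite uO a1 b0.
  pose B : 'M[R]_(1 + 0) := block_mx (- 1%:M) 0 0 1%:M.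
  have BT : B^T = B by rewrite /B tr_block_mx raddfN/= !trmx0 !trmx1.
  have BB : B *m B^T = 1%:M.
    rewrite BT /B mulmx_block !mulmx0 !mul0mx !addr0 add0r !mulmx1 mulmxN mulmx1 opprK.
    by rewrite [RHS]scalar_mx_block.
  apply: (cancel_rot _ _ _ BB (rot_sign 0)); apply: first_row; first exact: orthM.
  rewrite uE uO a1 b0 mul_row_block !mulmx0 !mul0mx !addr0 mulmxN mulmx1 raddfN/=.
  by rewrite opprK.
(* With [(a, b)] the first row, a Householder matrix on the last coordinates turns [b] into
   [(|b|, 0)]; its invariance is the induction hypothesis. The plane reflection of parameters
   [(a, |b|)] then sends the row to the first basis vector. *)
pose bb := (b *m b^T) 0 0.
have bb0 : 0 <= bb by rewrite /bb mxE sumr_ge0// => j _; rewrite [b^T _ _]mxE -expr2 sqr_ge0.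
pose e : 'rV[R]_(1 + m) := row_mx (Num.sqrt bb)%:M 0.
have ee : e *m e^T = bb%:M.
  rewrite /e tr_row_mx mul_row_col trmx0 mulmx0 addr0 tr_scalar_mx.
  by rewrite -scalar_mxM -expr2 sqr_sqrtr.
have [|H HH bH] := @householder _ b e.
  by rewrite [LHS]mx11_scalar; exact: esym ee.
pose R1 : 'M[R]_(1 + (1 + m)) := block_mx 1%:M 0 0 H.
have R11 : R1 *m R1^T = 1%:M.
  rewrite /R1 tr_block_mx mulmx_block !trmx0 !trmx1 !mulmx0 !mul0mx !addr0 add0r !mulmx1 HH.
  by rewrite [RHS]scalar_mx_block.
have cs : a ^+ 2 + Num.sqrt bb ^+ 2 = 1 by rewrite sqr_sqrtr.
pose R2 := reflmx m a (Num.sqrt bb).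
have R22 : R2 *m R2^T = 1%:M.
  have -> : R2^T = R2.
    by rewrite /R2 /reflmx !tr_block_mx tr_row_mx tr_col_mx !tr_scalar_mx !trmx0.
  rewrite /R2 /reflmx mulmx_block mul_row_col mul_mx_row mul_row_block mul_col_mx mul_block_col.
  rewrite mul_col_row mulmx_block add_row_mx add_col_mx add_block_mx.
  rewrite !mulmx0 !mul0mx !addr0 !add0r mulmx1 -!scalar_mxM -!raddfD/=.
  have -> : a * a + Num.sqrt bb * Num.sqrt bb = 1 by rewrite -!expr2.
  have -> : a * Num.sqrt bb + Num.sqrt bb * - a = 0 by ring.
  have -> : Num.sqrt bb * a + - a * Num.sqrt bb = 0 by ring.
  have -> : Num.sqrt bb * Num.sqrt bb + - a * - a = 1 by rewrite mulrNN addrC -!expr2.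
  by rewrite !raddf0 row_mx0 col_mx0 -!scalar_mx_block.
apply: (cancel_rot _ _ _ R11 (rot_block (IH _ HH))).
apply: (cancel_rot _ _ _ R22 (rot_refl _ cs)).
apply: first_row; first exact: (orthM _ _ (orthM _ _ OO R11) R22).
rewrite !uE uO /R1 mul_row_block !mulmx0 mulmx1 addr0 add0r bH /R2 /e.
rewrite mul_reflmx -!expr2 cs mulrC subrr.
by rewrite raddf0 row_mx0.
Qed.

End gauss_rotation.

(** * Hermite calculus for Gaussian vectors *)

Section gaussian_vector.
Variable R : realType.
Local Notation N01 := (normal_prob (0 : R) 1).

(** Only the polynomial moments of independent standard Gaussian coordinates are recorded: this
    suffices for Hermite expansions, and passes easily to images and to independent samples. *)
Definition gaussian_vec d (T : measurableType d) (P : probability T R) (I : finType)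
    (xi : T -> I -> R) :=
  forall p : I -> {poly R},
    intg P (fun w => \prod_i (p i).[xi w i]) /\
    Ex P (fun w => \prod_i (p i).[xi w i]) = \prod_i gfun (p i).

Section theory.
Context d (T : measurableType d) (P : probability T R) (I : finType) (xi : T -> I -> R).
Hypothesis g : gaussian_vec P xi.

Lemma gv_HI (b : I -> nat) : sqi P (fun w => HI b (xi w)).
Proof.
have [h _] := g (fun i => He R (b i)); split; first exact: intg_meas h.
have [h2 _] := g (fun i => He R (b i) ^+ 2).
apply: (eq_intg _ h2) => w; rewrite /HI -prodrXl; apply: eq_bigr => i _.
by rewrite horner_exp.
Qed.

Lemma gv_Ex_HI (b b' : I -> nat) :
  Ex P (fun w => HI b (xi w) * HI b' (xi w)) = \prod_i gfun (He R (b i) * He R (b' i)).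
Proof.
have [_ <-] := g (fun i => He R (b i) * He R (b' i)).
apply: eq_Ex => w; rewrite /HI -big_split; apply: eq_bigr => i _.
by rewrite hornerM.
Qed.

Lemma gv_Ex1_HI (b : I -> nat) :
  Ex P (fun w => HI b (xi w)) = \prod_i (b i == 0%N)%:R.
Proof.
have [_ ->] := g (fun i => He R (b i)); apply: eq_bigr => i _.
by rewrite -[He R (b i)]mulr1 (gfunHe R (b i) 0); case: eqP => // ->.
Qed.

Lemma gv_HW (s : seq I) : sqi P (fun w => HW s (xi w)).
Proof. exact: gv_HI. Qed.

(** The quotient of the two sides is a multinomial coefficient, built up here one binomial at a
    time. *)
Lemma prod_fact_count_le (s : seq I) : (\prod_i (count_mem i s)`! <= (size s)`!)%N.
Proof.
rewrite -sum_countN; elim/big_rec2: _ => // i x y _ h.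
rewrite (leq_trans (leq_mul (leqnn _) h))//.
rewrite -(@bin_fact (count_mem i s + x) (count_mem i s)) ?leq_addr// addKn.
by rewrite leq_pmull// bin_gt0 leq_addr.
Qed.

Lemma gv_HW_sqr (s : seq I) : Ex P (fun w => HW s (xi w) ^+ 2) <= (size s)`!%:R.
Proof.
rewrite (eq_Ex _ (fun w => expr2 _)) gv_Ex_HI.
under eq_bigr do rewrite gfunHe eqxx.
by rewrite -natr_prod ler_nat prod_fact_count_le.
Qed.

Lemma gv_pushes d' (T' : measurableType d') (Q : probability T' R) (psi : T' -> T) :
  pushes Q P psi -> gaussian_vec Q (xi \o psi).
Proof.
move=> QP p; have [h1 h2] := g p; have mh := intg_meas h1; split.
  exact/(pushes_intg QP mh).
by rewrite -h2 (pushes_Ex QP mh).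
Qed.

Lemma gv_iid n : gaussian_vec (iid n P) (fun w (ij : 'I_n * I) => xi (tnth w ij.1) ij.2).
Proof.
move=> p.
have [h1 h2] := @iid_prod _ _ _ P n (fun i w => \prod_j (p (i, j)).[xi w j])
  (fun i => (g (fun j => p (i, j))).1).
have E w : \prod_i \prod_j (p (i, j)).[xi (tnth w i) j] =
    \prod_(ij : 'I_n * I) (p ij).[xi (tnth w ij.1) ij.2].
  by rewrite pair_bigA; apply: eq_bigr => -[i j].
split; first exact: (eq_intg E h1).
rewrite -(eq_Ex _ E) h2 (eq_bigr (fun i => \prod_j gfun (p (i, j)))); last first.
  by move=> i _; exact: (g (fun j => p (i, j))).2.
by rewrite pair_bigA; apply: eq_bigr => -[i j].
Qed.

End theory.

Lemma gv_pushed d (T : measurableType d) (P : probability T R) (I : finType) d'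
    (T' : measurableType d') (Q : probability T' R) (xi : T' -> I -> R) (psi : T -> T') :
  pushes P Q psi -> (forall i, measurable_fun setT (xi ^~ i)) ->
  gaussian_vec P (xi \o psi) -> gaussian_vec Q xi.
Proof.
move=> PQ mxi g p; have [h1 h2] := g p.
have mh : measurable_fun setT (fun w => \prod_i (p i).[xi w i]).
  apply: measurable_prod => i _; apply: measurableT_comp (mxi i).
  exact: measurable_poly.
split; first exact/(pushes_intg PQ mh).
by rewrite (pushes_Ex PQ mh) h2.
Qed.

Lemma gv_gauss m : gaussian_vec (gauss m) (fun (x : 'rV[R]_m) a => x 0 a).
Proof.
have h : pushes (iid m N01) (gauss m) (fun t => \row_i tnth t i) := pushes_law _ _.
apply: (gv_pushed h); first by move=> i; exact: measurable_coef.
move=> p; have [h1 h2] := @iid_prod _ _ _ N01 m (fun i x => (p i).[x])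
  (fun i => normal_poly_intg (p i)).
split; first by apply: (eq_intg _ h1) => w; apply: eq_bigr => i _; rewrite /= mxE.
transitivity (\prod_i Ex N01 (fun x => (p i).[x])).
  by rewrite -h2; apply: eq_Ex => w; apply: eq_bigr => i _; rewrite /= mxE.
by apply: eq_bigr => i _; exact: normal_poly_Ex.
Qed.

End gaussian_vector.

(** * Moments of the planted law *)

Section planted_law.
Variables (R : realType) (r : nat) (P : probability ('rV[R]_r * R)%type R).
Variable S : {vspace 'rV[R]_r}.
Variable kappa : R.-pker 'rV[R]_(\dim (perp S)) ~> ('rV[R]_(\dim S) * R)%type.
Hypothesis dis : is_disintegration P S kappa.
Local Notation q := (\dim (perp S)).
Local Notation Y := ('rV[R]_(\dim S) * R)%type.
Local Notation z := (perp_input S).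
Local Notation y := (eff_label S).

Lemma pushes_perp_input : pushes P (gauss q) z.
Proof.
split; first exact: measurable_perp_input.
move=> A mA; have := dis mA measurableT; rewrite preimage_setT setIT => ->.
by under eq_integral do rewrite prob_kernel; rewrite integral_cst// mul1e.
Qed.

(** A disintegration speaks of rectangles only; uniqueness of measures agreeing on this generating
    class, closed under intersection, reaches all measurable sets. *)
Lemma disintegration_xsection (V : set ('rV[R]_q * Y)) : measurable V ->
  P ((fun w => (z w, y w)) @^-1` V) = (\int[gauss q]_x kappa x (xsection V x))%E.
Proof.
move=> mV.
have mzy : measurable_fun setT (fun w => (z w, y w)).
  by apply: measurable_fun_pair; [exact: measurable_perp_input|exact: measurable_eff_label].
pose k1 := kprobability (measurable_cst (gauss q : pprobability _ R) : measurable_fun [set: unit] _).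
pose k2 := kcomap kappa (measurable_snd : measurable_fun [set: unit * 'rV[R]_q] _).
have kE U : measurable U -> mkproduct k1 k2 tt U = (\int[gauss q]_x kappa x (xsection U x))%E.
  move=> mU; apply: eq_integral => x _.
  by rewrite kernel.intker_indicE.
rewrite -kE//.
have -> : P ((fun w => (z w, y w)) @^-1` V) = law P mzy V by [].
pose C : set (set ('rV[R]_q * Y)) :=
  [set C | exists A, measurable A /\ exists B, measurable B /\ C = A `*` B].
apply: (measure_unique C (fun=> setT)) => //.
- rewrite measurable_prod_measurableType //; congr (<<s _ >>).
  rewrite predeqE; split => [[A mA [B mB <-]]|[A [mA [B [mB ->]]]]].
    by exists A; split => //; exists B.
  by exists A => //; exists B.
- move=> /= _ _ [X1 [mX1 [X2 [mX2 ->]]]] [Y1 [mY1 [Y2 [mY2 ->]]]].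
  rewrite -setXI; exists (X1 `&` Y1); split; first exact: measurableI.
  by exists (X2 `&` Y2); split => //; exact: measurableI.
- by move=> n; exists setT; split => //; exists setT; split => //; rewrite setXTT.
- by rewrite bigcup_const.
- move=> _ [A [mA [B [mB ->]]]].
  transitivity (P (z @^-1` A `&` y @^-1` B)); first by [].
  rewrite dis// integral_mkcond [RHS]kE; last exact: measurableX.
  apply: eq_integral => x _; rewrite /patch; case: ifPn => xA.
    by rewrite in_xsectionX.
  by rewrite notin_xsectionX// measure0.
- move=> _; have p1 : law P mzy setT = 1%E := probability_setT (law P mzy).
  by rewrite [X in (X < _)%E]p1 ltry.
Qed.

Variables (l : nat) (O : 'M[R]_(l + q)).
Hypothesis OO : O *m O^T = 1%:M.
Let W : 'M[R]_(l + q, q) := O *m col_mx 0 1%:M.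

(** The last [q] columns of [O] are [W]. The vector [v] fills the [l] uninformative directions, and
    [P] supplies the informative ones together with the label. *)
Definition planted_map (vw : 'rV[R]_l * ('rV[R]_r * R)) : 'rV[R]_(l + q) * Y :=
  (row_mx vw.1 (z vw.2) *m O^T, y vw.2).

Lemma measurable_planted_map : measurable_fun setT planted_map.
Proof.
apply: measurable_fun_pair.
  apply: measurable_mulmxr; apply: measurable_row_mx; first exact: measurable_fst.
  exact: measurableT_comp (measurable_perp_input S) measurable_snd.
exact: measurableT_comp (measurable_eff_label S) measurable_snd.
Qed.

(** The input is a rotated Gaussian, hence Gaussian, and applying [W] to it returns exactly [z]; the
    label is therefore drawn from [kappa] at the right point. *)
Lemma pushes_planted :
  pushes (gauss l \x P)%E (kfiber (planted (l + q) kappa) W) planted_map.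
Proof.
split; first exact: measurable_planted_map.
move=> U mU.
have OTO : O^T *m O = 1%:M by exact: mulmx1C.
pose G (x : 'rV[R]_(l + q)) : \bar R := kappa (x *m W) (xsection U x).
have mW : measurable_fun setT (fun x : 'rV[R]_(l + q) => x *m W).
  by apply: measurable_mulmxr; exact: measurable_id.
have mG : measurable_fun setT G.
  pose k := kcomap kappa (measurableT_comp mW (measurable_snd : measurable_fun [set: unit * 'rV[R]_(l + q)] _)).
  have := kernel.measurable_intker_indic k mU => /(measurable_fun_pair2 tt).
  congr measurable_fun; apply/funext => x.
  by rewrite kernel.intker_indicE.
have G0 x : (0 <= G x)%E by exact: measure_ge0.
have rO : rotinv O^T by apply: gauss_rot; rewrite trmxK.
have pO := pushes_comp (pushes_gauss_add R l q) rO.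
transitivity (\int[gauss (l + q)]_x G x)%E.
  by apply: eq_integral => x _; rewrite kernel.intker_indicE.
rewrite (pushes_ge0_integral pO)// fubini_tonelli1//; last exact: measurableT_comp mG pO.1.
apply: eq_integral => v _; rewrite /fubini_F/=.
pose psi (zy : 'rV[R]_q * Y) : 'rV[R]_(l + q) * Y := (row_mx v zy.1 *m O^T, zy.2).
have mpsi : measurable_fun setT psi.
  apply: measurable_fun_pair => //; apply: measurable_mulmxr; apply: measurable_row_mx => //.
have mV : measurable (psi @^-1` U) by rewrite -[X in measurable X]setTI; exact: mpsi.
transitivity (\int[gauss q]_x kappa x (xsection (psi @^-1` U) x))%E.
  apply: eq_integral => x _; rewrite /G.
  have -> : row_mx v x *m O^T *m W = x.
    by rewrite /W mulmxA -(mulmxA _ O^T) OTO mulmx1 mul_row_col mulmx0 add0r mulmx1.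
  by congr (kappa x _); rewrite !xsectionE.
rewrite -disintegration_xsection//; congr (P _).
by rewrite !xsectionE.
Qed.

End planted_law.

Section planted_moments.
Variables (R : realType) (r : nat) (P : probability ('rV[R]_r * R)%type R).
Variable S : {vspace 'rV[R]_r}.
Variable kappa : R.-pker 'rV[R]_(\dim (perp S)) ~> ('rV[R]_(\dim S) * R)%type.
Hypothesis dis : is_disintegration P S kappa.
Local Notation q := (\dim (perp S)).
Local Notation Y := ('rV[R]_(\dim S) * R)%type.
Local Notation z := (perp_input S).
Local Notation y := (eff_label S).
Local Notation nu := (law P (measurable_eff_label S)).

Lemma pushes_snd d d' (T : measurableType d) (T' : measurableType d')
    (A : probability T R) (B : probability T' R) : pushes (A \x B)%E B snd.
Proof.
split; first exact: measurable_snd.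
move=> U mU; rewrite (_ : snd @^-1` U = setT `*` U); last first.
  by apply/seteqP; split => -[x x'] //= [].
by rewrite [RHS]product_measure1E// [X in (X * _)%E]probability_setT mul1e.
Qed.

(** The columns of [W] span at most [q'] dimensions, so the orthogonal complement of their span
    contains [l] orthonormal vectors, placed in front of them. *)
Lemma orthogonal_completion l q' (W : 'M[R]_(l + q', q')) : W^T *m W = 1%:M ->
  exists2 O : 'M[R]_(l + q'), O *m O^T = 1%:M & W = O *m col_mx 0 1%:M.
Proof.
move=> WW.
pose V : {vspace 'rV[R]_(l + q')} := <<[seq row i W^T | i : 'I_q']>>%VS.
have dV : (\dim V <= q')%N.
  by rewrite (leq_trans (dim_span _))// size_map size_enum_ord.
have lV : (l <= \dim (perp V))%N by rewrite dimv_perp -{1}(addnK q' l) leq_sub2l.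
have [B [BB BV]] := orthonormal_in_exists lV.
have BW : B *m W = 0.
  apply/row_matrixP => i; rewrite row_mul row0; apply/rowP => j.
  have /memv_perpP /(_ (row j W^T)) := BV i.
  have -> : row j W^T \in V by apply/memv_span/mapP; exists j; rewrite // mem_enum.
  move=> /(_ isT) /matrixP /(_ 0 0); rewrite !mxE => h; rewrite -[RHS]h.
  by apply: eq_bigr => k _; rewrite !mxE.
pose O := row_mx B^T W.
exists O; last by rewrite /O mul_row_col mulmx0 add0r mulmx1.
apply: mulmx1C; rewrite /O tr_row_mx trmxK mul_col_row BB BW WW.
have -> : W^T *m B^T = 0 by rewrite -trmx_mul BW trmx0.
by rewrite [RHS]scalar_mx_block.
Qed.

Variables (l n : nat).
Local Notation m := (l + q)%N.
Local Notation I := ('I_n * 'I_m)%type.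
Local Notation Iq := ('I_n * 'I_q)%type.
Local Notation sample := (n.-tuple ('rV[R]_m * Y)).

Definition xcoord m' d (T : measurableType d) (s : n.-tuple ('rV[R]_m' * T)) : 'I_n * 'I_m' -> R :=
  fun ia => (tnth s ia.1).1 0 ia.2.
Definition labels m' d (T : measurableType d) (s : n.-tuple ('rV[R]_m' * T)) : n.-tuple T :=
  [tuple of [seq xy.2 | xy <- s]].
Definition zcoord (w : n.-tuple ('rV[R]_r * R)) : Iq -> R := fun ib => z (tnth w ib.1) 0 ib.2.
Definition ylabels (w : n.-tuple ('rV[R]_r * R)) : n.-tuple Y := [tuple of map y w].
Definition Zmom (s : seq Iq) (c : n.-tuple Y -> R) : R :=
  Ex (iid n P) (fun w => c (ylabels w) * HW s (zcoord w)).
(** The block-diagonal matrix with one copy of [A] per sample, acting on all the inputs at once. *)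
Definition block_of m' (A : 'M[R]_(m', q)) : 'I_n * 'I_m' -> Iq -> R :=
  fun ia jb => (ia.1 == jb.1)%:R * A ia.2 jb.2.

Lemma measurable_xcoord m' d (T : measurableType d) ia : measurable_fun setT (@xcoord m' d T ^~ ia).
Proof.
apply: measurableT_comp (measurable_coef _ _) _.
by apply: measurable_fst_comp; exact: measurable_tnth.
Qed.

Lemma measurable_labels m' d (T : measurableType d) : measurable_fun setT (@labels m' d T).
Proof. exact: (@measurable_map_tuple _ _ _ _ n snd measurable_snd). Qed.

Lemma measurable_ylabels : measurable_fun setT ylabels.
Proof. exact: (measurable_map_tuple (measurable_eff_label S)). Qed.

Lemma measurable_HW d (T : measurableType d) (J : finType) (xi : T -> J -> R) s :
  (forall j, measurable_fun setT (xi ^~ j)) -> measurable_fun setT (fun w => HW s (xi w)).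
Proof.
move=> mxi; apply: measurable_prod => j _; apply: measurableT_comp (mxi j).
exact: measurable_poly.
Qed.

Lemma pushes_ylabels : pushes (iid n P) (iid n nu) ylabels.
Proof. exact: (pushes_iid n (pushes_law P (measurable_eff_label S))). Qed.

Lemma gv_zcoord : gaussian_vec (iid n P) zcoord.
Proof.
exact: (@gv_iid _ _ _ P _ (fun w b => z w 0 b) (gv_pushes (@gv_gauss R q) (pushes_perp_input dis)) n).
Qed.

Lemma sqi_ylabels c : measurable_fun setT c -> sqi (iid n nu) c ->
  sqi (iid n P) (fun w => c (ylabels w)).
Proof. by move=> mc /(pushes_sqi pushes_ylabels mc). Qed.

Section fixed_W.
Variable W : 'M[R]_(m, q).
Hypothesis WW : W^T *m W = 1%:M.
Local Notation PW := (kfiber (planted m kappa) W).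

Lemma pushes_planted_input_label :
  pushes PW (gauss m) fst /\ pushes PW nu snd.
Proof.
case: (orthogonal_completion WW) => O OO WE.
have := pushes_planted dis OO; rewrite -WE => pp.
have rO : rotinv O^T by apply: gauss_rot; rewrite trmxK; exact: mulmx1C.
split.
  apply: (pushes_factor pp measurable_fst).
  have := pushes_comp (pushes_comp (pushes_prod (pushes_id (gauss l)) (pushes_perp_input dis))
    (pushes_gauss_add R l q)) rO.
  by apply: pushes_eqf.
apply: (pushes_factor pp measurable_snd).
have := pushes_comp (pushes_snd (gauss l) P) (pushes_law P (measurable_eff_label S)).
by apply: pushes_eqf.
Qed.

Lemma gv_xcoord_planted : gaussian_vec (iid n PW) (@xcoord m _ Y).
Proof.
exact: (@gv_iid _ _ _ PW _ (fun s a => s.1 0 a) (gv_pushes (@gv_gauss R m) pushes_planted_input_label.1) n).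
Qed.

Lemma pushes_labels_planted : pushes (iid n PW) (iid n nu) (@labels m _ Y).
Proof. exact: (pushes_iid n pushes_planted_input_label.2). Qed.

Variable c : n.-tuple Y -> R.
Hypotheses (mc : measurable_fun setT c) (sc : sqi (iid n nu) c).

(** The bound does not involve [W]: this is the uniformity required by [mixture_Ex]. *)
Lemma planted_intg (t : seq I) :
  intg (iid n PW) (fun s => c (labels s) * HW t (xcoord s)) /\
  Ex (iid n PW) (fun s => `|c (labels s) * HW t (xcoord s)|) <=
    2^-1 * (Ex (iid n nu) (fun u => c u ^+ 2) + (size t)`!%:R).
Proof.
have s1 : sqi (iid n PW) (fun s => c (labels s)) by apply/(pushes_sqi pushes_labels_planted mc).
have s2 := gv_HW gv_xcoord_planted t.
split; first exact: intgM.
have i2 := gv_HW_sqr gv_xcoord_planted t.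
have E1 : Ex (iid n nu) (fun u => c u ^+ 2) = Ex (iid n PW) (fun s => c (labels s) ^+ 2).
  by rewrite (pushes_Ex pushes_labels_planted)//; exact: measurable_funX.
have h : 2^-1 * (Ex (iid n PW) (fun s => c (labels s) ^+ 2) + Ex (iid n PW) (fun s => HW t (xcoord s) ^+ 2)) <=
    2^-1 * (Ex (iid n nu) (fun u => c u ^+ 2) + (size t)`!%:R).
  by rewrite ler_wpM2l ?invr_ge0// E1 lerD2l.
apply: le_trans h; rewrite -ExD; [|exact: s1.2|exact: s2.2].
rewrite -ExZ; last by apply: intgD; [exact: s1.2|exact: s2.2].
apply: Ex_le.
- by apply: intg_norm; exact: intgM.
- by apply: intgZ; apply: intgD; [exact: s1.2|exact: s2.2].
- by move=> x; exact: mul_le_sqr.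
Qed.

Lemma planted_Ex (t : seq I) :
  Ex (iid n PW) (fun s => c (labels s) * HW t (xcoord s)) =
  \sum_(s <- words Iq (size t)) WP (block_of W) t s * Zmom s c.
Proof.
case: (orthogonal_completion WW) => O OO WE.
have := pushes_planted dis OO; rewrite -WE => pp.
have pPsi := pushes_comp (pushes_zip (gauss l) P n) (pushes_iid n pp).
rewrite (pushes_Ex pPsi); last first.
  apply: measurable_funM; first exact: measurableT_comp mc (@measurable_labels _ _ _).
  by apply: measurable_HW => ia; exact: measurable_xcoord.
pose I2 := ('I_n * 'I_(l + q))%type.
pose Ot (ia jb : I2) : R := (ia.1 == jb.1)%:R * O ia.2 jb.2.
pose U (vw : n.-tuple 'rV[R]_l * n.-tuple ('rV[R]_r * R)) (ib : I2) : R :=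
  row_mx (tnth vw.1 ib.1) (z (tnth vw.2 ib.1)) 0 ib.2.
have sumpair (F : I2 -> R) (i : 'I_n) : \sum_(jb : I2) (i == jb.1)%:R * F jb = \sum_b F (i, b).
  rewrite (eq_bigr (fun p => (i == p.1)%:R * F (p.1, p.2))); last by case.
  rewrite -(pair_bigA _ (fun j b => (i == j)%:R * F (j, b)))/= (bigD1 i)//=.
  rewrite [X in _ + X]big1 ?addr0 => [|j ji]; last first.
    by rewrite big1// => b _; rewrite eq_sym (negbTE ji) mul0r.
  by apply: eq_bigr => b _; rewrite eqxx mul1r.
have OtO (ia ia' : I2) : \sum_jb Ot ia jb * Ot ia' jb = (ia == ia')%:R.
  rewrite /Ot; under eq_bigr do rewrite -mulrA.
  rewrite sumpair/=; case: ia ia' => [i a] [i' a'] /=.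
  under eq_bigr do rewrite mulrCA.
  rewrite -mulr_sumr xpair_eqE [i' == i]eq_sym.
  have /matrixP /(_ a a') := OO; rewrite !mxE => h.
  have -> : \sum_b O a b * O a' b = (a == a')%:R.
    by rewrite -[RHS]h; apply: eq_bigr => b _; rewrite mxE.
  by case: eqP => _; rewrite ?mul1r// mul0r.
have xU vw ia : xcoord ([tuple of map (@planted_map R r S l O) (ziptuple vw)]) ia =
    \sum_jb Ot ia jb * U vw jb.
  rewrite /xcoord tnth_map tnth_mktuple /planted_map/= mxE /Ot.
  under [RHS]eq_bigr do rewrite -mulrA.
  rewrite (sumpair (fun jb => O ia.2 jb.2 * U vw jb)) /U/=.
  by apply: eq_bigr => b _; rewrite [X in _ * X = _]mxE mulrC.
have lU vw : labels ([tuple of map (@planted_map R r S l O) (ziptuple vw)]) = ylabels vw.2.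
  by apply: eq_from_tnth => i; rewrite /labels /ylabels [RHS]tnth_map [LHS]tnth_map tnth_map /ziptuple tnth_mktuple.
pose vcoord (v : n.-tuple 'rV[R]_l) (ib : 'I_n * 'I_l) : R := (tnth v ib.1) 0 ib.2.
have gvv : gaussian_vec (iid n (gauss l)) vcoord.
  exact: (gv_iid (@gv_gauss R l) (n := n)).
pose cl (s : seq I2) (ib : 'I_n * 'I_l) := count_mem (ib.1, lshift q ib.2) s.
pose cq (s : seq I2) (ib : Iq) := count_mem (ib.1, rshift l ib.2) s.
have splitU s vw : HW s (U vw) = HI (cl s) (vcoord vw.1) * HI (cq s) (zcoord vw.2).
  have pE (J : finType) (G : 'I_n * J -> R) : \prod_ib G ib = \prod_i \prod_b G (i, b).
    by rewrite pair_bigA; apply: eq_bigr => -[].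
  rewrite /HW /HI !pE.
  rewrite -big_split/=; apply: eq_bigr => i _; rewrite big_split_ord/=; congr (_ * _).
    by apply: eq_bigr => b _; rewrite /U/= row_mxEl.
  by apply: eq_bigr => b _; rewrite /U/= row_mxEr.
have sv s := gv_HI gvv (cl s).
have szc s : sqi (iid n P) (fun w => HI (cq s) (zcoord w)) by exact: (gv_HI gv_zcoord).
have scy := sqi_ylabels mc sc.
have E0 vw : c (labels [tuple of map (@planted_map R r S l O) (ziptuple vw)]) *
    HW t (xcoord [tuple of map (@planted_map R r S l O) (ziptuple vw)]) =
    \sum_(s <- words I2 (size t)) WP Ot t s *
      (HI (cl s) (vcoord vw.1) * (c (ylabels vw.2) * HI (cq s) (zcoord vw.2))).
  rewrite lU (HW_rotate _ OtO (xU vw)) mulr_sumr; apply: eq_bigr => s _.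
  by rewrite splitU; ring.
rewrite (eq_Ex _ E0).
have ip s : intg (iid n (gauss l) \x iid n P)%E (fun vw =>
    HI (cl s) (vcoord vw.1) * (c (ylabels vw.2) * HI (cq s) (zcoord vw.2))).
  exact: (intg_prod (sqi_intg (sv s)) (intgM scy (szc s))).
rewrite Ex_sum => [|s _]; last by apply: intgZ; exact: ip.
pose F (s : seq I2) := WP Ot t s *
  (Ex (iid n (gauss l)) (fun v => HI (cl s) (vcoord v)) *
   Ex (iid n P) (fun w => c (ylabels w) * HI (cq s) (zcoord w))).
transitivity (\sum_(s <- words I2 (size t)) F s).
  apply: eq_bigr => s _; rewrite ExZ; last exact: ip.
  by rewrite (Ex_prod (sqi_intg (sv s)) (intgM scy (szc s))).
pose emb (ib : Iq) : I2 := (ib.1, rshift l ib.2).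
have embi : injective emb by move=> [i b] [j b'] [-> /addnI/val_inj ->].
(* A letter in an uninformative direction contributes a Hermite polynomial of positive degree in a
   Gaussian coordinate independent of the labels, hence a zero mean. *)
rewrite (big_words_emb embi); last first.
  move=> s _ [[i b] si]; rewrite /F (gv_Ex1_HI gvv).
  have := splitK b; case: (fintype.split b) => b' /= bE; last first.
    by case/codomP; exists (i, b'); rewrite /emb/= bE.
  move=> _; rewrite (bigD1 (i, b'))//= [cl _ _ == _](_ : _ = false) ?mul0r ?mul0r ?mulr0//.
  by rewrite /cl/= bE; apply/negbTE; rewrite -lt0n -has_count; apply/hasP; exists (i, b) => /=.
have WO a b : W a b = O a (rshift l b).
  rewrite WE mxE big_split_ord/= big1 => [|j _]; last by rewrite col_mxEu mxE mulr0.
  rewrite add0r (bigD1 b)//= big1 => [|j jb]; rewrite col_mxEd mxE; last by rewrite (negbTE jb) mulr0.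
  by rewrite eqxx mulr1 addr0.
rewrite big_seq [RHS]big_seq; apply: eq_bigr => s /size_words st; rewrite /F.
congr (_ * _).
  elim: t s st {E0 F} => [|[i a] t IH] [|[j b] s] //= [st]; congr (_ * _); last exact: IH.
  by rewrite /Ot /block_of/= WO.
rewrite (gv_Ex1_HI gvv) big1 ?mul1r => [|[i b] _]; last first.
  rewrite /cl/= count_map (@eq_count _ _ pred0) ?count_pred0// => -[j b'] /=.
  rewrite /emb/= xpair_eqE andbC; case: eqP => // /(congr1 val)/= h.
  by have := ltn_ord b; rewrite -h ltnNge leq_addr.
apply: eq_Ex => w; congr (_ * _); rewrite /HW; apply: eq_bigr => -[i b] _.
rewrite /cq/= count_map; congr (He R _).[_]; apply: eq_count => -[j b'] /=.
by rewrite /emb/= !xpair_eqE (inj_eq (@rshift_inj _ _)).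
Qed.

End fixed_W.
End planted_moments.

(** * Hermite tensors and the effect of the leap exponent *)

Section hermite_gradient.
Variable R : realType.

Lemma normal_pdf01_gt0 (x : R) : 0 < normal_pdf 0 1 x.
Proof. by rewrite normal_pdf01E mulr_gt0 ?expR_gt0// normal_peak_gt0. Qed.

Lemma derive_coord m (g : R -> R) (f : 'rV[R]_m -> R) (u : 'rV[R]_m) (a : 'I_m) (K : R) :
  (forall h, f (h *: delta_mx 0 a + u) = K * g (h + u 0 a)) ->
  derivable g (u 0 a) 1 ->
  'D_(delta_mx 0 a) f u = K * 'D_1 g (u 0 a).
Proof.
move=> fg dg.
rewrite -[K * _]/(K *: _) -deriveZ//.
have f0 : f u = K * g (u 0 a) by have := fg 0; rewrite scale0r !add0r.
have E : (fun h : R => h^-1 *: ((f \o shift u) (h *: delta_mx 0 a) - f u)) =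
    (fun h : R => h^-1 *: (((K \*: g) \o shift (u 0 a)) (h *: 1) - (K \*: g) (u 0 a))).
  by apply/funext => h /=; rewrite fg f0 /GRing.scale/= mulr1.
by rewrite /derive E.
Qed.

(** Rodrigues' formula one direction at a time: each derivative adds its letter to the word and
    contributes a sign. *)
Lemma nabla_gauss_pdf m k (s : {ffun 'I_k -> 'I_m}) (u : 'rV[R]_m) :
  nabla (@gauss_pdf R m) u s =
  (-1) ^+ k * HW [seq s i | i <- enum 'I_k] (u 0) * gauss_pdf u.
Proof.
suff h (l : seq 'I_k) : foldr (fun a g => 'D_(delta_mx 0 (s a)) g) (@gauss_pdf R m) l =
    (fun u => (-1) ^+ (size l) * HW [seq s i | i <- l] (u 0) * gauss_pdf u).
  by rewrite /nabla h size_enum_ord.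
elim: l => [|a l IH]; first by apply/funext => v; rewrite /= HW_nil !mul1r.
rewrite [LHS]/= IH; apply/funext => {}u.
pose c i := count_mem i [seq s i | i <- l].
pose phi : R -> R := normal_pdf 0 1.
have E (v : 'rV[R]_m) (w : seq 'I_m) : HW w (v 0) * gauss_pdf v =
    (\prod_(i | i != s a) ((He R (count_mem i w)).[v 0 i] * phi (v 0 i))) *
    ((He R (count_mem (s a) w)).[v 0 (s a)] * phi (v 0 (s a))).
  by rewrite /HW /HI /gauss_pdf -big_split/= (bigD1 (s a))//= mulrC.
have dv := is_derive_He_phi (c (s a)) (u 0 (s a)).
rewrite (@derive_coord _ (fun t => (He R (c (s a))).[t] * phi t) _ _ _
   ((-1) ^+ (size l) * \prod_(i | i != s a) ((He R (c i)).[u 0 i] * phi (u 0 i)))); last first.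
- by case: dv.
- move=> h; rewrite -[LHS]mulrA E -[RHS]mulrA; congr (_ * (_ * _)).
    by apply: eq_bigr => i ia; rewrite !mxE (negbTE ia) mulr0 add0r.
  by rewrite !mxE !eqxx mulr1.
rewrite derive_val -[RHS]mulrA E /= eqxx add1n exprS mulrN !mulNr mul1r -!mulrA.
congr (- (_ * (_ * _))); apply: eq_bigr => i ia.
by rewrite eq_sym (negbTE ia).
Qed.

Lemma hermiteE m k (s : {ffun 'I_k -> 'I_m}) (u : 'rV[R]_m) :
  hermite u s = (Num.sqrt k`!%:R)^-1 * HW [seq s i | i <- enum 'I_k] (u 0).
Proof.
rewrite /hermite nabla_gauss_pdf mulfK; last first.
  by apply/prodf_neq0 => i _; rewrite gt_eqF// normal_pdf01_gt0.
by rewrite [_ / _]mulrC -!mulrA [X in _ * X]mulrA -expr2 sqrr_sign mul1r.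
Qed.

End hermite_gradient.

Section leap_vanishing.
Variables (R : realType) (r : nat) (P : probability ('rV[R]_r * R)%type R).
Variable S : {vspace 'rV[R]_r}.
Variable kappa : R.-pker 'rV[R]_(\dim (perp S)) ~> ('rV[R]_(\dim S) * R)%type.
Hypothesis dis : is_disintegration P S kappa.
Local Notation q := (\dim (perp S)).
Local Notation Y := ('rV[R]_(\dim S) * R)%type.
Local Notation z := (perp_input S).
Local Notation y := (eff_label S).
Local Notation nu := (law P (measurable_eff_label S)).

Lemma gv_perp_input : gaussian_vec P (fun w b => z w 0 b).
Proof. exact: (gv_pushes (@gv_gauss R q) (pushes_perp_input dis)). Qed.

(** Below [kap] the integral [lambda2] is 0, hence so is the integral of each of its nonnegative
    terms, one per entry of the tensor. By [hermiteE], the entry at [w] is [HW w] up to the square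
    root of a factorial. *)
Lemma leap_Ex_eq0 kap : leap_index P S kap -> forall w : seq 'I_q, (1 <= size w < kap)%N ->
  forall phi : Y -> R, measurable_fun setT phi ->
  intg P (fun x => HW w (z x 0) * phi (y x)) -> Ex P (fun x => HW w (z x 0) * phi (y x)) = 0.
Proof.
move=> [_ _ h] w wk phi mphi iphi; have l0 := h _ wk.
pose s : {ffun 'I_(size w) -> 'I_q} := [ffun i => tnth (in_tuple w) i].
have ws : [seq s i | i <- enum 'I_(size w)] = w.
  rewrite (eq_map (g := tnth (in_tuple w))) => [|i]; last by rewrite ffunE.
  exact: map_tnth_enum.
pose C := Num.sqrt (size w)`!%:R : R.
have C0 : C != 0 by rewrite sqrtr_eq0 -ltNge ltr0n fact_gt0.
have hE x : hermite (z x) s = C^-1 * HW w (z x 0) by rewrite hermiteE ws.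
have iX : intg P (fun x => hermite (z x) s).
  apply: (eq_intg (fun x => esym (hE x))); apply: intgZ.
  exact: sqi_intg (gv_HW gv_perp_input w).
have mz (s' : {ffun 'I_(size w) -> 'I_q}) : measurable_fun setT (fun x => zeta P _ S (y x) s').
  have iX' : intg P (fun x => hermite (z x) s').
    apply: (eq_intg (fun x => esym (hermiteE _ _))); apply: intgZ.
    exact: sqi_intg (gv_HW gv_perp_input _).
  have [mc _ _] := cond_expP iX' (measurable_eff_label S).
  exact: measurableT_comp mc (measurable_eff_label S).
have z0 : (\int[P]_x (cond_exp P (fun x => hermite (z x) s) y (y x) ^+ 2)%:E = 0)%E.
  have : (lambda2 P (size w) S = 0)%E.
    apply/eqP; rewrite eq_le; apply/andP; split; first by rewrite leNgt; exact/negP.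
    by apply: integral_ge0 => x _; rewrite lee_fin sumr_ge0// => s' _; exact: sqr_ge0.
  move=> l00; apply/eqP; rewrite eq_le; apply/andP; split; last first.
    by apply: integral_ge0 => x _; rewrite lee_fin sqr_ge0.
  rewrite -l00; apply: ge0_le_integral => //.
  - by move=> x _; rewrite lee_fin sqr_ge0.
  - by apply/measurable_EFinP; apply: measurable_funX; exact: (mz s).
  - apply/measurable_EFinP; apply: measurable_sum => s'; apply: measurable_funX; exact: (mz s').
  - move=> x _; rewrite lee_fin (bigD1 s)//= lerDl sumr_ge0// => s' _; exact: sqr_ge0.
have E x : HW w (z x 0) * phi (y x) = C * (hermite (z x) s * phi (y x)).
  by rewrite hE -mulrA mulVKf.
have iH : intg P (fun x => hermite (z x) s * phi (y x)).
  by apply: (eq_intg _ (intgZ C^-1 iphi)) => x; rewrite hE mulrA.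
rewrite (eq_Ex _ E) ExZ// (cond_exp_sqr0 (measurable_eff_label S) iX z0 mphi iH).
by rewrite mulr0.
Qed.

Variable n : nat.
Local Notation Iq := ('I_n * 'I_q)%type.

Lemma Zmom_eq0 kap (s : seq Iq) (c : n.-tuple Y -> R) : leap_index P S kap ->
  ~~ good_word kap (map fst s) -> measurable_fun setT c -> sqi (iid n nu) c ->
  Zmom P s c = 0.
Proof.
move=> lk /forallPn[i0]; rewrite negb_or -lt0n -ltnNge => ci0 mc sc.
(* The coordinates that [s] attaches to sample [i]. For [i0] they form a word of length between 1
   and [kap - 1], to which [leap_Ex_eq0] applies. *)
pose si i := [seq p.2 | p <- s & p.1 == i].
pose h i (x : 'rV[R]_r * R) := HW (si i) (z x 0).
have E w : HW s (zcoord w) = \prod_i h i (tnth w i).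
  rewrite /HW /HI /h /HW /HI (eq_bigr (fun p => (He R (count_mem (p.1, p.2) s)).[z (tnth w p.1) 0 p.2])); last by case.
  rewrite -(pair_bigA _ (fun i b => (He R (count_mem (i, b) s)).[z (tnth w i) 0 b]))/=.
  apply: eq_bigr => i _; apply: eq_bigr => b _; congr (He R _).[_].
  rewrite /si count_map count_filter; apply: eq_count => -[i' b'] /=.
  by rewrite xpair_eqE andbC.
have mh i : measurable_fun setT (h i).
  apply: measurable_HW => b; apply: measurableT_comp (measurable_coef _ _) _.
  exact: measurable_perp_input.
have ssi : size (si i0) = count_mem i0 (map fst s).
  by rewrite /si size_map size_filter count_map.
rewrite /Zmom (eq_Ex _ (fun w => congr1 _ (E w))).
apply: (iid_Ex_eq0 (i0 := i0) mh (measurable_eff_label S)) => //.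
  by move=> phi mphi iphi; apply: (leap_Ex_eq0 lk) => //; rewrite ssi.
have ih := intgM (sqi_ylabels mc sc) (gv_HW (@gv_zcoord _ _ _ _ _ dis n) s).
by apply: (eq_intg _ ih) => w; rewrite E.
Qed.

(** The representative is fixed by cases, so that it is identically 0 on bad words and identically 1
    on the empty word, not merely almost surely. *)
Lemma zeta_exists kap (s : seq Iq) : leap_index P S kap -> exists zeta_word : n.-tuple Y -> R,
  [/\ sqi (iid n nu) zeta_word, Ex (iid n nu) (fun u => zeta_word u ^+ 2) <= (size s)`!%:R,
    forall c, measurable_fun setT c -> sqi (iid n nu) c ->
      intg (iid n nu) (fun u => zeta_word u * c u) /\
      Zmom P s c = Ex (iid n nu) (fun u => zeta_word u * c u),
    ~~ good_word kap (map fst s) -> zeta_word = cst 0 &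
    s = [::] -> zeta_word = cst 1].
Proof.
move=> lk; case: s => [|p s].
  exists (cst 1); split=> //.
  - exact: sqi_cst.
  - by rewrite (eq_Ex _ (fun=> expr1n _ _)) Ex_cst.
  - move=> c mc sc; split; first by apply: (eq_intg _ (sqi_intg sc)) => u; rewrite mul1r.
    rewrite /Zmom (eq_Ex _ (fun w => congr1 _ (HW_nil _))).
    rewrite (eq_Ex _ (fun w => mulr1 _)) (eq_Ex _ (fun w => mul1r _)).
    by rewrite (pushes_Ex (pushes_ylabels P S n)).
  - by move=> /forallPn[i].
set s' := p :: s; have [gs|ngs] := boolP (good_word kap (map fst s')); last first.
  exists (cst 0); split=> //.
  - exact: sqi_cst.
  - by rewrite (eq_Ex _ (fun=> expr0n _ _)) Ex_cst.
  - move=> c mc sc; rewrite (Zmom_eq0 lk)//; split.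
      by apply: (eq_intg _ (intg_cst _ 0)) => u; rewrite mul0r.
    by rewrite (eq_Ex _ (fun=> mul0r _)) Ex_cst.
have sX := gv_HW (@gv_zcoord _ _ _ _ _ dis n) s'.
have [zeta_word [mz sz ez oz]] := sqi_cond_exp (@measurable_ylabels _ _ S n) sX.
have sz' : sqi (iid n nu) zeta_word by apply/(pushes_sqi (pushes_ylabels P S n) mz).
exists zeta_word; split=> //.
- rewrite (pushes_Ex (pushes_ylabels P S n)); last exact: measurable_funX.
  by apply: le_trans ez _; exact: (gv_HW_sqr (@gv_zcoord _ _ _ _ _ dis n)).
- move=> c mc sc; split; first exact: intgM.
  rewrite (pushes_Ex (pushes_ylabels P S n)); last exact: measurable_funM.
  rewrite -oz//; last exact: sqi_ylabels.
  by apply: eq_Ex => w; rewrite mulrC.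
Qed.

End leap_vanishing.

Lemma measurable_bigsum d (T : measurableType d) (R : realType) (J : Type) (r : seq J)
    (p : pred J) (h : J -> T -> R) : (forall j, measurable_fun setT (h j)) ->
  measurable_fun setT (fun x => \sum_(j <- r | p j) h j x).
Proof.
move=> mh; under eq_fun do rewrite big_mkcond/=.
by apply: measurable_sum => j; case: (p j).
Qed.

Section Lfun2.
Context d (T : measurableType d) (R : realType) (P : probability T R).

Lemma Lfun2P (f : T -> R) : f \in Lfun P 2%:E <-> sqi P f.
Proof.
split=> [fL|[mf sf]].
  split; first by have := sub_Lfun_mfun fL; rewrite inE.
  exact: Lfun2_integrable_sqr.
rewrite inE; apply/andP; split; rewrite inE//=.
rewrite /finite_norm unlock /Lnorm poweR_lty//.
under eq_integral => x _ do rewrite /= powR_mulrn ?normr_ge0// real_normK ?num_real//.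
by rewrite ExE// ltry.
Qed.

Lemma Lnorm2E (f : T -> R) : sqi P f ->
  Lnorm P 2%:E (EFin \o f) = (Num.sqrt (Ex P (fun x => f x ^+ 2)))%:E.
Proof.
move=> [mf sf]; rewrite unlock /Lnorm.
under eq_integral => x _ do rewrite /= powR_mulrn ?normr_ge0// real_normK ?num_real//.
by rewrite ExE// poweR_EFin powR12_sqrt// Ex_ge0// => x; exact: sqr_ge0.
Qed.

End Lfun2.

(** * Low-degree functions in the Hermite basis *)

Section hermite_form.
Context (R : realType) dY (Y : measurableType dY) (m n D : nat) (nu : probability Y R).
Local Notation I := ('I_n * 'I_m)%type.
Local Notation H0 := (iid n (gauss m \x nu)%E).
Local Notation idx := {ffun I -> 'I_D.+1}.
Local Notation coefs := ({ffun I -> 'I_D.+1} -> n.-tuple Y -> R).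
Local Notation sample := (n.-tuple ('rV[R]_m * Y)).
Implicit Types d e : coefs.

Definition bfact (b : {ffun I -> 'I_D.+1}) : R := \prod_i (b i)`!%:R.

(** With the weight [1/b!], the function [d b] is the conditional moment against the Hermite product
    of index [b] given the labels, under the null law. *)
Definition hpoly d (s : sample) : R :=
  \sum_(b : {ffun I -> 'I_D.+1} | (\sum_i b i <= D)%N)
    (bfact b)^-1 * d b (labels s) * HI (mult b) (xcoord s).

Lemma bfact_gt0 b : 0 < bfact b.
Proof. by apply: prodr_gt0 => i _; rewrite ltr0n fact_gt0. Qed.

Lemma measurable_HI_xcoord (b : I -> nat) :
  measurable_fun setT (fun s : sample => HI b (xcoord s)).
Proof.
apply: measurable_prod => j _; apply: measurableT_comp; last exact: measurable_xcoord.
exact: measurable_poly.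
Qed.

Lemma measurable_hpoly d : (forall b, measurable_fun setT (d b)) ->
  measurable_fun setT (hpoly d).
Proof.
move=> md; apply: measurable_bigsum => b; apply: measurable_funM; last exact: measurable_HI_xcoord.
apply: measurable_funM => //; exact: measurableT_comp (md b) (@measurable_labels _ _ _ _ _).
Qed.

Lemma poly_degree_hpoly d : (forall b, measurable_fun setT (d b)) ->
  poly_degree_le D (hpoly d).
Proof.
move=> md.
exists (fun (a : idx) u => \sum_(b : {ffun I -> 'I_D.+1} | (\sum_i b i <= D)%N)
  ((bfact b)^-1 * \prod_i (He R (b i))`_(a i)) * d b u); split.
  by move=> a; apply: measurable_bigsum => b; apply: measurable_funM.
move=> s; rewrite /hpoly.
under eq_bigr => b bD do rewrite HI_expand// mulr_sumr.
rewrite exchange_big/=; apply: eq_bigr => a aD; rewrite mulr_suml.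
apply: eq_bigr => b bD; rewrite mulrA -/(labels s); congr (_ * _); ring.
Qed.

Lemma hpoly_of_poly_degree (f : sample -> R) : poly_degree_le D f ->
  exists2 d : coefs, (forall b, measurable_fun setT (d b)) & f =1 hpoly d.
Proof.
move=> [c [mc fE]].
exists (fun (b : idx) u => \sum_(a : {ffun I -> 'I_D.+1} | (\sum_i a i <= D)%N)
  c a u * \prod_i gfun ('X^(a i) * He R (b i))).
  by move=> b; apply: measurable_bigsum => a; apply: measurable_funM.
move=> s; rewrite fE /hpoly.
under [RHS]eq_bigr => b bD do rewrite mulr_sumr mulr_suml.
rewrite [RHS]exchange_big/=; apply: eq_bigr => a aD.
rewrite (monom_expand (xcoord s) aD) mulr_sumr; apply: eq_bigr => b bD.
by rewrite -/(labels s) /bfact; ring.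
Qed.

Let xc (v : n.-tuple 'rV[R]_m) : I -> R := fun ia => tnth v ia.1 0 ia.2.

Let gv_xc : gaussian_vec (iid n (gauss m)) xc.
Proof. exact: (gv_iid (@gv_gauss R m) (n := n)). Qed.

Lemma null_pushes : pushes (iid n (gauss m) \x iid n nu)%E H0 (@ziptuple _ _ n).
Proof. exact: pushes_zip. Qed.

Let xcoord_zip w : xcoord (@ziptuple _ Y n w) = xc w.1.
Proof. by apply/funext => ia; rewrite /xcoord /ziptuple tnth_mktuple. Qed.

Let labels_zip (w : n.-tuple 'rV[R]_m * n.-tuple Y) : labels (ziptuple w) = w.2.
Proof.
by apply: eq_from_tnth => i; rewrite /labels tnth_map /ziptuple tnth_mktuple.
Qed.

Let hpoly_zip d w : hpoly d (ziptuple w) =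
  \sum_(b : {ffun I -> 'I_D.+1} | (\sum_i b i <= D)%N)
    HI (mult b) (xc w.1) * ((bfact b)^-1 * d b w.2).
Proof.
by rewrite /hpoly xcoord_zip labels_zip; apply: eq_bigr => b _; rewrite mulrC.
Qed.

Lemma sqi_hpoly d : (forall b, sqi (iid n nu) (d b)) -> sqi H0 (hpoly d).
Proof.
move=> sd; apply/(pushes_sqi null_pushes); first by apply: measurable_hpoly => b; exact: (sd b).1.
apply: (eq_sqi (fun w => esym (hpoly_zip d w))).
apply: sqi_sum => b bD.
exact: (sqi_prod (gv_HI gv_xc (mult b)) (sqiZ (bfact b)^-1 (sd b))).
Qed.

Let Ex_HI2 (b b' : {ffun I -> 'I_D.+1}) :
  Ex (iid n (gauss m)) (fun v => HI (mult b) (xc v) * HI (mult b') (xc v)) =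
  if b == b' then bfact b else 0.
Proof. by rewrite (gv_Ex_HI gv_xc) prod_gfunHe. Qed.

Lemma Ex_hpolyM d e : (forall b, sqi (iid n nu) (d b)) -> (forall b, sqi (iid n nu) (e b)) ->
  Ex H0 (fun s => hpoly d s * hpoly e s) =
  \sum_(b : {ffun I -> 'I_D.+1} | (\sum_i b i <= D)%N)
    (bfact b)^-1 * Ex (iid n nu) (fun u => d b u * e b u).
Proof.
move=> sd se; rewrite (pushes_Ex null_pushes); last first.
  by apply: measurable_funM; apply: measurable_hpoly => b; [exact: (sd b).1|exact: (se b).1].
have E w : hpoly d (ziptuple w) * hpoly e (ziptuple w) =
  \sum_(b : {ffun I -> 'I_D.+1} | (\sum_i b i <= D)%N)
  \sum_(b' : {ffun I -> 'I_D.+1} | (\sum_i b' i <= D)%N)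
   ((HI (mult b) (xc w.1) * HI (mult b') (xc w.1)) *
     (((bfact b)^-1 * (bfact b')^-1) * (d b w.2 * e b' w.2))).
  rewrite !hpoly_zip mulr_suml; apply: eq_bigr => b _; rewrite mulr_sumr.
  by apply: eq_bigr => b' _; ring.
rewrite (eq_Ex _ E).
have iX (b b' : idx) : intg (iid n (gauss m)) (fun v => HI (mult b) (xc v) * HI (mult b') (xc v)).
  by apply: intgM; exact: (gv_HI gv_xc).
have iY (b b' : {ffun I -> 'I_D.+1}) :
    intg (iid n nu) (fun u => ((bfact b)^-1 * (bfact b')^-1) * (d b u * e b' u)).
  by apply: intgZ; exact: intgM.
have iXY (b b' : idx) := intg_prod (iX b b') (iY b b').
rewrite Ex_sum => [|b _]; last by apply: intg_sum => b' _; exact: iXY.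
apply: eq_bigr => b bD; rewrite Ex_sum => [|b' _]; last exact: iXY.
rewrite (bigD1 b)//= big1 ?addr0 => [|b' /andP[_ bb']].
  rewrite (Ex_prod (iX b b) (iY b b)) Ex_HI2 eqxx ExZ; last exact: intgM.
  by rewrite mulrA mulVKf// gt_eqF// bfact_gt0.
by rewrite (Ex_prod (iX b b') (iY b b')) Ex_HI2 eq_sym (negbTE bb') mul0r.
Qed.

(** Square integrability is known for the whole sum only. At fixed labels, integrating out the
    inputs is a finite Parseval identity of nonnegative terms, and Tonelli then bounds the integral
    of each term; no cross term is integrated over the labels. *)
Lemma sqi_coef_hpoly d : (forall b, measurable_fun setT (d b)) -> sqi H0 (hpoly d) ->
  forall b : idx, (\sum_i b i <= D)%N -> sqi (iid n nu) (d b).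
Proof.
move=> md sd b bD; split; first exact: md.
have /(pushes_sqi null_pushes) : sqi H0 (hpoly d) by [].
move=> /(_ (measurable_hpoly md)) [_ iG]; set G := fun w => _ in iG.
have mG := intg_meas iG.
have inner u : Ex (iid n (gauss m)) (fun v => G (v, u)) =
    \sum_(b : {ffun I -> 'I_D.+1} | (\sum_i b i <= D)%N) (bfact b)^-1 * d b u ^+ 2 /\
    intg (iid n (gauss m)) (fun v => G (v, u)).
  have E v : G (v, u) = \sum_(b : {ffun I -> 'I_D.+1} | (\sum_i b i <= D)%N)
      \sum_(b' : {ffun I -> 'I_D.+1} | (\sum_i b' i <= D)%N)
      (((bfact b)^-1 * (bfact b')^-1) * (d b u * d b' u)) *
      (HI (mult b) (xc v) * HI (mult b') (xc v)).
    rewrite /G/= hpoly_zip/= expr2 mulr_suml; apply: eq_bigr => b1 _; rewrite mulr_sumr.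
    by apply: eq_bigr => b' _; ring.
  have iX (K : R) (b1 b' : idx) : intg (iid n (gauss m)) (fun v => K * (HI (mult b1) (xc v) * HI (mult b') (xc v))).
    by apply: intgZ; apply: intgM; exact: (gv_HI gv_xc).
  split; last first.
    apply: (eq_intg (fun v => esym (E v))); apply: intg_sum => b1 _; apply: intg_sum => b' _.
    exact: iX.
  rewrite (eq_Ex _ E) Ex_sum => [|b1 _]; last by apply: intg_sum => b' _; exact: iX.
  apply: eq_bigr => b1 b1D; rewrite Ex_sum => [|b' _]; last exact: iX.
  rewrite (bigD1 b1)//= big1 ?addr0 => [|b' /andP[_ bb']].
    rewrite ExZ; last by apply: intgM; exact: (gv_HI gv_xc).
    rewrite Ex_HI2 eqxx -expr2.
    rewrite mulrC mulrA; congr (_ * _); rewrite mulrA mulfV ?mul1r//.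
    by rewrite gt_eqF// bfact_gt0.
  rewrite ExZ; last by apply: intgM; exact: (gv_HI gv_xc).
  by rewrite Ex_HI2 eq_sym (negbTE bb') mulr0.
have G0 w : 0 <= G w by exact: sqr_ge0.
have mEG : measurable_fun setT (EFin \o G) by exact/measurable_EFinP.
have : (\int[iid n (gauss m) \x iid n nu]_w (G w)%:E < +oo)%E by rewrite ExE// ltry.
rewrite -[X in (X < _)%E]/(\int[_]_w (EFin \o G) w)%E fubini_tonelli2//=.
move=> fin; apply: intg_ge0P; [exact: measurable_funX|by move=> u; exact: sqr_ge0|].
have le1 : (\int[iid n nu]_u (d b u ^+ 2)%:E <=
    (bfact b)%:E * \int[iid n nu]_u \int[iid n (gauss m)]_v (G (v, u))%:E)%E.
  rewrite -ge0_integralZl//; last first.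
  - by rewrite lee_fin ltW// bfact_gt0.
  - by move=> u _; apply: integral_ge0 => v _; rewrite lee_fin.
  - exact: (@measurable_fun_fubini_tonelli_G _ _ _ _ R (iid n (gauss m)) (EFin \o G)).
  apply: ge0_le_integral => //.
  - by move=> u _; rewrite lee_fin sqr_ge0.
  - by apply/measurable_EFinP; exact: measurable_funX.
  - apply: emeasurable_funM => //.
    exact: (@measurable_fun_fubini_tonelli_G _ _ _ _ R (iid n (gauss m)) (EFin \o G)).
  move=> u _; rewrite ExE; last exact: (inner u).2.
  rewrite (inner u).1 -EFinM lee_fin (bigD1 b)//= mulrDr mulVKf ?gt_eqF ?bfact_gt0//.
  rewrite lerDl mulr_ge0 ?(ltW (bfact_gt0 _))// sumr_ge0// => b' _.
  by rewrite mulr_ge0 ?sqr_ge0// invr_ge0 ltW// bfact_gt0.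
apply: le_lt_trans le1 _.
rewrite lte_mul_pinfty//; first by rewrite lee_fin ltW// bfact_gt0.
Qed.

End hermite_form.

Lemma measurable_trmx (R : realType) d (T : measurableType d) a b (f : T -> 'M[R]_(a, b)) :
  measurable_fun setT f -> measurable_fun setT (fun x => (f x)^T).
Proof.
move=> mf; apply: measurable_to_matrix => i j; under eq_fun do rewrite mxE.
exact: measurableT_comp (measurable_coef _ _) mf.
Qed.

Lemma intg_ae d (T : measurableType d) (R : realType) (P : probability T R) (f : T -> R) (M : R) :
  measurable_fun setT f -> 0 <= M -> {ae P, forall x, `|f x| <= M} -> intg P f.
Proof.
move=> mf M0 fM; apply/integrableP; split; first exact/measurable_EFinP.
apply: (@le_lt_trans _ _ (\int[P]_x (cst M%:E x))%E); last first.
  by rewrite integral_cst// [X in (_ * X)%E]probability_setT mule1 ltry.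
apply: ae_ge0_le_integral => //.
- by apply: measurableT_comp => //; exact/measurable_EFinP.
by apply: filterS fM => x fM _ /=; rewrite lee_fin.
Qed.

(** * Haar matrices *)

Section haar_moments.
Variables (R : realType) (q : nat).
Implicit Types m n : nat.

Lemma measurable_orthonormal m : measurable [set W : 'M[R]_(m, q) | W^T *m W = 1%:M].
Proof.
rewrite (_ : mkset _ = \big[setI/setT]_(ij : 'I_q * 'I_q)
    [set W : 'M[R]_(m, q) | (W^T *m W) ij.1 ij.2 = (1%:M : 'M[R]_q) ij.1 ij.2]).
  apply: bigsetI_measurable => ij _.
  have mf : measurable_fun setT (fun W : 'M[R]_(m, q) => (W^T *m W) ij.1 ij.2).
    apply: measurableT_comp (measurable_coef _ _) _.
    by apply: measurable_mulmx; [exact: measurable_trmx|exact: measurable_id].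
  by have := mf measurableT [set (1%:M : 'M[R]_q) ij.1 ij.2] (measurable_set1 _); rewrite setTI.
apply/seteqP; split => W /=.
  by move=> h; rewrite -bigcap_seq => ij _ /=; rewrite h.
rewrite -bigcap_seq => h; apply/matrixP => i j.
by apply: (h (i, j)); rewrite /= mem_index_enum.
Qed.

Lemma haar_ae m (mu : probability 'M[R]_(m, q) R) : is_haar mu ->
  {ae mu, forall W, W^T *m W = 1%:M}.
Proof.
move=> [mu1 _]; apply/negligibleP.
  by apply: measurableC; exact: measurable_orthonormal.
by rewrite [LHS]probability_setC ?mu1 ?subee//; exact: measurable_orthonormal.
Qed.

Lemma haar_pushes m (mu : probability 'M[R]_(m, q) R) (O : 'M[R]_m) : is_haar mu ->
  O *m O^T = 1%:M -> pushes mu mu (mulmx O).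
Proof.
move=> [_ h] OO; split; last by move=> U mU; rewrite -[LHS](h _ OO U mU).
by apply: measurable_mulmx; [exact: measurable_cst|exact: measurable_id].
Qed.

Let sqn m (x : 'rV[R]_m) : R := \sum_a x 0 a ^+ 2.

Let sqnE m (x : 'rV[R]_m) : x *m x^T = (sqn x)%:M.
Proof.
by apply/matrixP => i j; rewrite !ord1 !mxE mulr1n; apply: eq_bigr => a _; rewrite mxE expr2.
Qed.

Let sqn_ge0 m (x : 'rV[R]_m) : 0 <= sqn x.
Proof. by apply: sumr_ge0 => a _; exact: sqr_ge0. Qed.

Let measurable_sqn m : measurable_fun setT (@sqn m).
Proof.
by apply: measurable_sum => a; apply: measurable_funX; exact: measurable_coef.
Qed.

Let measurable_F m b k :
  measurable_fun setT (fun xW : 'rV[R]_m * 'M[R]_(m, q) => ((xW.1 *m xW.2) 0 b) ^+ k).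
Proof.
apply: measurable_funX; apply: measurableT_comp (measurable_coef _ _) _.
by apply: measurable_mulmx; [exact: measurable_fst|exact: measurable_snd].
Qed.

Let measurable_Fr m b k (x : 'rV[R]_m) :
  measurable_fun setT (fun W : 'M[R]_(m, q) => ((x *m W) 0 b) ^+ k).
Proof.
apply: measurable_funX; apply: measurableT_comp (measurable_coef _ _) _.
by apply: measurable_mulmx; [exact: measurable_cst|exact: measurable_id].
Qed.

Lemma expr_double_ge0 (x : R) p : 0 <= x ^+ p.*2.
Proof. by rewrite -muln2 mulnC exprM exprn_ge0// sqr_ge0. Qed.

Let haar_scale m (mu : probability 'M[R]_(m, q) R) (v x : 'rV[R]_m) b p : is_haar mu ->
  v *m v^T = 1%:M ->
  (\int[mu]_W (((x *m W) 0 b) ^+ p.*2)%:E =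
   (sqn x ^+ p)%:E * \int[mu]_W (((v *m W) 0 b) ^+ p.*2)%:E)%E.
Proof.
move=> hmu vv; have [c cE] : {c | c = Num.sqrt (sqn x)} by exists (Num.sqrt (sqn x)).
have c2 : c ^+ 2 = sqn x by rewrite cE sqr_sqrtr.
have [|H HH xE] := @householder R m (c *: v) x.
  by rewrite linearZ/= -scalemxAl -scalemxAr scalerA vv sqnE -c2 expr2 scale_scalar_mx mulr1.
rewrite -ge0_integralZl//; last 3 first.
- by apply/measurable_EFinP; exact: measurable_Fr.
- by move=> W _; rewrite lee_fin expr_double_ge0.
- by rewrite lee_fin exprn_ge0.
rewrite [RHS](pushes_ge0_integral (haar_pushes hmu HH)); last first.
- by move=> W; rewrite -EFinM lee_fin mulr_ge0 ?expr_double_ge0// exprn_ge0.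
- by apply/measurable_EFinP; apply: measurable_funM => //; exact: measurable_Fr.
apply: eq_integral => W _; rewrite -EFinM; congr EFin.
rewrite -[X in (X *m W) 0 b]xE -scalemxAl -scalemxAl mulmxA mxE exprMn; congr (_ * _).
by rewrite -muln2 mulnC exprM c2.
Qed.

Let gauss_inner m b (W : 'M[R]_(m, q)) p : W^T *m W = 1%:M ->
  (\int[gauss m]_x (((x *m W) 0 b) ^+ p.*2)%:E = (gmom R p.*2)%:E)%E.
Proof.
move=> WW; pose w := row b W^T.
have ww : w *m w^T = 1%:M.
  apply/matrixP => i j; rewrite !ord1 !mxE eqxx.
  have /matrixP /(_ b b) := WW; rewrite !mxE eqxx => <-.
  by apply: eq_bigr => a _; rewrite !mxE.
have [a0 _] : exists a0 : 'I_m, true.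
  case: m W WW w ww => [|m] W WW w ww; last by exists ord0.
  by have /matrixP /(_ 0 0) := ww; rewrite !mxE big_ord0 => /eqP; rewrite eq_sym oner_eq0.
have [|H HH wE] := @householder R m (delta_mx 0 a0) w.
  rewrite ww trmx_delta mul_delta_mx; apply/matrixP => i j.
  by rewrite !ord1 !mxE !eqxx.
have rH : rotinv H^T by apply: gauss_rot; rewrite trmxK; exact: mulmx1C.
have E (x : 'rV[R]_m) : (x *m W) 0 b = (x *m H^T) 0 a0.
  have -> : (x *m W) 0 b = (x *m w^T) 0 0 by rewrite !mxE; apply: eq_bigr => a _; rewrite !mxE.
  rewrite -wE trmx_mul mulmxA trmx_delta [LHS]mxE (bigD1 a0)//= [delta_mx _ _ _ _]mxE !eqxx mulr1 big1 ?addr0// => a aa.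
  by rewrite [X in _ * X]mxE (negbTE aa) mulr0.
transitivity (\int[gauss m]_x (((x : 'rV[R]_m) 0 a0) ^+ p.*2)%:E)%E.
  rewrite [RHS](pushes_ge0_integral rH); last first.
  - by move=> x; rewrite lee_fin expr_double_ge0.
  - by apply/measurable_EFinP; apply: measurable_funX; exact: measurable_coef.
  by apply: eq_integral => x _; rewrite E.
have [] := @gv_gauss R m (fun a => if a == a0 then 'X^(p.*2) else 1).
have hE x : \prod_i ((if i == a0 then 'X^(p.*2) else 1) : {poly R}).[(x : 'rV[R]_m) 0 i] =
    x 0 a0 ^+ p.*2.
  by rewrite (bigD1 a0)//= eqxx hornerXn big1 ?mulr1// => i /negbTE ->; rewrite hornerC.
move=> ih Eh; have ix := eq_intg hE ih.
rewrite (ExE ix); congr EFin; rewrite -(eq_Ex _ hE) Eh (bigD1 a0)//= eqxx gfunXn big1 ?mulr1//.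
by move=> i /negbTE ->; exact: (gfunXn R 0).
Qed.

(** Jensen's inequality for [t^p], proved with the tangent line at [t = m], the mean of [|x|^2]. *)
Let gauss_sqn m p : (0 < m)%N -> intg (gauss m) (fun x => sqn x ^+ p) ->
  m%:R ^+ p <= Ex (gauss m) (fun x => sqn x ^+ p).
Proof.
move=> m0 ip; have mR : 0 < (m%:R : R) by rewrite ltr0n.
have i1 a : intg (gauss m) (fun x : 'rV[R]_m => x 0 a ^+ 2) /\ Ex (gauss m) (fun x : 'rV[R]_m => x 0 a ^+ 2) = 1.
  have [] := @gv_gauss R m (fun i => if i == a then 'X^2 else 1).
  have hE x : \prod_i ((if i == a then 'X^2 else 1) : {poly R}).[(x : 'rV[R]_m) 0 i] =
      x 0 a ^+ 2.
    by rewrite (bigD1 a)//= eqxx hornerXn big1 ?mulr1// => i /negbTE ->; rewrite hornerC.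
  move=> ih Eh; split; first exact: eq_intg hE ih.
  rewrite -(eq_Ex _ hE) Eh (bigD1 a)//= eqxx gfunXn big1 ?mulr1 ?mul1r//.
    by rewrite /= !mulr1.
  by move=> i /negbTE ->; exact: (gfunXn R 0).
have is1 : intg (gauss m) (@sqn m) by apply: intg_sum => a _; exact: (i1 a).1.
have Es : Ex (gauss m) (@sqn m) = m%:R.
  rewrite Ex_sum => [|a _]; last exact: (i1 a).1.
  by rewrite (eq_bigr (fun=> 1)) ?sumr_const ?card_ord// => a _; exact: (i1 a).2.
case: p ip => [|p] ip; first by rewrite (eq_Ex _ (fun=> expr0 _)) Ex_cst expr0.
have -> : m%:R ^+ p.+1 = Ex (gauss m)
    (fun x => (p.+1%:R * m%:R ^+ p) * sqn x + (m%:R ^+ p.+1 - p.+1%:R * m%:R ^+ p.+1)).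
  rewrite ExD; [|exact: intgZ|exact: intg_cst].
  by rewrite ExZ// Ex_cst Es exprS; ring.
apply: Ex_le => //; first by apply: intgD; [exact: intgZ|exact: intg_cst].
move=> x; move: (sqn x) (sqn_ge0 x) => t t0; have mR0 := ltW mR.
elim: p {ip} => [|p IH]; first by rewrite !expr1 expr0; lra.
(* The next tangent inequality is [t] times the previous one plus a multiple of [(t - m)^2]. *)
have h : 0 <= t * (t ^+ p.+1 - (p.+1%:R * m%:R ^+ p * t + (m%:R ^+ p.+1 - p.+1%:R * m%:R ^+ p.+1))).
  by rewrite mulr_ge0// subr_ge0.
have h2 : 0 <= p.+1%:R * m%:R ^+ p * (t - m%:R) ^+ 2 by rewrite mulr_ge0 ?sqr_ge0// mulr_ge0// exprn_ge0.
rewrite -subr_ge0; apply: le_trans (addr_ge0 h h2) _; rewrite le_eqVlt; apply/orP; left; apply/eqP.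
by rewrite -[p.+2%:R]natr1 !exprS; ring.
Qed.

(* By invariance the moment at x is |x|^(2p) times the one at a unit vector v;
   averaging over a Gaussian x, with E|x|^(2p) >= m^p, gives the bound. *)
Lemma haar_moment m (mu : probability 'M[R]_(m, q) R) (v : 'rV[R]_m) b p : is_haar mu ->
  v *m v^T = 1%:M ->
  (\int[mu]_W (((v *m W) 0 b) ^+ p.*2)%:E <= ((p.*2%:R / m%:R) ^+ p)%:E)%E.
Proof.
move=> hmu vv; set A := (\int[mu]_W _)%E.
have m0 : (0 < m)%N.
  case: m mu v hmu vv @A => [|//] mu v _ vv _.
  by have /matrixP /(_ 0 0) := vv; rewrite !mxE big_ord0 => /eqP; rewrite eq_sym oner_eq0.
have A0 : (0 <= A)%E by apply: integral_ge0 => W _; rewrite lee_fin expr_double_ge0.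
have B0 : 0 <= (p.*2%:R / m%:R : R) ^+ p by rewrite exprn_ge0// divr_ge0.
have mEF : measurable_fun setT (fun xW : 'rV[R]_m * 'M[R]_(m, q) => (((xW.1 *m xW.2) 0 b) ^+ p.*2)%:E).
  by apply/measurable_EFinP; exact: measurable_F.
have IA : ((\int[gauss m]_x (sqn x ^+ p)%:E) * A = (gmom R p.*2)%:E)%E.
  transitivity (\int[gauss m]_x \int[mu]_W (((x *m W) 0 b) ^+ p.*2)%:E)%E.
    rewrite muleC -ge0_integralZl//; last 2 first.
    - by apply/measurable_EFinP; apply: measurable_funX; exact: measurable_sqn.
    - by move=> x _; rewrite lee_fin exprn_ge0.
    by apply: eq_integral => x _; rewrite (haar_scale x b p hmu vv) muleC.
  rewrite (fubini_tonelli (fun xW : 'rV[R]_m * 'M[R]_(m, q) => (((xW.1 *m xW.2) 0 b) ^+ p.*2)%:E))//; last first.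
    by move=> x; rewrite lee_fin expr_double_ge0.
  transitivity (\int[mu]_W (cst (gmom R p.*2)%:E W))%E; last first.
    by rewrite integral_cst// [X in (_ * X)%E]probability_setT mule1.
  apply: ge0_ae_eq_integral => //.
  - by apply: (measurable_fun_fubini_tonelli_G _ mEF) => x; rewrite lee_fin expr_double_ge0.
  - by move=> W _; apply: integral_ge0 => x _; rewrite lee_fin expr_double_ge0.
  - by move=> W _; rewrite /= lee_fin gmom_ge0.
  by apply: filterS (haar_ae hmu) => W WW _; exact: (gauss_inner b p WW).
have msq : measurable_fun setT (fun x : 'rV[R]_m => sqn x ^+ p).
  by apply: measurable_funX; exact: measurable_sqn.
(* Were this moment infinite, [IA] would force [A = 0], since its right-hand side is finite. *)
have [fin|] := ltP (\int[gauss m]_x (sqn x ^+ p)%:E)%E +oo%E; last first.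
  rewrite leye_eq => /eqP I; move: IA; rewrite I.
  have [->|An0] := eqVneq A 0%E; first by rewrite lee_fin.
  by rewrite gt0_mulye// lt_neqAle eq_sym An0.
have ip : intg (gauss m) (fun x : 'rV[R]_m => sqn x ^+ p).
  by apply: intg_ge0P => // x; exact: exprn_ge0.
have mR : 0 < (m%:R : R) ^+ p by rewrite exprn_gt0// ltr0n.
have Elow := gauss_sqn m0 ip.
have hG : ((m%:R ^+ p)%:E * A <= (p.*2%:R ^+ p : R)%:E)%E.
  apply: (@le_trans _ _ (gmom R p.*2)%:E); last by rewrite lee_fin gmom_le.
  by rewrite -IA ExE//; apply: lee_wpmul2r => //; rewrite lee_fin.
by rewrite expr_div_n mulrC EFinM lee_pdivlMl.
Qed.

Section haar_words.
Variables (m n : nat) (mu : probability 'M[R]_(m, q) R).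
Hypothesis hmu : is_haar mu.
Local Notation Im := ('I_n * 'I_m)%type.
Local Notation Iq := ('I_n * 'I_q)%type.
Local Notation blk A :=
  (fun (ia : 'I_n * 'I__) (jb : 'I_n * 'I_q) => (ia.1 == jb.1)%:R * A ia.2 jb.2).

Lemma measurable_WP d (T : measurableType d) (J J' : finType) (A : T -> J -> J' -> R) t s :
  (forall j j', measurable_fun setT (fun x => A x j j')) ->
  measurable_fun setT (fun x => WP (A x) t s).
Proof.
move=> mA; elim: t s => [|j t IH] [|j' s] /=; try exact: measurable_cst.
by apply: measurable_funM; [exact: mA|exact: IH].
Qed.

Lemma measurable_WP_blk (t : seq Im) (s : seq Iq) :
  measurable_fun setT (fun W : 'M[R]_(m, q) => WP (blk W) t s).
Proof.
apply: measurable_WP => ia jb; apply: measurable_funM; first exact: measurable_cst.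
exact: measurable_coef.
Qed.

Lemma orthonormal_entry_le (W : 'M[R]_(m, q)) a b : W^T *m W = 1%:M -> `|W a b| <= 1.
Proof.
move=> WW; have /matrixP /(_ b b) := WW; rewrite !mxE eqxx mulr1n => h.
rewrite -[leRHS](expr1n _ 2)// -ler_sqr ?nnegrE// ?expr1n//.
rewrite real_normK ?num_real// -h (bigD1 a)//= mxE -expr2 lerDl sumr_ge0// => i _.
by rewrite mxE -expr2 sqr_ge0.
Qed.

Lemma WP_blk_le1 (W : 'M[R]_(m, q)) (t : seq Im) (s : seq Iq) : W^T *m W = 1%:M ->
  `|WP (blk W) t s| <= 1.
Proof.
move=> WW; elim: t s => [|ia t IH] [|jb s] //=; rewrite ?normr0 ?normr1//.
rewrite normrM mulr_ile1 ?normr_ge0// normrM mulr_ile1 ?normr_ge0//.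
  by case: eqP; rewrite ?normr1 ?normr0.
exact: orthonormal_entry_le.
Qed.

Lemma intg_WP (t : seq Im) (s : seq Iq) : intg mu (fun W => WP (blk W) t s).
Proof.
apply: (@intg_ae _ _ _ _ _ 1) => //; first exact: measurable_WP_blk.
by apply: filterS (haar_ae hmu) => W /(WP_blk_le1 t s).
Qed.

Let cross (WW' : 'M[R]_(m, q) * 'M[R]_(m, q)) : 'M[R]_q := WW'.1^T *m WW'.2.

Let measurable_cross b b' : measurable_fun setT (fun x => cross x b b').
Proof.
apply: measurableT_comp (measurable_coef _ _) _; apply: measurable_mulmx.
  exact: measurable_trmx.
exact: measurable_snd.
Qed.

Let cross_moment b b' k : intg (mu \x mu)%E (fun x => cross x b b' ^+ k.*2) /\
  Ex (mu \x mu)%E (fun x => cross x b b' ^+ k.*2) <= (k.*2%:R / m%:R) ^+ k.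
Proof.
have mf : measurable_fun setT (fun x => cross x b b' ^+ k.*2).
  exact: measurable_funX.
have le1 : (\int[mu \x mu]_x (cross x b b' ^+ k.*2)%:E <= ((k.*2%:R / m%:R) ^+ k)%:E)%E.
  rewrite (fubini_tonelli1 (fun x => (cross x b b' ^+ k.*2)%:E))//; last 2 first.
  - exact/measurable_EFinP.
  - by move=> x; rewrite lee_fin expr_double_ge0.
  apply: (@le_trans _ _ (\int[mu]_W (cst ((k.*2%:R / m%:R) ^+ k)%:E W))%E); last first.
    by rewrite integral_cst// [X in (_ * X)%E]probability_setT mule1.
  apply: ae_ge0_le_integral => //.
  - by move=> W _; apply: integral_ge0 => W' _; rewrite lee_fin expr_double_ge0.
  - apply: measurable_fun_fubini_tonelli_F; first exact/measurable_EFinP.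
    by move=> x; rewrite lee_fin expr_double_ge0.
  - by move=> W _; rewrite /= lee_fin exprn_ge0// divr_ge0.
  apply: filterS (haar_ae hmu) => W WW _.
  pose w := row b W^T.
  have ww : w *m w^T = 1%:M.
    apply/matrixP => i j; rewrite !ord1 !mxE eqxx.
    have /matrixP /(_ b b) := WW; rewrite !mxE eqxx => <-.
    by apply: eq_bigr => a _; rewrite !mxE.
  apply: le_trans (haar_moment b' k hmu ww).
  rewrite /fubini_F le_eqVlt; apply/orP; left; apply/eqP; apply: eq_integral => W' _.
  congr ((_ ^+ _)%:E); rewrite /cross/= !mxE; apply: eq_bigr => a _.
  by rewrite !mxE.
have ii : intg (mu \x mu)%E (fun x => cross x b b' ^+ k.*2).
  apply: intg_ge0P => // [x|]; first exact: expr_double_ge0.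
  by apply: le_lt_trans le1 _; rewrite ltry.
by split => //; rewrite -lee_fin -ExE.
Qed.

(** The product of two means is a mean over an independent pair, and the sum over [t] then contracts
    the two tensor powers into one of [W^T W']. Its diagonal blocks force [s] and [s'] to run
    through the same samples. *)
Lemma sum_haar_WP k (s s' : seq Iq) : (0 < m)%N -> (0 < k)%N -> size s = k -> size s' = k ->
  `|\sum_(t <- words Im k) Ex mu (fun W => WP (blk W) t s) * Ex mu (fun W => WP (blk W) t s')| <=
  (map fst s == map fst s')%:R * ((q ^ 2)%:R * Num.sqrt (k.*2%:R / m%:R) ^+ k).
Proof.
move=> m0 k0 sk s'k.
pose A : R := k.*2%:R / m%:R.
have A0 : 0 < A by rewrite divr_gt0// ltr0n// double_gt0.
(* Moments are controlled only in the even order [2k], while order [k] is needed: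
   [|a|^k <= (c + a^(2k)/c)/2], and this [c] makes both halves contribute at most [c/2] in the
   mean. *)
pose c := Num.sqrt A ^+ k.
have c0 : 0 < c by rewrite exprn_gt0// sqrtr_gt0.
have c2 : c ^+ 2 = A ^+ k by rewrite -exprM mulnC exprM sqr_sqrtr// ltW.
have ip t := intg_prod (intg_WP t s) (intg_WP t s').
have E1 : \sum_(t <- words Im k) Ex mu (fun W => WP (blk W) t s) * Ex mu (fun W => WP (blk W) t s') =
    Ex (mu \x mu)%E (fun x => WP (blk (cross x)) s s').
  under eq_bigr => t _ do rewrite -(Ex_prod (intg_WP t s) (intg_WP t s')).
  rewrite -Ex_sum => [|t _]; last exact: ip.
  apply: eq_Ex => x; rewrite -[RHS](WP_comp (I := Im) (A := blk x.1) (B := blk x.2) (k := k))//.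
  move=> [i b] [i' b'] /=; rewrite (eq_bigr (fun p : Im => (p.1 == i)%:R * ((p.1 == i')%:R * (x.1 p.2 b * x.2 p.2 b')))).
    2: by move=> [j a] _ /=; ring.
  rewrite (eq_bigr (fun p : Im => (fun j a => (j == i)%:R * ((j == i')%:R * (x.1 a b * x.2 a b'))) p.1 p.2)); last by case.
  rewrite -(pair_bigA _ (fun j a => (j == i)%:R * ((j == i')%:R * (x.1 a b * x.2 a b'))))/=.
  rewrite (bigD1 i)//= [X in _ + X]big1 ?addr0 => [|j ji]; last first.
    by rewrite big1// => a _; rewrite (negbTE ji) mul0r.
  rewrite /cross !mxE mulr_sumr; apply: eq_bigr => a _.
  by rewrite eqxx mul1r !mxE.
rewrite E1.
pose G x := (map fst s == map fst s')%:R * \sum_(p : 'I_q * 'I_q) 2^-1 * (c + c^-1 * cross x p.1 p.2 ^+ k.*2).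
have iG p : intg (mu \x mu)%E (fun x => 2^-1 * (c + c^-1 * cross x p.1 p.2 ^+ k.*2)).
  apply: intgZ; apply: intgD; first exact: intg_cst.
  by apply: intgZ; exact: (cross_moment _ _ _).1.
have iGG : intg (mu \x mu)%E G by apply: intgZ; apply: intg_sum => p _; exact: iG.
have amgm (a : R) : `|a| ^+ k <= 2^-1 * (c + c^-1 * a ^+ k.*2).
  have -> : a ^+ k.*2 = (`|a| ^+ k) ^+ 2.
    by rewrite -exprM mulnC exprM real_normK ?num_real// -exprM mul2n.
  rewrite -subr_ge0.
  have -> : 2^-1 * (c + c^-1 * (`|a| ^+ k) ^+ 2) - `|a| ^+ k = 2^-1 * c^-1 * (`|a| ^+ k - c) ^+ 2.
    by field; rewrite gt_eqF.
  by rewrite mulr_ge0 ?sqr_ge0// mulr_ge0 ?invr_ge0// ltW.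
have leG x : `|WP (blk (cross x)) s s'| <= G x.
  (* The factors of the product are distinct entries of one random matrix. Bounding them by their
     maximum, and its power by the sum of the powers, costs the number [q^2] of entries. *)
  pose X := \big[Num.max/0]_(p : 'I_q * 'I_q) `|cross x p.1 p.2|.
  apply: le_trans (@WP_block_le R n q k (cross x) X s s' _ sk s'k) _.
    by move=> b b'; exact: (le_bigmax _ (fun p : 'I_q * 'I_q => `|cross x p.1 p.2|) (b, b')).
  rewrite ler_wpM2l//; apply: le_trans (_ : \sum_(p : 'I_q * 'I_q) `|cross x p.1 p.2| ^+ k <= _); last first.
    by apply: ler_sum => p _; exact: amgm.
  suff [] : 0 <= X /\ X ^+ k <= \sum_(p : 'I_q * 'I_q) `|cross x p.1 p.2| ^+ k by [].
  rewrite /X; elim/big_rec2: _ => [|p y1 y2 _ [y10 h]]; first by rewrite expr0n gtn_eqF.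
  split; first by rewrite le_max normr_ge0.
  rewrite /Order.max; case: ifP => _; rewrite ?lerDl ?exprn_ge0//.
    by apply: le_trans h _; rewrite lerDr exprn_ge0.
  by apply: le_trans h; rewrite exprn_ge0.
have iW : intg (mu \x mu)%E (fun x => WP (blk (cross x)) s s').
  apply: (intg_le _ iGG leG); apply: measurable_WP => ia jb.
  by apply: measurable_funM => //; exact: measurable_cross.
apply: le_trans (Ex_norm_le iW iGG leG) _.
rewrite ExZ; last by apply: intg_sum => p _; exact: iG.
rewrite ler_wpM2l// Ex_sum => [|p _]; last exact: iG.
have le1 p : Ex (mu \x mu)%E (fun x => 2^-1 * (c + c^-1 * cross x p.1 p.2 ^+ k.*2)) <= c.
  have [i1 l1] := cross_moment p.1 p.2 k.
  rewrite ExZ; last by apply: intgD; [exact: intg_cst|exact: intgZ].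
  rewrite ExD; [|exact: intg_cst|exact: intgZ].
  rewrite Ex_cst ExZ//.
  have : c^-1 * Ex (mu \x mu)%E (fun x => cross x p.1 p.2 ^+ k.*2) <= c.
    by rewrite ler_pdivrMl// -expr2 c2.
  lra.
apply: le_trans (ler_sum _ (fun p _ => le1 p)) _.
by rewrite (sumr_const _ c) card_prod card_ord -[leLHS]mulr_natl.
Qed.

End haar_words.

End haar_moments.

(** * The low-degree likelihood ratio *)

Section likelihood_ratio.
Variables (R : realType) (r : nat) (P : probability ('rV[R]_r * R)%type R).
Variable S : {vspace 'rV[R]_r}.
Variable kappa : R.-pker 'rV[R]_(\dim (perp S)) ~> ('rV[R]_(\dim S) * R)%type.
Hypothesis dis : is_disintegration P S kappa.
Variable kap : nat.
Hypothesis lk : leap_index P S kap.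
Local Notation q := (\dim (perp S)).
Local Notation Y := ('rV[R]_(\dim S) * R)%type.
Local Notation nu := (law P (measurable_eff_label S)).
Variables (l n : nat).
Local Notation m := (l + q)%N.
Local Notation I := ('I_n * 'I_m)%type.
Local Notation Iq := ('I_n * 'I_q)%type.
Local Notation sample := (n.-tuple ('rV[R]_m * Y)).
Variable mu : probability 'M[R]_(m, q) R.
Hypothesis hmu : is_haar mu.
Local Notation H0 := (null_law P S m n).
Local Notation H1 := (planted_law S m n kappa mu).

Definition zeta_word (s : seq Iq) : n.-tuple Y -> R := sval (cid (zeta_exists dis s lk)).

Let ztP (s : seq Iq) := svalP (cid (zeta_exists dis s lk)).

Lemma zeta_word_sqi s : sqi (iid n nu) (zeta_word s). Proof. by case: (ztP s). Qed.

Lemma zeta_word_sqr s : Ex (iid n nu) (fun u => zeta_word s u ^+ 2) <= (size s)`!%:R.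
Proof. by case: (ztP s). Qed.

Lemma Zmom_zeta_word s c : measurable_fun setT c -> sqi (iid n nu) c ->
  Zmom P s c = Ex (iid n nu) (fun u => zeta_word s u * c u).
Proof. by case: (ztP s) => _ _ h _ _ mc sc; case: (h c mc sc). Qed.

Lemma zeta_word_bad s : ~~ good_word kap (map fst s) -> zeta_word s = cst 0.
Proof. by case: (ztP s) => _ _ _ h _; exact: h. Qed.

Lemma zeta_word_nil : zeta_word [::] = cst 1.
Proof. by case: (ztP [::]) => _ _ _ _; exact. Qed.

Definition mean_WP (t : seq I) (s : seq Iq) : R := Ex mu (fun W => WP (block_of W) t s).

Definition lr_coef (t : seq I) (u : n.-tuple Y) : R :=
  \sum_(s <- words Iq (size t)) mean_WP t s * zeta_word s u.

Lemma lr_coef_sqi t : sqi (iid n nu) (lr_coef t).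
Proof. by apply: sqi_sum => s _; apply: sqiZ; exact: zeta_word_sqi. Qed.

Lemma planted_law_moment t c : measurable_fun setT c -> sqi (iid n nu) c ->
  intg H1 (fun s => c (labels s) * HW t (xcoord s)) /\
  Ex H1 (fun s => c (labels s) * HW t (xcoord s)) = Ex (iid n nu) (fun u => lr_coef t u * c u).
Proof.
move=> mc sc.
pose F (W : 'M[R]_(m, q)) := \sum_(s <- words Iq (size t)) WP (block_of W) t s * Zmom P s c.
have EF : Ex mu F = Ex (iid n nu) (fun u => lr_coef t u * c u).
  have iW s : intg mu (fun W => WP (block_of W) t s * Zmom P s c).
    by apply: (eq_intg _ (intgZ (Zmom P s c) (intg_WP hmu t s))) => W; rewrite mulrC.
  rewrite /F Ex_sum => [|s _]; last exact: iW.
  have E u : lr_coef t u * c u = \sum_(s <- words Iq (size t)) mean_WP t s * (zeta_word s u * c u).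
    by rewrite /lr_coef mulr_suml; apply: eq_bigr => s _; rewrite mulrA.
  have iz s : intg (iid n nu) (fun u => zeta_word s u * c u) by apply: intgM => //; exact: zeta_word_sqi.
  rewrite (eq_Ex _ E) Ex_sum => [|s _]; last by apply: intgZ; exact: iz.
  apply: eq_bigr => s _; rewrite [RHS]ExZ; last exact: iz.
  rewrite -[X in _ = _ * X](Zmom_zeta_word s mc sc) [RHS]mulrC -[RHS]ExZ; last exact: intg_WP.
  by apply: eq_Ex => W; rewrite mulrC.
rewrite -EF.
have M0 : 0 <= 2^-1 * (Ex (iid n nu) (fun u => c u ^+ 2) + (size t)`!%:R) :> R.
  by rewrite mulr_ge0// addr_ge0// Ex_ge0// => u; exact: sqr_ge0.
apply: (mixture_Ex M0).
- apply: measurable_funM; first exact: measurableT_comp mc (@measurable_labels _ _ _ _ _).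
  by apply: measurable_HW => ia; exact: measurable_xcoord.
- apply: measurable_sum => s; apply: measurable_funM => //; exact: measurable_WP_blk.
apply: filterS (haar_ae hmu) => W WW.
have [h1 h2] := planted_intg dis WW mc sc t.
split=> //; exact: (planted_Ex dis WW mc sc t).
Qed.

(** The representatives [zeta_word s] are chosen separately for each [s], so [lr_coef t] and
    [lr_coef t'] are not claimed equal pointwise. They represent the same functional of [c], because
    [HW] ignores the order of letters, and so have the same norm. *)
Lemma Ex_lr_coef_perm t t' : perm_eq t t' ->
  Ex (iid n nu) (fun u => lr_coef t u ^+ 2) = Ex (iid n nu) (fun u => lr_coef t' u ^+ 2).
Proof.
move=> tt'.
have swap c : measurable_fun setT c -> sqi (iid n nu) c ->
    Ex (iid n nu) (fun u => lr_coef t u * c u) = Ex (iid n nu) (fun u => lr_coef t' u * c u).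
  move=> mc sc; rewrite -(planted_law_moment t mc sc).2 -(planted_law_moment t' mc sc).2.
  by apply: eq_Ex => s; rewrite (HW_perm (xcoord s) tt').
rewrite (eq_Ex _ (fun u => expr2 _)) (eq_Ex _ (fun u => expr2 (lr_coef t' u))).
rewrite swap; [|exact: (lr_coef_sqi t).1|exact: lr_coef_sqi].
rewrite -(swap (lr_coef t')); [|exact: (lr_coef_sqi t').1|exact: lr_coef_sqi].
by apply: eq_Ex => u; rewrite mulrC.
Qed.

Variable D : nat.
Local Notation idx := ({ffun I -> 'I_D.+1}).

Definition low_degree_ratio : sample -> R := hpoly (fun b : idx => lr_coef (canon_word (mult b))).

Lemma low_degree_ratio_space : low_degree_space H0 D low_degree_ratio.
Proof.
split; first by apply/Lfun2P; apply: sqi_hpoly => b; exact: lr_coef_sqi.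
by apply: poly_degree_hpoly => b; exact: (lr_coef_sqi _).1.
Qed.

Lemma low_degree_ratio_Ex (p : sample -> R) : low_degree_space H0 D p ->
  intg H1 p /\ Ex H0 (fun s => low_degree_ratio s * p s) = Ex H1 p.
Proof.
move=> [/Lfun2P sp /hpoly_of_poly_degree[d0 md0 pE]].
(* Coefficients of weight above [D] do not enter [p], and [sqi_coef_hpoly] says nothing about them;
   they are set to 0. *)
pose d (b : idx) := if (\sum_i b i <= D)%N then d0 b else cst 0.
have pE' s : p s = hpoly d s.
  by rewrite pE /hpoly; apply: eq_bigr => b bD; rewrite /d bD.
have sd b : sqi (iid n nu) (d b).
  rewrite /d; case: ifPn => bD; last exact: sqi_cst.
  apply: (sqi_coef_hpoly (D := D) md0 _ bD).
  exact: (eq_sqi pE sp).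
rewrite (eq_Ex _ (fun s => congr1 _ (pE' s))) (Ex_hpolyM (fun b => lr_coef_sqi _) sd).
have hE s : hpoly d s = \sum_(b : idx | (\sum_i b i <= D)%N)
    (bfact R b)^-1 * (d b (labels s) * HW (canon_word (mult b)) (xcoord s)).
  by apply: eq_bigr => b _; rewrite HW_canon_word mulrA.
have hm (b : idx) := planted_law_moment (canon_word (mult b)) (sd b).1 (sd b).
have ib (b : idx) : intg H1 (fun s => (bfact R b)^-1 * (d b (labels s) * HW (canon_word (mult b)) (xcoord s))).
  by apply: intgZ; exact: (hm b).1.
split.
  apply: (eq_intg (fun s => esym (pE' s))); apply: (eq_intg (fun s => esym (hE s))).
  by apply: intg_sum => b _; exact: ib.
rewrite (eq_Ex _ pE') (eq_Ex _ hE) Ex_sum => [|b _]; last exact: ib.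
apply: eq_bigr => b _; rewrite ExZ; last exact: (hm b).1.
by rewrite (hm b).2.
Qed.

Lemma is_LR_low_degree_ratio : is_low_degree_LR H0 H1 D low_degree_ratio.
Proof.
split=> [|p hp]; first exact: low_degree_ratio_space.
have [ip Ep] := low_degree_ratio_Ex hp; rewrite (ExE ip) -Ep -ExE//.
by apply: intgM; apply/Lfun2P; [exact: low_degree_ratio_space.1|exact: hp.1].
Qed.

(** With [g] the explicit ratio, testing each of [f] and [g] against both gives [E0[f^2] = E1[f] =
    E0[g f] = E1[g] = E0[g^2]]. *)
Lemma is_LR_norm f : is_low_degree_LR H0 H1 D f ->
  Ex H0 (fun s => f s ^+ 2) = Ex H0 (fun s => low_degree_ratio s ^+ 2).
Proof.
move=> [fs hf]; have f0s := low_degree_ratio_space.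
have E p : low_degree_space H0 D p -> Ex H0 (fun s => f s * p s) = Ex H1 p.
  by move=> hp; rewrite /Ex /Rintegral hf.
have E0 p hp := (@low_degree_ratio_Ex p hp).2.
rewrite (eq_Ex _ (fun s => expr2 _)) (E _ fs) -(E0 _ fs).
rewrite (eq_Ex _ (fun s => mulrC _ _)) (E _ f0s) -(E0 _ f0s).
by apply: eq_Ex => s; rewrite expr2.
Qed.

Lemma low_degree_ratio_sqr :
  Ex H0 (fun s => low_degree_ratio s ^+ 2) =
  \sum_(k < D.+1) (k`!%:R)^-1 * \sum_(s <- words Iq k) \sum_(s' <- words Iq k)
    (\sum_(t <- words I k) mean_WP t s * mean_WP t s') * Ex (iid n nu) (fun u => zeta_word s u * zeta_word s' u).
Proof.
rewrite (eq_Ex _ (fun s => expr2 _)).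
rewrite (Ex_hpolyM (fun b => lr_coef_sqi _) (fun b => lr_coef_sqi _)).
rewrite (eq_bigr (fun b : idx => (\prod_i (b i)`!%:R)^-1 *
   Ex (iid n nu) (fun u => lr_coef (canon_word (mult b)) u ^+ 2))); last first.
  by move=> b _; congr (_ * _); apply: eq_Ex => u; rewrite expr2.
have pF : perm_inv (fun t => Ex (iid n nu) (fun u => lr_coef t u ^+ 2)).
  by move=> t t'; exact: Ex_lr_coef_perm.
rewrite (sum_index D pF).
apply: eq_bigr => k _; congr (_ * _).
transitivity (\sum_(t <- words I k) \sum_(s <- words Iq k) \sum_(s' <- words Iq k)
    (mean_WP t s * mean_WP t s') * Ex (iid n nu) (fun u => zeta_word s u * zeta_word s' u)).
  rewrite big_seq [RHS]big_seq; apply: eq_bigr => t /size_words tk.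
  have E u : lr_coef t u ^+ 2 = \sum_(s <- words Iq k) \sum_(s' <- words Iq k)
      (mean_WP t s * mean_WP t s') * (zeta_word s u * zeta_word s' u).
    rewrite /lr_coef tk expr2 mulr_suml; apply: eq_bigr => s _; rewrite mulr_sumr.
    by apply: eq_bigr => s' _; ring.
  have iz s s' : intg (iid n nu) (fun u => zeta_word s u * zeta_word s' u) by apply: intgM; exact: zeta_word_sqi.
  rewrite (eq_Ex _ E) Ex_sum => [|s _]; last by apply: intg_sum => s' _; apply: intgZ; exact: iz.
  apply: eq_bigr => s _; rewrite Ex_sum => [|s' _]; last by apply: intgZ; exact: iz.
  by apply: eq_bigr => s' _; rewrite [LHS]ExZ; last exact: iz.
rewrite exchange_big/=; apply: eq_bigr => s _.
rewrite exchange_big/=; apply: eq_bigr => s' _.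
by rewrite mulr_suml.
Qed.

(** The empty word accounts for the 1. For [k >= 1] the inner products of the [zeta_word] are at
    most [k!], which cancels [1/k!], and [sum_haar_WP] and [sum_good_pairs] supply the two factors
    of the ratio. *)
Lemma low_degree_ratio_bound (rho : R) : (0 < m)%N -> (0 < kap)%N -> 1 <= rho -> n%:R <= rho ^+ kap ->
  `|Ex H0 (fun s => low_degree_ratio s ^+ 2) - 1| <=
  \sum_(1 <= k < D.+1) (q ^ 2)%:R *
     (Num.sqrt (k.*2%:R / m%:R) * (k%:R * rho * q%:R ^+ 2)) ^+ k.
Proof.
move=> m0 kap0 rho1 nrho; rewrite low_degree_ratio_sqr -(big_mkord xpredT (fun k =>
  (k`!%:R)^-1 * \sum_(s <- words Iq k) \sum_(s' <- words Iq k)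
    (\sum_(t <- words I k) mean_WP t s * mean_WP t s') * Ex (iid n nu) (fun u => zeta_word s u * zeta_word s' u))).
rewrite big_nat_recl// big_add1/=.
have E0 : (0`!%:R)^-1 * (\sum_(s <- words Iq 0) \sum_(s' <- words Iq 0)
    (\sum_(t <- words I 0) mean_WP t s * mean_WP t s') * Ex (iid n nu) (fun u => zeta_word s u * zeta_word s' u)) = 1 :> R.
  rewrite !big_words0 zeta_word_nil (_ : mean_WP [::] [::] = 1); last by rewrite /mean_WP/= (Ex_cst mu 1).
  rewrite (_ : Ex _ _ = 1) ?fact0 ?invr1 ?mulr1//.
  by rewrite (eq_Ex _ (fun u => mulr1 _)) (Ex_cst _ 1).
rewrite E0 [1 + _]addrC addrK.
apply: le_trans (ler_norm_sum _ _ _) _; apply: ler_sum => j _; set k := j.+1.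
pose c : R := Num.sqrt (k.*2%:R / m%:R) ^+ k.
have fk : 0 < k`!%:R :> R by rewrite ltr0n fact_gt0.
rewrite normrM ger0_norm ?invr_ge0 ?(ltW fk)// ler_pdivrMl//.
have term s s' : s \in words Iq k -> s' \in words Iq k ->
    `|(\sum_(t <- words I k) mean_WP t s * mean_WP t s') * Ex (iid n nu) (fun u => zeta_word s u * zeta_word s' u)| <=
    (k`!%:R * ((q ^ 2)%:R * c)) * (good_word kap (map fst s) && (map fst s == map fst s'))%:R.
  move=> /size_words sk /size_words s'k.
  have [gs|bs] := boolP (good_word kap (map fst s)); last first.
    rewrite (zeta_word_bad bs) (eq_Ex _ (fun u => mul0r _)) (Ex_cst _ 0) mulr0 normr0.
    by rewrite mulr0.
  have b1 := @sum_haar_WP R q m n mu hmu k s s' m0 isT sk s'k.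
  have b2 : `|Ex (iid n nu) (fun u => zeta_word s u * zeta_word s' u)| <= k`!%:R.
    apply: le_trans (ExM_le (zeta_word_sqi s) (zeta_word_sqi s')) _.
    have := zeta_word_sqr s; have := zeta_word_sqr s'; rewrite sk s'k; lra.
  rewrite normrM; apply: le_trans (ler_pM (normr_ge0 _) (normr_ge0 _) b1 b2) _.
  by rewrite /= le_eqVlt; apply/orP; left; apply/eqP; rewrite -/c; ring.
apply: le_trans (ler_norm_sum _ _ _) _; rewrite big_seq.
apply: le_trans (_ : \sum_(s <- words Iq k | s \in words Iq k) \sum_(s' <- words Iq k)
   (k`!%:R * ((q ^ 2)%:R * c)) * (good_word kap (map fst s) && (map fst s == map fst s'))%:R <= _).
  apply: ler_sum => s sW; apply: le_trans (ler_norm_sum _ _ _) _.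
  by rewrite big_seq [leRHS]big_seq; apply: ler_sum => s' s'W; exact: term.
rewrite -big_seq.
under eq_bigr => s _ do rewrite -mulr_sumr.
rewrite -mulr_sumr -mulrA ler_wpM2l ?(ltW fk)// -mulrA ler_wpM2l//.
rewrite exprMn -/c ler_wpM2l//; last exact: sum_good_pairs.
by rewrite exprn_ge0// sqrtr_ge0.
Qed.

End likelihood_ratio.

(** * Asymptotic estimates *)

Section asymptotics.
Variable R : realType.

Lemma sum_expr_le (theta : R) D : 0 <= theta <= 2^-1 ->
  \sum_(1 <= k < D.+1) theta ^+ k <= 2 * theta.
Proof.
move=> /andP[t0 t1].
(* The tail is added to the left side so that the induction on [D] closes. *)
suff : \sum_(1 <= k < D.+1) theta ^+ k + 2 * theta ^+ D.+1 <= 2 * theta.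
  by apply: le_trans; rewrite lerDl mulr_ge0// exprn_ge0.
elim: D => [|D IH]; first by rewrite big_nil add0r expr1.
rewrite big_nat_recr//=; apply: le_trans IH; rewrite -addrA lerD2l.
have h : 0 <= theta ^+ D.+1 by rewrite exprn_ge0.
have h2 : theta ^+ D.+2 <= 2^-1 * theta ^+ D.+1 by rewrite exprS ler_wpM2r.
lra.
Qed.

Lemma ln_le_powR (x eps : R) : 0 < x -> 0 < eps -> ln x <= eps^-1 * x `^ eps.
Proof.
move=> x0 e0; rewrite ler_pdivlMl// -ln_powR.
by apply/ltW/ln_sublinear; exact: powR_gt0.
Qed.

Lemma sqrt_sub1_le (t : R) : 0 <= t -> `|Num.sqrt t - 1| <= `|t - 1|.
Proof.
move=> t0; have s0 := sqrtr_ge0 t.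
have -> : t - 1 = (Num.sqrt t - 1) * (Num.sqrt t + 1) by rewrite -{1}(sqr_sqrtr t0); ring.
rewrite normrM ler_peMr//.
by rewrite ger0_norm ?addr_ge0// lerDr.
Qed.

(* rho is max(1, n)^(1/kap); ln x is bounded by x^eps / eps with eps = delta / 8. *)
Lemma rate_bound (kap q D n m : nat) (C1 C2 gamma x : R) :
  (0 < kap)%N -> 0 < gamma -> 0 < C1 -> 0 < C2 -> 1 <= x -> (0 < m)%N -> x <= 2 * m%:R ->
  D%:R <= C1 * ln x ^+ 2 -> n%:R <= C2 * x `^ (kap%:R / 2 - gamma) ->
  exists rho, [/\ 1 <= rho, n%:R <= rho ^+ kap &
    let delta := Num.min gamma (kap%:R / 2) / kap%:R in
    Num.sqrt (D.*2%:R / m%:R) * (D%:R * rho * q%:R ^+ 2) <=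
    (2 * q%:R ^+ 2 * (1 + C2) `^ (kap%:R^-1) * C1 ^+ 2 * ((delta / 8)^-1) ^+ 4) * x `^ (- (delta / 2))].
Proof.
move=> kap0 g0 C10 C20 x1 m0 xm hD hn.
have kR : 0 < kap%:R :> R by rewrite ltr0n.
have x0 : 0 < x by exact: lt_le_trans x1.
(* Cutting [gamma] at [kap/2] keeps the exponent of [x] nonnegative, so that the power also
   dominates the 1 in [max(1, n)]. *)
set g' := Num.min gamma (kap%:R / 2).
have g'0 : 0 < g' by rewrite lt_min g0 divr_gt0.
have g'1 : g' <= gamma by rewrite ge_min lexx.
have g'2 : g' <= kap%:R / 2 by rewrite ge_min lexx orbT.
pose a : R := Num.max 1 n%:R.
have a1 : 1 <= a by rewrite le_max lexx.
have aC : a <= (1 + C2) * x `^ (kap%:R / 2 - g').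
  have p1 : 1 <= x `^ (kap%:R / 2 - g') by rewrite -[leLHS](powRr0 x) ler_powR// subr_ge0.
  rewrite ge_max; apply/andP; split.
    by rewrite -[leLHS]mulr1 ler_pM// lerDl ltW.
  apply: le_trans hn _; rewrite ler_pM ?powR_ge0 ?(ltW C20)//; first by rewrite lerDr.
  by rewrite ler_powR// lerD2l lerN2.
exists (a `^ kap%:R^-1); split.
- by rewrite -[leLHS](powRr0 a) ler_powR// invr_ge0 ltW.
- rewrite -powR_mulrn ?powR_ge0// -powRrM mulVf ?gt_eqF// powRr1; last by apply: le_trans a1.
  by rewrite /a le_max lexx orbT.
move=> delta.
have d0 : 0 < delta by rewrite divr_gt0.
have rho_le : a `^ kap%:R^-1 <= (1 + C2) `^ (kap%:R^-1) * x `^ (2^-1 - delta).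
  apply: le_trans (_ : ((1 + C2) * x `^ (kap%:R / 2 - g')) `^ kap%:R^-1 <= _).
    apply: ge0_ler_powR aC; rewrite ?invr_ge0 ?nnegrE ?(ltW kR)//; first exact: le_trans a1.
    by rewrite mulr_ge0 ?powR_ge0// addr_ge0// ltW.
  rewrite powRM ?powR_ge0//; last by rewrite addr_ge0// ltW.
  rewrite -powRrM (_ : (kap%:R / 2 - g') * kap%:R^-1 = 2^-1 - delta)// /delta.
  by field; rewrite gt_eqF.
(* Replacing the square root of [D] by [D] is wasteful but harmless: [D] is polylogarithmic, and
   half of the exponent [delta] is kept to pay for [D^2]. *)
have sq_le : Num.sqrt (D.*2%:R / m%:R) <= 2 * D%:R * x `^ (- 2^-1) :> R.
  rewrite powRN powR12_sqrt ?(ltW x0)// ler_pdivlMr ?sqrtr_gt0// -sqrtrM; last first.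
    by rewrite divr_ge0.
  rewrite -[leRHS]ger0_norm ?mulr_ge0// -sqrtr_sqr ler_sqrt; last exact: sqr_ge0.
  rewrite mulrAC ler_pdivrMr ?ltr0n//.
  have DD : (D%:R : R) <= D%:R ^+ 2 by rewrite -natrX ler_nat; case: (D) => // k; rewrite -mulnn leq_pmulr.
  have -> : D.*2%:R = 2 * D%:R :> R by rewrite -mul2n natrM.
  apply: le_trans (_ : 2 * D%:R ^+ 2 * (2 * m%:R) <= _); last by rewrite le_eqVlt; apply/orP; left; apply/eqP; ring.
  by rewrite ler_pM ?(ltW x0) ?mulr_ge0// ler_wpM2l.
have ln0 : 0 <= ln x by exact: ln_ge0.
have ln_le : ln x ^+ 4 <= ((delta / 8)^-1) ^+ 4 * x `^ (delta / 2).
  have e0 : 0 < delta / 8 by rewrite divr_gt0.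
  apply: le_trans (_ : ((delta / 8)^-1 * x `^ (delta / 8)) ^+ 4 <= _).
    by rewrite lerXn2r ?nnegrE ?mulr_ge0 ?powR_ge0 ?invr_ge0 ?(ltW e0)//; exact: ln_le_powR.
  rewrite exprMn -[(x `^ _) ^+ 4]powR_mulrn ?powR_ge0// -powRrM.
  by rewrite (_ : delta / 8 * 4 = delta / 2)//; field.
have D2 : D%:R ^+ 2 <= C1 ^+ 2 * (((delta / 8)^-1) ^+ 4 * x `^ (delta / 2)).
  apply: le_trans (_ : (C1 * ln x ^+ 2) ^+ 2 <= _).
    by rewrite lerXn2r ?nnegrE// mulr_ge0 ?sqr_ge0// ltW.
  by rewrite exprMn -exprM ler_wpM2l ?sqr_ge0.
set A := (1 + C2) `^ kap%:R^-1 in rho_le *.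
have A0 : 0 <= A by exact: powR_ge0.
apply: le_trans (_ : (2 * D%:R * x `^ (- 2^-1)) * (D%:R * (A * x `^ (2^-1 - delta)) * q%:R ^+ 2) <= _).
  rewrite ler_pM ?sqrtr_ge0 ?mulr_ge0 ?powR_ge0 ?sqr_ge0//.
  by rewrite ler_wpM2r ?sqr_ge0// ler_wpM2l.
have -> : (2 * D%:R * x `^ (- 2^-1)) * (D%:R * (A * x `^ (2^-1 - delta)) * q%:R ^+ 2) =
   (2 * q%:R ^+ 2 * A) * x `^ (- delta) * D%:R ^+ 2.
  have -> : x `^ (- delta) = x `^ (- 2^-1) * x `^ (2^-1 - delta).
    by rewrite -powRD ?(gt_eqF x0) ?implybT//; congr (_ `^ _); ring.
  ring.
apply: le_trans (_ : (2 * q%:R ^+ 2 * A) * x `^ (- delta) *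
   (C1 ^+ 2 * (((delta / 8)^-1) ^+ 4 * x `^ (delta / 2))) <= _).
  by rewrite ler_wpM2l// !mulr_ge0 ?powR_ge0 ?sqr_ge0.
have -> : x `^ (- (delta / 2)) = x `^ (- delta) * x `^ (delta / 2).
  by rewrite -powRD ?(gt_eqF x0) ?implybT//; congr (_ `^ _); field.
by rewrite le_eqVlt; apply/orP; left; apply/eqP; ring.
Qed.

End asymptotics.

Section fixed_dimension.
Variables (R : realType) (r : nat) (P : probability ('rV[R]_r * R)%type R).
Variable S : {vspace 'rV[R]_r}.
Variable kappa : R.-pker 'rV[R]_(\dim (perp S)) ~> ('rV[R]_(\dim S) * R)%type.
Hypothesis dis : is_disintegration P S kappa.
Variable kap : nat.
Hypothesis lk : leap_index P S kap.
Local Notation q := (\dim (perp S)).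
Variables (m n D : nat) (mu : probability 'M[R]_(m, q) R).
Hypotheses (qm : (q <= m)%N) (hmu : is_haar mu).
Local Notation H0 := (null_law P S m n).
Local Notation H1 := (planted_law S m n kappa mu).

Lemma low_degree_LR_exists : exists f, is_low_degree_LR H0 H1 D f.
Proof.
(* The moments are computed for [m] written as [l + q]; as types depend on [m], the Haar law is
   generalised before the substitution. *)
have [l mE] : exists l, m = (l + q)%N by exists (m - q)%N; rewrite subnK.
move: mu hmu; rewrite mE => mu' hmu'.
exists (low_degree_ratio dis lk mu' D); exact: is_LR_low_degree_ratio.
Qed.

Lemma low_degree_LR_bound f (rho theta : R) : is_low_degree_LR H0 H1 D f ->
  (0 < m)%N -> 1 <= rho -> n%:R <= rho ^+ kap ->
  Num.sqrt (D.*2%:R / m%:R) * (D%:R * rho * q%:R ^+ 2) <= theta -> theta <= 2^-1 ->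
  Lnorm H0 2%:E (EFin \o f) = (Num.sqrt (Ex H0 (fun s => f s ^+ 2)))%:E /\
  `|Num.sqrt (Ex H0 (fun s => f s ^+ 2)) - 1| <= (q ^ 2)%:R * (2 * theta).
Proof.
move=> hf m0 rho1 nrho th th2.
have sf : sqi H0 f by apply/Lfun2P; exact: hf.1.1.
split; first exact: Lnorm2E.
apply: le_trans (sqrt_sub1_le _) _; first by apply: Ex_ge0 => s; exact: sqr_ge0.
have [l mE] : exists l, m = (l + q)%N by exists (m - q)%N; rewrite subnK.
move: mu hmu f hf m0 th {sf}; rewrite mE => mu' hmu' f hf m0 th.
rewrite (is_LR_norm dis lk hmu' hf).
have kap0 : (0 < kap)%N by case: lk.
apply: le_trans (low_degree_ratio_bound dis lk hmu' D m0 kap0 rho1 nrho) _.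
rewrite -mulr_sumr ler_wpM2l//.
have rho0 : 0 <= rho by exact: le_trans rho1.
have th0 : 0 <= theta.
  by apply: le_trans th; rewrite mulr_ge0 ?sqrtr_ge0// mulr_ge0 ?sqr_ge0// mulr_ge0.
apply: le_trans (sum_expr_le D _); last by rewrite th0.
apply: ler_sum_nat => k /andP[k1 kD]; rewrite lerXn2r ?nnegrE//.
  by rewrite mulr_ge0 ?sqrtr_ge0// mulr_ge0 ?sqr_ge0// mulr_ge0.
apply: le_trans th; rewrite ler_pM ?sqrtr_ge0//.
- by rewrite mulr_ge0 ?sqr_ge0// mulr_ge0.
- rewrite ler_sqrt ?divr_ge0// ler_wpM2r ?invr_ge0// ler_nat leq_double -ltnS//.
- by rewrite ler_wpM2r ?sqr_ge0// ler_wpM2r// ler_nat -ltnS.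
Qed.

End fixed_dimension.

Unset Implicit Arguments.

Theorem theorem1 (R : realType) (r : nat)
    (P : probability ('rV[R]_r * R)%type R)
    (L : nat) (S : nat -> {vspace 'rV[R]_r}) (k : nat -> nat) (kstar : nat)
    (Sbar : {vspace 'rV[R]_r})
    (kappa : R.-pker 'rV[R]_(\dim (perp Sbar)) ~> ('rV[R]_(\dim Sbar) * R)%type)
    (haar : forall d : nat,
        probability 'M[R]_(d - \dim Sbar, \dim (perp Sbar)) R)
    (gamma : R) (D n : nat -> nat) :
  (1 <= r)%N ->
  gaussian_input P ->
  intrinsic_dimension P ->
  leap_decomposition P L S k ->
  kstar = leap_exponent L k ->
  (exists2 i, (i < L)%N & Sbar = S i) ->
  leap_index P Sbar kstar ->
  is_disintegration P Sbar kappa ->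
  (forall d, (r <= d)%N -> is_haar (haar d)) ->
  0 < gamma ->
  (fun d => (D d)%:R : R^o) =O_\oo (fun d => ln d%:R ^+ 2 : R^o) ->
  (fun d => (n d)%:R : R^o) =O_\oo
    (fun d => d%:R `^ (kstar%:R / 2 - gamma) : R^o) ->
  let H0 d := null_law P Sbar (d - \dim Sbar) (n d) in
  let H1 d := planted_law Sbar (d - \dim Sbar) (n d) kappa (haar d) in
  (forall d, (r <= d)%N -> exists f, is_low_degree_LR (H0 d) (H1 d) (D d) f) /\
  (forall f, (forall d, (r <= d)%N ->
                is_low_degree_LR (H0 d) (H1 d) (D d) (f d)) ->
     Lnorm (H0 d) 2%:E (EFin \o f d) @[d --> \oo] --> 1%E).
Proof.
move=> r1 _ _ _ _ _ lk dis hhaar gamma0 OD On H0 H1.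
have kap0 : (0 < kstar)%N by case: lk.
set q := \dim (perp Sbar).
have qd d : (r <= d)%N -> (q <= d - \dim Sbar)%N by move=> rd; rewrite /q dimv_perp leq_sub2r.
split=> [d rd|f hf].
  exact: (low_degree_LR_exists dis lk _ _ (qd d rd) (hhaar d rd)).
have /eqO_exP[C1 C10 hC1] := OD; have /eqO_exP[C2 C20 hC2] := On.
set delta := Num.min gamma (kstar%:R / 2) / kstar%:R.
have delta0 : 0 < delta.
  by rewrite divr_gt0 ?ltr0n// lt_min gamma0 divr_gt0// ltr0n.
set K := (2 * q%:R ^+ 2 * (1 + C2) `^ (kstar%:R^-1) * C1 ^+ 2 * ((delta / 8)^-1) ^+ 4).
have main eta : 0 < eta -> eta <= 2^-1 -> \forall d \near \oo,
    Lnorm (H0 d) 2%:E (EFin \o f d) = (Num.sqrt (Ex (H0 d) (fun s => f d s ^+ 2)))%:E /\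
    `|Num.sqrt (Ex (H0 d) (fun s => f d s ^+ 2)) - 1| <= (q ^ 2)%:R * (2 * eta).
  move=> eta0 eta1; near=> d.
  have rd : (r <= d)%N by near: d; exact: nbhs_infty_ge.
  (* This makes the effective dimension positive and at least [d/2], as [rate_bound] requires. *)
  have d2 : (2 * r + 2 <= d)%N by near: d; exact: nbhs_infty_ge.
  have dS : (\dim Sbar <= r)%N.
    by rewrite (leq_trans (dimvS (subvf _)))// dimvf [X in (X <= _)%N](mul1n r).
  have m0 : (0 < d - \dim Sbar)%N by lia.
  have x1 : 1 <= d%:R :> R by rewrite ler1n; lia.
  have x0 : 0 < d%:R :> R by exact: lt_le_trans x1.
  have xm : d%:R <= 2 * (d - \dim Sbar)%:R :> R by rewrite -natrM ler_nat; lia.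
  have hD : (D d)%:R <= C1 * ln (d%:R : R) ^+ 2.
    have : `|(D d)%:R : R| <= C1 * `|ln (d%:R : R) ^+ 2| by near: d.
    by rewrite !ger0_norm ?sqr_ge0.
  have hn : (n d)%:R <= C2 * d%:R `^ (kstar%:R / 2 - gamma).
    have : `|(n d)%:R : R| <= C2 * `|(d%:R : R) `^ (kstar%:R / 2 - gamma)| by near: d.
    by rewrite !ger0_norm ?powR_ge0.
  have [rho [rho1 nrho th]] := rate_bound q kap0 gamma0 C10 C20 x1 m0 xm hD hn.
  apply: (low_degree_LR_bound dis lk (qd d rd) (hhaar d rd) (hf d rd) m0 rho1 nrho _ eta1).
  apply: le_trans th _; rewrite -/delta -/K powRN ler_pdivrMr ?powR_gt0//.
  have K0 : 0 <= K.
    apply: mulr_ge0; last by rewrite exprn_ge0// invr_ge0 divr_ge0// ltW.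
    apply: mulr_ge0; last exact: sqr_ge0.
    by rewrite mulr_ge0 ?powR_ge0// mulr_ge0// sqr_ge0.
  rewrite mulrC -ler_pdivrMr//.
  (* The threshold is obtained by solving [K d^(-delta/2) <= eta] for [d]. *)
  have : (K / eta) `^ (delta / 2)^-1 <= d%:R by near: d; exact: nbhs_infty_ger.
  move=> /(ge0_ler_powR (ltW (divr_gt0 delta0 (ltr0n R 2)))).
  rewrite !nnegrE powR_ge0 (ltW x0) => /(_ isT isT).
  have dd : (delta / 2)^-1 * (delta / 2) = 1 by rewrite mulVf// gt_eqF// divr_gt0.
  by rewrite -powRrM dd powRr1// divr_ge0// ltW.
have q1 : 0 < (q ^ 2)%:R * 2 + 1 :> R by rewrite ltr_wpDl.
apply: (cvg_EFin (a := 1)).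
  by apply: filterS (main 2^-1 _ (lexx _)) => [d [-> _]|]; rewrite ?invr_gt0.
apply/cvgrPdist_le => eps eps0.
(* The cap [1/2] is the one under which the geometric series is summed; the added 1 keeps the
   denominator positive whatever [q] is. *)
have e0 : 0 < Num.min 2^-1 (eps / ((q ^ 2)%:R * 2 + 1)).
  by rewrite lt_min invr_gt0 ltr0n divr_gt0.
have e1 : Num.min 2^-1 (eps / ((q ^ 2)%:R * 2 + 1)) <= 2^-1 :> R by rewrite ge_min lexx.
apply: filterS (main _ e0 e1) => d [E le1]; rewrite /= E /= distrC.
apply: le_trans le1 _; rewrite mulrA.
apply: le_trans (_ : ((q ^ 2)%:R * 2) * (eps / ((q ^ 2)%:R * 2 + 1)) <= _).
  by rewrite ler_wpM2l ?mulr_ge0// ge_min lexx orbT.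
by rewrite mulrA ler_pdivrMr// mulrC ler_wpM2l ?(ltW eps0)// lerDl.
Unshelve. all: by end_near.
Qed.
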